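(* Let $k\ge3$ be an integer. There exists a constant $C>0$ such that, for every $\gamma\in(0,1)$, there exists $\Delta_0\in\mathbb{N}$ with the following property. Let $\Delta\ge\Delta_0$, $n\in\mathbb{N}$, and set $$q:=\frac{C}{\gamma^{4k}}\left(\frac{\Delta}{\log\Delta}\right)^{\frac{1}{k-1}}.$$ Let $\mathcal{H}$ be an $n$-vertex $k$-uniform linear hypergraph of maximum degree at most $\Delta$. There exists a randomized single-pass streaming algorithm that computes a proper $q$-coloring of $\mathcal{H}$ with probability at least $1-1/n$ using $O(n^{1+\gamma})$ space.
   Context: A hypergraph is a pair $(V,E)$ with $V$ a finite set and $E\subseteq 2^V$; it is $k$-uniform if every edge has exactly $k$ elements, and linear if any two distinct edges share at most one vertex. The degree of a vertex is the number of edges containing it. A proper $q$-coloring is an assignment of at most $q$ colors to the vertices with no monochromatic edge ($q$ need not be an integer; floors and ceilings are suppressed). Streaming model: the vertex set and the parameters are known in advance, and the edges of the hypergraph are presented one by one, in arbitrary order, to an algorithm with limited memory; a single-pass algorithm reads the stream exactly once, and then outputs its answer. The space is the maximum memory used, measured in machine words (a vertex name, edge, color or counter occupies $O(1)$ words). Implicit constants may depend on $k$ and $\gamma$. $\log$ is the natural logarithm. *)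

(* Defs.v *)
From HB Require Import structures.
From mathcomp Require Import all_boot all_order all_algebra.
From mathcomp Require Import reals exp.

Set Implicit Arguments.
Unset Strict Implicit.
Unset Printing Implicit Defensive.

Import Order.TTheory GRing.Theory Num.Theory.
Local Open Scope ring_scope.

Section Hypergraph.
Variable V : finType.
Implicit Types (E : {set {set V}}) (e : {set V}) (c : V -> nat).

Definition k_uniform (k : nat) E : bool := [forall e in E, #|e| == k].

Definition linear_hypergraph E : bool :=
  [forall e in E, forall f in E, (e != f) ==> (#|e :&: f| <= 1)%N].

Definition degree E (v : V) : nat := #|[set e in E | v \in e]|.

Definition max_degree E : nat := \max_(v : V) degree E v.

Definition monochromatic c e : bool :=
  [forall u in e, forall v in e, c u == c v].

Definition num_colors c : nat := size (undup (codom c)).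

(* Colors are named by natural numbers. The bound q is real: at most q colors
   means at most floor(q) of them. *)
Definition proper_coloring (R : realType) (q : R) E c : bool :=
  ((num_colors c)%:R <= q) && [forall e in E, ~~ monochromatic c e].

End Hypergraph.

(* Number of binary digits of n (and 1 for n = 0), so that a word stores
   Theta(log n) bits and can hold any value in {0, ..., n}. *)
Definition word_bits (n : nat) : nat := (trunc_log 2 n).+1.

Definition word (n : nat) : finType := (word_bits n).-tuple bool.

(* Randomized single-pass streaming algorithms on the known vertex set V. The
   memory is an array of [num_words] machine words. The initialization, the
   processing of each edge and the output each draw a fresh, independent,
   uniformly random element of the finite type [coins]; earlier draws and
   earlier edges influence the computation only through the memory. *)
Record streaming_algorithm (V : finType) := StreamingAlgorithm {
  num_words : nat;
  coins : finType;
  coins_gt0 : (0 < #|coins|)%N;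
  alg_init : coins -> num_words.-tuple (word #|V|);
  alg_step : coins -> {set V} -> num_words.-tuple (word #|V|) ->
              num_words.-tuple (word #|V|);
  alg_output : coins -> num_words.-tuple (word #|V|) -> V -> nat
}.

Section Run.
Variables (V : finType) (A : streaming_algorithm V) (s : seq {set V}).

Definition randomness : finType :=
  (coins A * (size s).-tuple (coins A) * coins A)%type.

Definition run (w : randomness) : V -> nat :=
  let: (w_init, w_steps, w_out) := w in
  alg_output w_out
    (foldl (fun m x => alg_step x.1 x.2 m) (alg_init w_init) (zip w_steps s)).

End Run.

Definition uniform_prob (R : realType) (T : finType) (P : pred T) : R :=
  #|[set w | P w]|%:R / #|T|%:R.

Definition palette_size (R : realType) (k : nat) (C gamma : R) (Delta : nat) : R :=
  C / gamma ^+ (4 * k) * (Delta%:R / ln Delta%:R) `^ (k.-1%:R^-1).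

(* Main.v *)
Require Import Defs.
From HB Require Import structures.
From mathcomp Require Import all_boot all_order all_algebra.
From mathcomp Require Import reals sequences exp.
From mathcomp Require Import zify ring lra.

Set Implicit Arguments.
Unset Strict Implicit.
Unset Printing Implicit Defensive.

Import Order.TTheory GRing.Theory Num.Theory.
Local Open Scope ring_scope.

(* Colour classes are independent samples of a random independent set. A vertex is first kept
   with a small probability, after which short cycles through a given vertex are unlikely.
   Then come T rounds, T of order log Delta, in which the vertices in play become active at
   a rate that doubles from round to round. A vertex is discarded when an edge through it
   would be completed, or by an extra coin whose bias makes the survival probability of
   every round exactly 1/2 whatever the history; otherwise it joins if it is active. Thanks
   to this equalisation the states of the vertices near v evolve like independent Markov
   chains, so an exponential moment shows that v is rarely under more threats than
   the extra coin can compensate for, and v joins with probability of order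
   (log Delta / Delta)^(1/(k-1)).
   By the local lemma, O((Delta / log Delta)^(1/(k-1))) such sets can be chosen so that the
   vertices they miss induce a hypergraph of degree at most Delta / 2^(k-1); iterating, the
   palettes form a geometric series.
   The streaming algorithm splits the vertices at random into P classes and stores only the
   edges inside a class, P being such that these have degree O(n^gamma). A vertex is coloured
   by the pair of its class and its colour in a colouring of the stored hypergraph. *)

(** * Finite product probability spaces *)

(** The doubling rates produce the logarithm. A vertex is in play after [i] rounds with probability
    about [2 ^- i], which the rate [2 ^ i / N] offsets, so every round adds about [1 / N] to the
    chance of joining, [T / N] in all. A threat has at least one vertex still in play, so only
    [k - 2] of its [k - 1] other vertices bring in a factor [T]: its mean weight is of order
    [T ^ (k - 2) / N ^ (k - 1)]. After sampling with density [1 / M], a degree [D] is bearable while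
    [T ^ (k - 2) * D] stays below a constant times [(M * N) ^ (k - 1)]; at equality [T / (M * N)]
    has order [(T / D) ^ (1 / (k - 1))]. The exponential moment factorises only if the neighbours of
    [v] look at disjoint sets of coins, and no girth is assumed: this is why [M] has to be a large
    power of [N]. In the streaming part the classes are coloured at degree about [n ^ gamma], whose
    logarithm is [gamma * log n]; this is the loss in [gamma]. When [Delta] exceeds [n], linearity
    bounds the degree by [n], and [n / log n] is at most [Delta / log Delta]. *)

Record coin_law (R : realType) (J X : finType) := CoinLaw {
  law :> J -> X -> R;
  law_ge0 : forall j x, 0 <= law j x;
  law_sum1 : forall j, \sum_x law j x = 1 }.

Definition depends_on (J X : finType) (T : Type) (S : {set J})
    (f : {ffun J -> X} -> T) :=
  forall w w' : {ffun J -> X}, (forall j, j \in S -> w j = w' j) -> f w = f w'.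

Definition merge (J X : finType) (S : {set J}) (w w' : {ffun J -> X}) :=
  [ffun j => if j \in S then w j else w' j].

Section Expectation.
Variables (R : realType) (J X : finType) (p : coin_law R J X).
Implicit Types (f g h : {ffun J -> X} -> R) (w : {ffun J -> X}) (S : {set J}).
Implicit Types (A B : pred {ffun J -> X}).

Definition mass w : R := \prod_j p j (w j).
Definition Ex f : R := \sum_w mass w * f w.
Definition Pr (A : pred {ffun J -> X}) : R := Ex (fun w => (A w)%:R).

Lemma mass_ge0 w : 0 <= mass w.
Proof. by apply: prodr_ge0 => j _; exact: law_ge0. Qed.

Lemma Ex_prod (g : J -> X -> R) :
  Ex (fun w => \prod_j g j (w j)) = \prod_j \sum_x p j x * g j x.
Proof.
rewrite bigA_distr_bigA /=; apply: eq_bigr => w _.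
by rewrite /mass -big_split.
Qed.

Lemma eq_Ex f g : f =1 g -> Ex f = Ex g.
Proof. by move=> e; apply: eq_bigr => w _; rewrite e. Qed.

Lemma eq_Pr (A B : pred {ffun J -> X}) : A =1 B -> Pr A = Pr B.
Proof. by move=> e; apply: eq_Ex => w; rewrite e. Qed.

Lemma Ex_cst c : Ex (fun=> c) = c.
Proof.
rewrite /Ex -mulr_suml -[RHS]mul1r; congr (_ * _).
have := Ex_prod (fun _ _ => 1); rewrite /Ex => e.
transitivity (\sum_w mass w * \prod_(j : J) (1 : R)).
  by apply: eq_bigr => w _; rewrite big1 ?mulr1.
rewrite e big1 // => j _.
by under eq_bigr do rewrite mulr1; exact: law_sum1.
Qed.

Lemma ExD f g : Ex (fun w => f w + g w) = Ex f + Ex g.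
Proof. by rewrite /Ex -big_split; apply: eq_bigr => w _; rewrite mulrDr. Qed.

Lemma ExZ c f : Ex (fun w => c * f w) = c * Ex f.
Proof. by rewrite /Ex mulr_sumr; apply: eq_bigr => w _; rewrite mulrCA. Qed.

Lemma ExB f g : Ex (fun w => f w - g w) = Ex f - Ex g.
Proof.
by rewrite /Ex -sumrB; apply: eq_bigr => w _; rewrite mulrBr.
Qed.

Lemma Ex_sum (I : Type) (r : seq I) (P : pred I) (F : I -> {ffun J -> X} -> R) :
  Ex (fun w => \sum_(i <- r | P i) F i w) = \sum_(i <- r | P i) Ex (F i).
Proof.
rewrite /Ex exchange_big /=; apply: eq_bigr => w _; exact: mulr_sumr.
Qed.

Lemma Ex_le f g : (forall w, f w <= g w) -> Ex f <= Ex g.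
Proof.
by move=> le; apply: ler_sum => w _; apply: ler_wpM2l (le w); exact: mass_ge0.
Qed.

Lemma Ex_ge0 f : (forall w, 0 <= f w) -> 0 <= Ex f.
Proof. by move=> f0; rewrite -(Ex_cst 0); exact: Ex_le. Qed.

Lemma Pr_ge0 A : 0 <= Pr A.
Proof. by apply: Ex_ge0 => w; case: (A w). Qed.

Lemma Pr_le A B : (forall w, A w -> B w) -> Pr A <= Pr B.
Proof.
move=> AB; apply: Ex_le => w; rewrite ler_nat.
by move: (AB w); case: (A w) => // ->.
Qed.

Lemma Pr_union A B : Pr (fun w => A w || B w) <= Pr A + Pr B.
Proof.
rewrite -ExD; apply: Ex_le => w.
by rewrite -natrD ler_nat; case: (A w); case: (B w).
Qed.

Lemma Pr_exists (I : finType) (P : pred I) (A : I -> pred {ffun J -> X}) :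
  Pr (fun w => [exists i, P i && A i w]) <= \sum_(i | P i) Pr (A i).
Proof.
rewrite -Ex_sum; apply: Ex_le => w.
case: existsP => [[i /andP[Pi Ai]]|_]; last by apply: sumr_ge0 => i _; case: (A i w).
by rewrite (bigD1 i) //= Ai lerDl sumr_ge0 // => j _; case: (A j w).
Qed.

Lemma Pr_diff A B : Pr (fun w => A w && ~~ B w) = Pr A - Pr (fun w => A w && B w).
Proof.
apply/eqP; rewrite eq_sym subr_eq -ExD; apply/eqP/eq_Ex => w.
by rewrite -natrD; case: (A w); case: (B w).
Qed.

Lemma markov_exp f (A : pred {ffun J -> X}) c :
  0 < c -> (forall w, 0 <= f w) -> (forall w, A w -> c <= f w) -> Pr A <= Ex f / c.
Proof.
move=> c0 f0 Af; rewrite ler_pdivlMr // mulrC -ExZ; apply: Ex_le => w.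
by case: (boolP (A w)) => [/Af|_]; rewrite ?mulr1 ?mulr0.
Qed.

(* The pair [(w, w')] and the pair obtained by exchanging the coordinates
   outside [S] have the same joint mass. *)
Lemma Ex_swap S (F : {ffun J -> X} -> {ffun J -> X} -> R) :
  Ex (fun w' => Ex (fun w => F w w')) =
  Ex (fun w' => Ex (fun w => F (merge S w w') (merge S w' w))).
Proof.
rewrite /Ex.
under eq_bigr do rewrite mulr_sumr.
under [RHS]eq_bigr do rewrite mulr_sumr.
rewrite !pair_big /=.
pose s (u : {ffun J -> X} * {ffun J -> X}) := (merge S u.1 u.2, merge S u.2 u.1).
have sK : involutive s.
  case=> w w'; rewrite /s /=.
  have mK (u u' : {ffun J -> X}) : merge S (merge S u u') (merge S u' u) = u.
    by apply/ffunP => j; rewrite !ffunE; case: (j \in S).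
  by rewrite !mK.
rewrite [LHS](reindex_inj (inv_inj sK)); apply: eq_bigr => -[w w'] _ /=.
rewrite !mulrA; congr (_ * _); rewrite /mass -!big_split /=.
apply: eq_bigr => j _; rewrite !ffunE; case: (j \in S) => //; exact: mulrC.
Qed.

(** Stands in for conditional expectation: the outer [w'] fixes the coordinates outside [S], the
    inner expectation averages over those in [S]. *)
Lemma Ex_tower S h : Ex h = Ex (fun w' => Ex (fun w => h (merge S w w'))).
Proof.
rewrite -(Ex_swap S (fun w _ => h w)) [RHS](@eq_Ex _ (fun=> Ex h)) ?Ex_cst //.
Qed.

Lemma Ex_indep S S' f g : depends_on S f -> depends_on S' g ->
  [disjoint S & S'] -> Ex (fun w => f w * g w) = Ex f * Ex g.
Proof.
move=> fS gS' dis; rewrite (Ex_tower S) -ExZ; apply: eq_Ex => w'.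
rewrite mulrC -ExZ; apply: eq_Ex => w; rewrite mulrC; congr (_ * _).
  by apply: gS' => j jS'; rewrite ffunE (disjointFl dis jS').
by apply: fS => j jS; rewrite ffunE jS.
Qed.

Lemma depends_onW (T : Type) S S' (f : {ffun J -> X} -> T) :
  S \subset S' -> depends_on S f -> depends_on S' f.
Proof. by move=> /subsetP SS' fS w w' e; apply: fS => j /SS'; exact: e. Qed.

Lemma depends_on_prod (I : finType) (r : seq I) S' (f : I -> {ffun J -> X} -> R) :
  (forall i, i \in r -> depends_on S' (f i)) ->
  depends_on S' (fun w => \prod_(i <- r) f i w).
Proof.
move=> fS w w' e; rewrite big_seq [RHS]big_seq; apply: eq_bigr => i ir.
exact: fS.
Qed.

Lemma Ex_prod_indep_seq (I : finType) (r : seq I) (S : I -> {set J})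
    (f : I -> {ffun J -> X} -> R) :
  uniq r -> (forall i, i \in r -> depends_on (S i) (f i)) ->
  (forall i i', i \in r -> i' \in r -> i != i' -> [disjoint S i & S i']) ->
  Ex (fun w => \prod_(i <- r) f i w) = \prod_(i <- r) Ex (f i).
Proof.
elim: r => [|i r IH] /= => [_ _ _|/andP[ir ur] fS dis].
  by rewrite big_nil -[RHS]Ex_cst; apply: eq_Ex => w; rewrite big_nil.
rewrite big_cons -IH //; first last.
- by move=> a b ar br; apply: dis; rewrite inE ?ar ?br orbT.
- by move=> a ar; apply: fS; rewrite inE ar orbT.
rewrite -(@Ex_indep (S i) (\bigcup_(a in r) S a)).
- by apply: eq_Ex => w; rewrite big_cons.
- by apply: fS; rewrite mem_head.
- apply: depends_on_prod => a ar; apply: depends_onW (fS a _).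
    exact: bigcup_sup.
  by rewrite inE ar orbT.
- apply: bigcup_disjoint => a ar.
  by apply: dis; rewrite ?inE ?eqxx ?ar ?orbT //;
    apply: contraNneq ir => ->.
Qed.

Lemma Ex_prod_indep (I : finType) (A : {set I}) (S : I -> {set J})
    (f : I -> {ffun J -> X} -> R) :
  (forall i, i \in A -> depends_on (S i) (f i)) ->
  (forall i i', i \in A -> i' \in A -> i != i' -> [disjoint S i & S i']) ->
  Ex (fun w => \prod_(i in A) f i w) = \prod_(i in A) Ex (f i).
Proof.
move=> fS dis; rewrite -big_enum /=.
rewrite -(@Ex_prod_indep_seq _ _ S) ?enum_uniq //.
- by apply: eq_Ex => w; rewrite -big_enum.
- by move=> i; rewrite mem_enum; exact: fS.
- by move=> i i'; rewrite !mem_enum; exact: dis.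
Qed.

Lemma Ex_coord_prod (A : {set J}) (g : J -> X -> R) :
  Ex (fun w => \prod_(j in A) g j (w j)) = \prod_(j in A) \sum_x p j x * g j x.
Proof.
pose g' j x := if j \in A then g j x else 1.
rewrite [RHS]big_mkcond /= [RHS](eq_bigr (fun j => \sum_x p j x * g' j x)).
  by rewrite -Ex_prod; apply: eq_Ex => w; rewrite big_mkcond.
move=> j _; rewrite /g'; case: ifP => // _.
by under eq_bigr do rewrite mulr1; rewrite law_sum1.
Qed.

Lemma Ex_coord j (g : X -> R) : Ex (fun w => g (w j)) = \sum_x p j x * g x.
Proof.
have := Ex_coord_prod [set j] (fun=> g); rewrite big_set1 => <-.
by apply: eq_Ex => w; rewrite big_set1.
Qed.

(** Markov's inequality for the number of [m]-subsets of [F] all of whose events hold: when [z]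
    events hold there are at least ['C(z, m)] such subsets. A bound for [m] simultaneous events thus
    becomes a tail bound. *)
Lemma Pr_count (I : finType) (F : {set I}) (A : I -> pred {ffun J -> X})
    (m z : nat) (t : R) :
  (forall B : {set I}, B \subset F -> #|B| = m ->
     Pr (fun w => [forall i in B, A i w]) <= t) ->
  Pr (fun w => (z <= #|[set i in F | A i w]|)%N) * 'C(z, m)%:R <=
    'C(#|F|, m)%:R * t.
Proof.
move=> At; rewrite mulrC -ExZ.
apply: (@le_trans _ _ (\sum_(B : {set I} | (B \subset F) && (#|B| == m))
    Pr (fun w => [forall i in B, A i w]))); last first.
  rewrite -cards_draws mulr_natl -sumr_const big_set /=.
  apply: ler_sum => B; rewrite ?inE => /andP[BF /eqP Bm]; exact: At.
rewrite -Ex_sum; apply: Ex_le => w.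
set Fw := [set i in F | A i w].
have -> : \sum_(B : {set I} | (B \subset F) && (#|B| == m))
    [forall i in B, A i w]%:R = 'C(#|Fw|, m)%:R :> R.
  rewrite -cards_draws -sum1_card natr_sum big_mkcond [RHS]big_mkcond /=.
  apply: eq_bigr => B _; rewrite inE.
  have -> : (B \subset Fw) = (B \subset F) && [forall i in B, A i w].
    apply/subsetP/andP => [BFw|[/subsetP BF /forallP BA] i iB].
      split; first by apply/subsetP => i /BFw; rewrite inE => /andP[].
      by apply/forallP => i; apply/implyP => /BFw; rewrite inE => /andP[].
    by rewrite inE BF //=; move: (BA i); rewrite iB.
  by case: (B \subset F); case: (#|B| == m); case: [forall i in B, A i w].
case: leqP => [zF|_]; last by rewrite mulr0 ler0n.
by rewrite mulr1 ler_nat; exact: leq_bin2l.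
Qed.

End Expectation.

(** * The symmetric local lemma *)

Section LocalLemma.
Variables (R : realType) (J X I : finType) (p : coin_law R J X).
Variables (bad : I -> pred {ffun J -> X}) (S : I -> {set J}) (x : R) (b : nat).
Hypothesis bad_dep : forall i, depends_on (S i) (bad i).
Hypothesis bad_small : forall i, Pr p (bad i) <= x.
Hypothesis few_neighbours : forall i, (#|[set i' | ~~ [disjoint S i & S i']]| <= b)%N.
Hypothesis b_gt0 : (0 < b)%N.
Hypothesis xb : 4 * x * b%:R <= 1.

Let none (U : {set I}) (w : {ffun J -> X}) := [forall i in U, ~~ bad i w].

Let none_dep (U : {set I}) : depends_on (\bigcup_(i in U) S i) (none U).
Proof.
move=> w w' e; apply: eq_forallb => i; case: (boolP (i \in U)) => //= iU.
congr (~~ _); apply: bad_dep => j jS; apply: e; apply/bigcupP; by exists i.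
Qed.

Let x_ge0 (i : I) : 0 <= x.
Proof. exact: le_trans (Pr_ge0 p (bad i)) (bad_small i). Qed.

(** The conditional bound [2 * x], multiplied out so that nothing is divided by a probability not
    yet known to be positive. The event [bad i] is independent of [none U2], where [U2] omits the
    neighbours [U1] of [i]; by induction the at most [b] events of [U1] take away at most half of
    [none U2], since [2 * x * b <= 1/2]. *)
Let local_step (U : {set I}) (i : I) :
  Pr p (fun w => bad i w && none U w) <= 2 * x * Pr p (none U).
Proof.
have [n] := ubnP #|U|; elim: n U i => // n IH U i; rewrite ltnS => Un.
pose U1 := [set i' in U | ~~ [disjoint S i & S i']]; pose U2 := U :\: U1.
have indep : Pr p (fun w => bad i w && none U2 w) = Pr p (bad i) * Pr p (none U2).
  rewrite /Pr -(@Ex_indep _ _ _ p (S i) (\bigcup_(a in U2) S a)).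
  - by apply: eq_Ex => w; rewrite -natrM mulnb.
  - by move=> w w' e; rewrite (bad_dep e).
  - by move=> w w' e; rewrite (none_dep e).
  - apply: bigcup_disjoint => a; rewrite !inE.
    by case: (a \in U); rewrite ?andbF //= andbT negbK.
have half : Pr p (none U2) <= 2 * Pr p (none U).
  have [U10|U1n0] := eqVneq U1 set0.
    rewrite /U2 U10 setD0 ler_peMl ?Pr_ge0 //; lra.
  have U2n : (#|U2| < n)%N.
    apply: leq_trans Un; apply: proper_card; rewrite properE subsetDl /=.
    have /set0Pn[a aU1] := U1n0; apply/subsetPn; exists a.
      by move: aU1; rewrite inE => /andP[].
    by rewrite inE aU1.
  have cover : Pr p (none U2) <= Pr p (none U) +
      \sum_(a in U1) Pr p (fun w => bad a w && none U2 w).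
    apply: le_trans (lerD (lexx _) (Pr_exists _ _ _)).
    apply: le_trans (Pr_union _ _ _); apply: Pr_le => w n2.
    apply/orP; case: (boolP (none U w)) => [|nU]; [by left|right].
    move: nU; rewrite negb_forall => /existsP[a]; rewrite negb_imply negbK => /andP[aU ba].
    apply/existsP; exists a; rewrite ba n2 !andbT.
    apply: contraTT ba => aU1; move/forallP: n2 => /(_ a).
    by rewrite inE aU aU1.
  have : \sum_(a in U1) Pr p (fun w => bad a w && none U2 w) <=
      b%:R * (2 * x * Pr p (none U2)).
    apply: (@le_trans _ _ (\sum_(a in U1) 2 * x * Pr p (none U2))).
      by apply: ler_sum => a _; exact: IH.
    rewrite sumr_const -[leLHS]mulr_natl; apply: ler_wpM2r.
      by rewrite !mulr_ge0 ?Pr_ge0 ?x_ge0.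
    rewrite ler_nat; apply: leq_trans (few_neighbours i); apply: subset_leq_card.
    by apply/subsetP => a; rewrite !inE => /andP[].
  have := xb; have := Pr_ge0 p (none U2); move: (Pr p (none U2)) (Pr p (none U)) cover.
  move=> y z; set s := \sum_(a in U1) _; nra.
apply: le_trans (_ : Pr p (fun w => bad i w && none U2 w) <= _).
  apply: Pr_le => w /andP[-> /forallP nU] /=; apply/forallP => a.
  by apply/implyP; rewrite inE => /andP[_ aU]; move: (nU a); rewrite aU.
rewrite indep -mulrA mulrCA; apply: ler_pM; rewrite ?Pr_ge0 ?bad_small //.
Qed.

Lemma local_lemma : exists w, forall i, ~~ bad i w.
Proof.
have pos (U : {set I}) : 0 < Pr p (none U).
  have [n] := ubnP #|U|; elim: n U => // n IH U; rewrite ltnS => Un.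
  have [->|/set0Pn[i iU]] := eqVneq U set0.
    rewrite (@eq_Pr _ _ _ p _ predT) /Pr ?Ex_cst // => w.
    by apply/forallP => i; rewrite inE.
  have lt : 0 < Pr p (none (U :\ i)).
    by apply: IH; apply: leq_trans Un; rewrite [X in (_ < X)%N](cardsD1 i) iU.
  have b1 : 1 <= b%:R :> R by rewrite ler1n.
  rewrite (@eq_Pr _ _ _ p _ (fun w => none (U :\ i) w && ~~ bad i w)); last first.
    move=> w; apply/forallP/andP => [nU|[/forallP nU bi] a].
      split; last by move: (nU i); rewrite iU.
      by apply/forallP => a; apply/implyP; rewrite inE => /andP[_ aU]; move: (nU a); rewrite aU.
    apply/implyP => aU; have [->//|ai] := eqVneq a i.
    by move: (nU a); rewrite !inE ai aU.
  rewrite Pr_diff subr_gt0; apply: le_lt_trans (_ : 2 * x * Pr p (none (U :\ i)) < _).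
    by apply: le_trans (local_step (U :\ i) i); apply: Pr_le => w; rewrite andbC.
  rewrite gtr_pMl //.
  have := xb; have := x_ge0 i; nra.
have /existsP[w /forallP nw] : [exists w, none setT w].
  apply: contraLR (pos setT) => /existsPn nw; rewrite -leNgt.
  rewrite /Pr (@eq_Ex _ _ _ p _ (fun=> 0)) ?Ex_cst // => w; by rewrite (negbTE (nw w)).
by exists w => i; move: (nw i); rewrite inE.
Qed.

End LocalLemma.

(** * The random independent set of one colour *)

Lemma prod_1B_ge (R : realType) (I : finType) (A : {set I}) (x : I -> R) :
  (forall i, i \in A -> 0 <= x i <= 1) ->
  1 - \sum_(i in A) x i <= \prod_(i in A) (1 - x i).
Proof.
move=> x01.
suff : [/\ 1 - \sum_(i in A) x i <= \prod_(i in A) (1 - x i),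
   0 <= \prod_(i in A) (1 - x i) <= 1 & 0 <= \sum_(i in A) x i] by case.
apply: (big_ind2 (fun s p => [/\ 1 - s <= p, 0 <= p <= 1 & 0 <= s])).
- by rewrite subr0 ler01 lexx.
- move=> s1 p1 s2 p2 [l1 /andP[g1 h1] n1] [l2 /andP[g2 h2] n2].
  split; [nra| apply/andP; split; nra| nra].
- by move=> i /x01/andP[x0 x1]; split=> //; apply/andP; split; lra.
Qed.

Section Process.
Variables (R : realType) (V : finType) (E : {set {set V}}).
Variables (N T : nat).

(* [None] is a vertex still in play, [Some true] has joined the independent
   set, [Some false] is discarded. *)
Definition status := option bool.
Definition state : finType := {ffun V -> option bool}.
Implicit Types (st : state) (v w x : V) (e f : {set V}).

Definition rate (i : nat) : R := 2 ^+ i / N%:R.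

Definition undecided st e w : {set V} := [set x in e :\ w | st x == None].

(** An edge whose other vertices have all joined is left out, as its factor [1 - rate i ^+ 0] would
    make the product in [spare] vanish. For a vertex in play such an edge can only arise from a
    round in which the vertex was overloaded. *)
Definition candidate st w e :=
  [&& e \in E, w \in e, [forall x in e :\ w, st x != Some false] &
      (0 < #|undecided st e w|)%N].

Definition load i st w : R :=
  \sum_(e | candidate st w e) rate i ^+ #|undecided st e w|.

(** The load is the expected number of candidate edges that would be completed in the round. Above
    1/2 the extra coin may be unable to bring survival to exactly 1/2, so an overloaded vertex
    ignores its threats; the process is then well defined for every history, and [joined] removes
    such vertices afterwards. *)
Definition threats i st w : {set {set V}} :=
  if load i st w <= 2^-1 then [set e | candidate st w e] else set0.

Definition survives i st w (killed : bool) (act : V -> bool) :=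
  ~~ killed && [forall e in threats i st w, ~~ [forall x in undecided st e w, act x]].

Definition step i st (killed act : V -> bool) : state :=
  [ffun w => if st w is None then
     if survives i st w (killed w) act then if act w then Some true else None
     else Some false
   else st w].

(* Indexing the extra coin of [w] by the part of the state seen from [w] lets its
   bias depend on the state while the outcome at [w] stays local. *)
Definition visible st w : state :=
  [ffun x => if [exists e in E, (w \in e) && (x \in e)] then st x else None].

(* The probability that the extra coin spares [w]: the threats being independent,
   [w] survives round [i] with probability exactly 1/2, whatever the state. *)
Definition spare i st w : R :=
  2^-1 / \prod_(e in threats i st w) (1 - rate i ^+ #|undecided st e w|).

Lemma undecided_visible st e w : e \in E -> w \in e ->
  undecided (visible st w) e w = undecided st e w.
Proof.
move=> eE we; apply/setP => x; rewrite !inE ffunE; case: ifP => //.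
by move=> /existsP; case: (boolP (x \in e)) => [xe []|]; rewrite ?andbF //; exists e; rewrite eE we.
Qed.

Lemma candidate_visible st w e : candidate (visible st w) w e = candidate st w e.
Proof.
rewrite /candidate; case: (boolP (e \in E)) => //= eE; case: (boolP (w \in e)) => //= we.
rewrite undecided_visible //; congr (_ && _); apply: eq_forallb => x.
case: (boolP (x \in e :\ w)) => //=; rewrite inE ffunE => /andP[_ xe].
by case: existsP => // -[]; exists e; rewrite eE we.
Qed.

Lemma threats_visible i st w : threats i (visible st w) w = threats i st w.
Proof.
rewrite /threats.
have -> : load i (visible st w) w = load i st w.
  rewrite /load (eq_bigl (candidate st w)); last by move=> e; rewrite candidate_visible.
  by apply: eq_bigr => e /and4P[eE we _ _]; rewrite undecided_visible.
by case: ifP => // _; apply/setP => e; rewrite !inE candidate_visible.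
Qed.

Lemma threatsP i st w e : e \in threats i st w -> candidate st w e.
Proof. by rewrite /threats; case: ifP => _; rewrite inE. Qed.

Lemma spare_visible i st w : spare i (visible st w) w = spare i st w.
Proof.
rewrite /spare threats_visible; congr (_ / _); apply: eq_bigr => e /threatsP.
by case/and4P=> eE we _ _; rewrite undecided_visible.
Qed.

Hypothesis N_gt0 : (0 < N)%N.
Hypothesis TN : (2 ^ T <= N)%N.

Lemma rate_gt0 i : 0 < rate i.
Proof. by rewrite divr_gt0 ?exprn_gt0 ?ltr0n. Qed.

Lemma rate_le1 i : (i <= T)%N -> rate i <= 1.
Proof.
move=> iT; rewrite ler_pdivrMr ?ltr0n // mul1r -natrX ler_nat.
by apply: leq_trans TN; rewrite leq_exp2l.
Qed.

Lemma rateS i : rate i.+1 = 2 * rate i.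
Proof. by rewrite /rate exprS mulrA. Qed.

Lemma rate_le_half i : (i < T)%N -> rate i <= 2^-1.
Proof. move=> /rate_le1; rewrite rateS; lra. Qed.

Lemma rateX_le i n : (i <= T)%N -> (0 < n)%N -> 0 <= rate i ^+ n <= rate i.
Proof.
move=> iT n0; apply/andP; split; first by rewrite exprn_ge0 ?ltW ?rate_gt0.
apply: (@le_trans _ _ (rate i ^+ 1)); last by rewrite expr1.
by apply: ler_wiXn2l => //; [exact/ltW/rate_gt0 | exact: rate_le1].
Qed.

(** The product is at least 1 minus the load: the cap 1/2 on the load is what makes [spare] a
    probability. *)
Lemma threats_prod i st w : (i <= T)%N ->
  2^-1 <= \prod_(e in threats i st w) (1 - rate i ^+ #|undecided st e w|) <= 1.
Proof.
move=> iT.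
have x01 e : e \in threats i st w -> 0 <= rate i ^+ #|undecided st e w| <= 1.
  move=> /threatsP/and4P[_ _ _ a0]; have /andP[-> le] := rateX_le iT a0.
  exact: le_trans le (rate_le1 iT).
apply/andP; split; last first.
  by apply: prodr_ile1 => e /x01/andP[]; lra.
apply: le_trans (prod_1B_ge x01); rewrite /threats; case: ifP => [ld|_]; last by rewrite big_set0; lra.
rewrite (eq_bigl (candidate st w)); last by move=> e; rewrite inE.
move: ld; rewrite /load; lra.
Qed.

Lemma spare_bounds i st w : (i <= T)%N -> 0 <= spare i st w <= 1.
Proof.
move=> iT; have /andP[a b] := threats_prod st w iT.
rewrite divr_ge0 ?ler_pdivrMr ?mul1r; lra.
Qed.
End Process.

Section Coins.
Variables (R : realType) (V : finType) (E : {set {set V}}).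
Variables (N T q : nat) (delta : R).

(** The last component tells apart the coin of the initial sample ([None]), the activity coin of a
    round, and the extra coin of a round for each possible view. One extra coin per view keeps every
    bias fixed in advance, so that the space is a product. The type ['I_T.+1] of rounds lets [inord]
    apply. *)
Definition coin : finType := ('I_q * V * option ('I_T.+1 * option (state V)))%type.

Implicit Types (st : state V) (v w x : V) (e f : {set V}) (c : 'I_q) (i : nat).
Implicit Types (om : {ffun coin -> bool}).

Hypothesis N_gt0 : (0 < N)%N.
Hypothesis TN : (2 ^ T <= N)%N.
Hypothesis delta01 : 0 <= delta <= 1.
Hypothesis lin : forall e f x w, e \in E -> f \in E -> x != w ->
  x \in e -> w \in e -> x \in f -> w \in f -> e = f.

Definition bias (j : coin) : R :=
  match j.2 with
  | None => delta
  | Some (i, None) => rate R N i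
  | Some (i, Some st) => 1 - spare R E N i st j.1.2
  end.

Lemma bias01 j : 0 <= bias j <= 1.
Proof.
case: j => [[c w] [[i [st|]]|]] //=; rewrite /bias /=.
  have := spare_bounds R E N_gt0 TN st w (leq_ord i : (i <= T)%N); lra.
by rewrite ltW ?rate_gt0 // (rate_le1 R N_gt0 TN) // -ltnS.
Qed.

Definition coin_pmf (j : coin) (x : bool) : R := if x then bias j else 1 - bias j.

Lemma coin_pmf_ge0 j (x : bool) : 0 <= coin_pmf j x.
Proof. by rewrite /coin_pmf; have := bias01 j; case: x; lra. Qed.

Lemma coin_pmf_sum1 j : \sum_(x : bool) coin_pmf j x = 1.
Proof. by rewrite big_bool /coin_pmf /=; lra. Qed.

Definition fair := CoinLaw coin_pmf_ge0 coin_pmf_sum1.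

Definition in_coin c w : coin := (c, w, None).
Definition act_coin c i w : coin := (c, w, Some (inord i, None)).
Definition kill_coin c i w st : coin := (c, w, Some (inord i, Some (visible E st w))).

Definition round c i (D : {set V}) : {set coin} :=
  [set j | [&& j.1.1 == c, j.1.2 \in D & if j.2 is Some (i', _) then i' == inord i else false]].

Definition cstep c i st om : state V :=
  step R E N i st (fun w => om (kill_coin c i w st)) (fun w => om (act_coin c i w)).

Fixpoint trajectory c i om : state V :=
  if i is i'.+1 then cstep c i' (trajectory c i' om) om
  else [ffun w => if om (in_coin c w) then None else Some false].

Lemma Ex_coin j (g : bool -> R) :
  Ex fair (fun om => g (om j)) = bias j * g true + (1 - bias j) * g false.
Proof. by rewrite (Ex_coord _ j g) big_bool. Qed.

Section OneStep.
Variables (c : 'I_q) (i : nat) (iT : (i < T)%N) (st : state V).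

Let r := rate R N i.
Let r_gt0 : 0 < r. Proof. exact: (rate_gt0 R N_gt0). Qed.
Let r_half : r <= 2^-1. Proof. exact: (rate_le_half R N_gt0 TN). Qed.

Let inord_i : @inord T i = i :> nat.
Proof. by rewrite inordK // ltnS ltnW. Qed.

Lemma bias_act w : bias (act_coin c i w) = r.
Proof. by rewrite /bias /= inord_i. Qed.

Lemma bias_kill w : bias (kill_coin c i w st) = 1 - spare R E N i st w.
Proof. by rewrite /bias /= inord_i spare_visible. Qed.

Definition kept (B : {set {set V}}) w om : R :=
  (~~ om (kill_coin c i w st))%:R *
  \prod_(e in B) (1 - \prod_(x in undecided st e w) (om (act_coin c i x))%:R).

Definition fires e w om : bool := [forall x in undecided st e w, om (act_coin c i x)].

Lemma prod_fires e w om :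
  \prod_(x in undecided st e w) (om (act_coin c i x))%:R = (fires e w om)%:R :> R.
Proof.
rewrite /fires; case: forallP => [a|/forallP].
  by rewrite big1 // => x xu; move: (a x); rewrite xu /= => ->.
rewrite negb_forall => /existsP[x]; rewrite negb_imply => /andP[xu ax].
by rewrite (bigD1 x) //= (negbTE ax) mul0r.
Qed.

Lemma kept_ge0 B w om : 0 <= kept B w om.
Proof.
rewrite mulr_ge0 ?ler0n // prodr_ge0 // => e _.
by rewrite prod_fires; case: (fires e w om); rewrite ?subrr ?subr0.
Qed.

Lemma kept_threats w om : kept (threats R E N i st w) w om =
  (survives R E N i st w (om (kill_coin c i w st)) (fun x => om (act_coin c i x)))%:R.
Proof.
rewrite /kept /survives -mulnb natrM; congr (_ * _).
case: forallP => [a|/forallP].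
  rewrite big1 // => e eB; rewrite prod_fires; move: (a e); rewrite eB /=.
  by rewrite -/(fires e w om) => /negbTE ->; rewrite subr0.
rewrite negb_forall => /existsP[e]; rewrite negb_imply negbK -/(fires e w om) => /andP[eB fe].
by rewrite (bigD1 e) //= prod_fires fe subrr mul0r.
Qed.

Lemma kept_le (B B' : {set {set V}}) w om : B \subset B' -> kept B' w om <= kept B w om.
Proof.
move=> /setIidPr BB'; rewrite /kept ler_wpM2l ?ler0n //.
rewrite (big_setID B) /= BB' ler_piMr //.
  by apply: prodr_ge0 => e _; rewrite prod_fires; case: (fires e w om); rewrite ?subrr ?subr0.
by apply: prodr_ile1 => e _; rewrite prod_fires; case: (fires e w om); rewrite ?subrr ?subr0 ?lexx ?ler01.
Qed.

Definition reach (B : {set {set V}}) w : {set V} := w |: \bigcup_(e in B) e.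

Let dep_kill w : depends_on [set kill_coin c i w st]
  (fun om => (~~ om (kill_coin c i w st))%:R : R).
Proof. by move=> om om' e; rewrite e ?inE. Qed.

Let dep_edge (B : {set {set V}}) w e : e \in B ->
  depends_on [set act_coin c i x | x in undecided st e w]
   (fun om => 1 - \prod_(x in undecided st e w) (om (act_coin c i x))%:R : R).
Proof.
move=> eB om om' h; congr (_ - _); apply: eq_bigr => x xu.
by rewrite h // imset_f.
Qed.

Let act_inj : injective (act_coin c i).
Proof. by move=> x y []. Qed.

Let dep_edges (B : {set {set V}}) w :
  depends_on [set act_coin c i x | x in \bigcup_(e in B) undecided st e w]
   (fun om => \prod_(e in B) (1 - \prod_(x in undecided st e w) (om (act_coin c i x))%:R) : R).
Proof.
move=> om om' h; apply: eq_bigr => e eB; apply: (dep_edge eB) => j /imsetP[x xu ->].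
by apply: h; rewrite imset_f //; apply/bigcupP; exists e.
Qed.

(** By linearity two threats at [w] meet only in [w], whose own activity coin occurs in neither, so
    the factors read disjoint sets of coins. *)
Lemma Ex_kept (B : {set {set V}}) w : (B \subset threats R E N i st w) ->
  Ex fair (kept B w) =
   spare R E N i st w * \prod_(e in B) (1 - r ^+ #|undecided st e w|).
Proof.
move=> /subsetP Bt.
rewrite (@Ex_indep _ _ _ fair _ _ _ _ (@dep_kill w) (@dep_edges B w)); last first.
  by rewrite disjoints1; apply/imsetP => -[x _].
congr (_ * _).
  rewrite (Ex_coin _ (fun b => (~~ b)%:R)) bias_kill mulr0 mulr1; lra.
rewrite (@Ex_prod_indep _ _ _ fair _ B (fun e => [set act_coin c i x | x in undecided st e w])).
- apply: eq_bigr => e eB; rewrite ExB Ex_cst; congr (_ - _).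
  rewrite (@Ex_prod_indep _ _ _ fair _ _ (fun x => [set act_coin c i x])).
  + rewrite -prodr_const; apply: eq_bigr => x _.
    rewrite (Ex_coin _ (fun b => b%:R)) bias_act mulr0 mulr1; lra.
  + by move=> x _ om om' h; rewrite h ?inE.
  + by move=> x y _ _ xy; rewrite disjoints1 inE (inj_eq act_inj).
- by move=> e eB; exact: dep_edge eB.
- move=> e f eB fB ef; rewrite -setI_eq0; apply: contraNT ef => /set0Pn[j].
  rewrite inE => /andP[/imsetP[x xe ->]]; rewrite mem_imset // => xf.
  have /threatsP/and4P[eE we _ _] := Bt _ eB.
  have /threatsP/and4P[fE wf _ _] := Bt _ fB.
  move: xe xf; rewrite !inE => /andP[/andP[xw xe] _] /andP[/andP[_ xf] _].
  by apply/eqP; apply: lin xw xe we xf wf.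
Qed.

Lemma kept_depends (B : {set {set V}}) w :
  depends_on (round c i (reach B w)) (kept B w).
Proof.
move=> om om' h; rewrite /kept h; last by rewrite !inE /= !eqxx.
congr (_ * _); apply: (@dep_edges B w) => j /imsetP[x /bigcupP[e eB xu] ->].
apply: h; rewrite !inE /= !eqxx andbT /=; apply/orP; right.
by apply/bigcupP; exists e => //; move: xu; rewrite inE => /andP[/setD1P[]].
Qed.

(* Ignoring the threats outside [B] makes the outcomes at several vertices depend
   on disjoint sets of coins. *)
Definition lazy_step (B : {set {set V}}) (h : status -> R) w om : R :=
  if st w is None then
    kept B w om * h (if om (act_coin c i w) then Some true else None)
  else h (st w).

(** Dropping threats can only help [w] to survive, and [h] vanishes on discarded vertices. *)
Lemma lazy_step_ge (B : {set {set V}}) h w om : (forall s, 0 <= h s) -> h (Some false) = 0 ->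
  B \subset threats R E N i st w -> h (cstep c i st om w) <= lazy_step B h w om.
Proof.
move=> h0 hd Bt; rewrite /lazy_step /cstep ffunE.
case: (st w) => [s|] //; case: ifP => sv; last by rewrite hd mulr_ge0 ?kept_ge0.
rewrite ler_peMl //; apply: le_trans (kept_le w om Bt).
by rewrite kept_threats sv.
Qed.

Lemma lazy_step_threats h w om : h (Some false) = 0 ->
  h (cstep c i st om w) = lazy_step (threats R E N i st w) h w om.
Proof.
move=> hd; rewrite /lazy_step /cstep ffunE.
case: (st w) => [s|] //; rewrite kept_threats; case: ifP => _; last by rewrite mul0r.
by rewrite mul1r.
Qed.

Lemma lazy_step_depends (B : {set {set V}}) h w :
  depends_on (round c i (reach B w)) (lazy_step B h w).
Proof.
move=> om om' e; rewrite /lazy_step (kept_depends e).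
by rewrite (e (act_coin c i w)) // !inE /= !eqxx.
Qed.

Lemma Ex_lazy_step (B : {set {set V}}) h w : B \subset threats R E N i st w ->
  Ex fair (lazy_step B h w) =
  if st w is None then
    spare R E N i st w * \prod_(e in B) (1 - r ^+ #|undecided st e w|) *
    (r * h (Some true) + (1 - r) * h None)
  else h (st w).
Proof.
move=> Bt; rewrite /lazy_step; case: (st w) => [s|]; first by rewrite Ex_cst.
rewrite (@Ex_indep _ _ _ fair (kill_coin c i w st |:
    [set act_coin c i x | x in \bigcup_(e in B) undecided st e w])
  [set act_coin c i w]).
- by rewrite Ex_kept // (Ex_coin _ (fun b => h (if b then Some true else None))) bias_act.
- move=> om om' e; rewrite /kept e ?inE ?eqxx //; congr (_ * _).
  by apply: (@dep_edges B w) => j jS; apply: e; rewrite inE jS orbT.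
- by move=> om om' e; rewrite e ?inE.
- rewrite disjoint_sym disjoints1 in_setU1 negb_or; apply/andP; split.
    by apply/eqP; case.
  rewrite mem_imset //; apply/bigcupP => -[e _]; by rewrite !inE eqxx.
Qed.

Lemma Ex_lazy_step_all h w : st w = None ->
  Ex fair (lazy_step (threats R E N i st w) h w) =
  2^-1 * (r * h (Some true) + (1 - r) * h None).
Proof.
move=> sw; rewrite Ex_lazy_step // sw; congr (_ * _).
rewrite /spare divfK // lt0r_neq0 //.
by have := threats_prod R E N_gt0 TN st w (ltnW iT); rewrite -/r; lra.
Qed.

(** The omitted factor is [1 - r ^+ n] with [n > 0], hence at least [1 - r]. In the application [e]
    is the edge joining [w] to [v], at which the other vertices of [e] look too. *)
Lemma Ex_lazy_step_drop h w e : (forall s, 0 <= h s) -> st w = None ->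
  Ex fair (lazy_step (threats R E N i st w :\ e) h w) <=
  2^-1 / (1 - r) * (r * h (Some true) + (1 - r) * h None).
Proof.
move=> h0 sw; rewrite Ex_lazy_step ?subD1set // sw; apply: ler_wpM2r.
  by apply: addr_ge0; apply: mulr_ge0; rewrite ?h0 //; move: r_gt0 r_half; lra.
have /andP[P1 P2] := threats_prod R E N_gt0 TN st w (ltnW iT).
rewrite /spare; case: (boolP (e \in threats R E N i st w)) => [et|et]; last first.
  have -> : threats R E N i st w :\ e = threats R E N i st w.
    by apply/setDidPl; rewrite disjoint_sym disjoints1.
  rewrite divfK; last by rewrite lt0r_neq0 //; lra.
  have r1 : 0 < 1 - r by move: r_half; lra.
  rewrite ler_peMr ?invr_ge0 ?ler0n // invf_ge1 //; move: r_gt0; lra.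
move: P1 P2; rewrite (big_setD1 e et) /= -/r.
have /threatsP/and4P[_ _ _ a0] := et.
have /andP[x0 xr] := rateX_le R N_gt0 TN (ltnW iT) a0.
move: x0 xr; rewrite -/r; move: (r ^+ _) (\prod_(_ in _) _) => x y x0 xr P1 P2.
rewrite -!mulrA; apply: ler_wpM2l; first lra.
rewrite invfM -mulrA mulVf ?mulr1; last first.
  by apply: contraTneq P1 => ->; rewrite mulr0; lra.
rewrite lef_pV2 ?posrE; move: r_half r_gt0; lra.
Qed.

End OneStep.
End Coins.

(** * An exponential moment for the load of a vertex *)

Section Potential.
Variables (R : realType) (V : finType) (E : {set {set V}}).
Variables (N T q : nat) (delta : R).
Hypothesis N_gt0 : (0 < N)%N.
Hypothesis TN : (2 ^ T <= N)%N.
Hypothesis delta01 : 0 <= delta <= 1.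
Hypothesis lin : forall (e f : {set V}) x w, e \in E -> f \in E -> x != w ->
  x \in e -> w \in e -> x \in f -> w \in f -> e = f.

Implicit Types (st : state V) (v w x : V) (e f : {set V}) (c : 'I_q) (i : nat).
Implicit Types (om : {ffun coin V T q -> bool}) (F : {set {set V}}).
Local Notation mu := (fair E q N_gt0 TN delta01).
Local Notation r := (rate R N).

(* The sum over the choice of a vertex [w0 != v] of [e] that is still in play,
   each of the others either being in play (weight [a]) or having joined
   (weight 1). *)
Definition weight (b a : R) w0 w (s : status) : R :=
  if w == w0 then b * (s == None)%:R else (s == Some true)%:R + a * (s == None)%:R.

(** A substitute for the exponential of the contribution of [e] to the load: a sum of products over
    single vertices, whose expectation factorises. The vertex [w0] is set apart because a threat has
    a vertex in play, which collects no chance of having joined; so only the other [k - 2] vertices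
    contribute a factor of order [T]. *)
Definition edge_factor (l b a : R) v e st : R :=
  1 + l * \sum_(w0 in e :\ v) \prod_(w in e :\ v) weight b a w0 w (st w).

Definition potential l b a v F st : R := \prod_(e in F) edge_factor l b a v e st.

Definition separated i v F st := forall e f x w, e \in F -> f \in F ->
  x \in e :\ v -> w \in f :\ v -> x != w ->
  [disjoint reach (threats R E N i st x :\ e) x & reach (threats R E N i st w :\ f) w].

Lemma weight_ge0 b a w0 w s : 0 <= b -> 0 <= a -> 0 <= weight b a w0 w s.
Proof.
by move=> b0 a0; rewrite /weight; case: ifP => _; rewrite ?addr_ge0 ?mulr_ge0.
Qed.

Lemma edge_factor_ge1 l b a v e st : 0 <= l -> 0 <= b -> 0 <= a ->
  1 <= edge_factor l b a v e st.
Proof.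
move=> l0 b0 a0; rewrite lerDl mulr_ge0 // sumr_ge0 // => w0 _.
by rewrite prodr_ge0 // => w _; exact: weight_ge0.
Qed.

Lemma disjoint_round c i (D D' : {set V}) : [disjoint D & D'] ->
  [disjoint round T c i D & round T c i D'].
Proof.
move=> dis; rewrite -setI_eq0; apply/eqP/setP => j; rewrite !inE.
case: (boolP (j.1.2 \in D)) => [jD|]; last by rewrite andbF.
by rewrite (disjointFr dis jD) !andbF.
Qed.

Lemma round_sub c i (D D' : {set V}) : D \subset D' ->
  round T c i D \subset round T c i D'.
Proof.
move=> /subsetP DD'; apply/subsetP => j; rewrite !inE => /and3P[-> jD ->].
by rewrite DD'.
Qed.

(** With [e] dropped, a vertex in play survives with probability at most [2^-1 / (1 - r i)]. Staying
    inactive has probability [1 - r i], which cancels, so weights in play are halved; joining adds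
    at most [r i]. *)
Lemma lazy_step_weight_le c i st e b a w0 w : (i < T)%N -> 0 <= b -> 0 <= a ->
  Ex mu (lazy_step E c i st (threats R E N i st w :\ e) (weight b a w0 w) w) <=
  weight (b / 2) (a / 2 + r i) w0 w (st w).
Proof.
move=> iT b0 a0.
have r0 := rate_gt0 R N_gt0 i; have rh := rate_le_half R N_gt0 TN iT.
case sw: (st w) => [s|]; last first.
  apply: le_trans (Ex_lazy_step_drop N_gt0 TN delta01 lin c iT e _ sw) _.
    by move=> s; exact: weight_ge0.
  have [u uE u1] : exists2 u, 2^-1 / (1 - r i) = u & u * (1 - r i) = 2^-1.
    by exists (2^-1 / (1 - r i)) => //; rewrite divfK //; lra.
  rewrite uE /weight /=; have u2 : u <= 1 by nra.
  case: (w == w0); rewrite ?mulr0 ?mulr1 ?add0r ?addr0 ?mulr1.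
    by rewrite mulrA u1; lra.
  rewrite mulrDr [u * ((1 - _) * _)]mulrA u1; nra.
rewrite Ex_lazy_step ?subD1set // sw.
by rewrite /weight; case: (w == w0); rewrite /= !mulr0.
Qed.

(** Each vertex of an edge [e] of [F] forgets the threat [e]; by [separated], what distinct vertices
    still look at is disjoint, so the expectation splits first over the edges and then over the
    vertices of an edge. *)
Lemma potential_step c i st v F l b a : (i < T)%N -> 0 <= l -> 0 <= b -> 0 <= a ->
  F \subset [set e in E | v \in e] -> separated i v F st ->
  Ex mu (fun om => potential l b a v F (cstep R E N c i st om)) <=
  potential l (b / 2) (a / 2 + r i) v F st.
Proof.
move=> iT l0 b0 a0 /subsetP FE sep.
pose lz e w0 w om := lazy_step E c i st (threats R E N i st w :\ e) (weight b a w0 w) w om.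
pose lazy e om := 1 + l * \sum_(w0 in e :\ v) \prod_(w in e :\ v) lz e w0 w om.
pose D e := \bigcup_(w in e :\ v) reach (threats R E N i st w :\ e) w.
have lz_dep e w0 w : depends_on (round T c i (reach (threats R E N i st w :\ e) w)) (lz e w0 w).
  exact: lazy_step_depends.
have lz_ge e w0 w om : weight b a w0 w (cstep R E N c i st om w) <= lz e w0 w om.
  rewrite /lz; apply: lazy_step_ge; rewrite ?subD1set //.
    by move=> s; exact: weight_ge0.
  by rewrite /weight; case: ifP; rewrite ?mulr0 ?addr0.
apply: (@le_trans _ _ (Ex mu (fun om => \prod_(e in F) lazy e om))).
  apply: Ex_le => om; apply: ler_prod => e _; apply/andP; split.
    by apply: le_trans ler01 _; exact: edge_factor_ge1.
  rewrite lerD2l ler_wpM2l //; apply: ler_sum => w0 _; apply: ler_prod => w _.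
  by rewrite weight_ge0 //= lz_ge.
rewrite (@Ex_prod_indep _ _ _ mu _ F (fun e => round T c i (D e))); first last.
- move=> e f eF fF ef; apply: disjoint_round.
  rewrite disjoint_sym; apply: bigcup_disjoint => x xe.
  rewrite disjoint_sym; apply: bigcup_disjoint => w wf.
  rewrite disjoint_sym; apply: sep => //.
  apply: contraNneq ef => xw; move: xe wf; rewrite -xw => /setD1P[xv xe] /setD1P[_ xf].
  have := FE _ eF; have := FE _ fF; rewrite !inE => /andP[fE vf] /andP[eE ve].
  by apply/eqP; apply: lin xv xe ve xf vf.
- move=> e eF om om' h; congr (_ + _ * _); apply: eq_bigr => w0 _.
  apply: eq_bigr => w we; apply: lz_dep => j jr; apply: h.
  apply: (subsetP (round_sub c i _)) jr.
  by apply/subsetP => x xr; apply/bigcupP; exists w.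
apply: ler_prod => e eF; apply/andP; split.
  apply: Ex_ge0 => om; rewrite addr_ge0 // mulr_ge0 // sumr_ge0 // => w0 _.
  by apply: prodr_ge0 => w _; apply: le_trans (lz_ge _ _ _ _); exact: weight_ge0.
rewrite /lazy ExD Ex_cst ExZ lerD2l ler_wpM2l // Ex_sum.
apply: ler_sum => w0 _.
rewrite (@Ex_prod_indep _ _ _ mu _ (e :\ v)
  (fun w => round T c i (reach (threats R E N i st w :\ e) w))).
- apply: ler_prod => w we; apply/andP; split.
    by apply: Ex_ge0 => om; apply: le_trans (lz_ge _ _ _ _); exact: weight_ge0.
  exact: lazy_step_weight_le.
- by move=> w _; exact: lz_dep.
- by move=> x w xe we xw; apply: disjoint_round; exact: sep.
Qed.
End Potential.

(** * Clean samples and the Markov property of the rounds *)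

Section Evolution.
Variables (R : realType) (V : finType) (E : {set {set V}}).
Variables (N T q : nat) (delta : R).
Hypothesis N_gt0 : (0 < N)%N.
Hypothesis TN : (2 ^ T <= N)%N.
Hypothesis delta01 : 0 <= delta <= 1.
Hypothesis lin : forall (e f : {set V}) x w, e \in E -> f \in E -> x != w ->
  x \in e -> w \in e -> x \in f -> w \in f -> e = f.

Implicit Types (st : state V) (v w x : V) (e f : {set V}) (c : 'I_q) (i : nat).
Implicit Types (om : {ffun coin V T q -> bool}) (F : {set {set V}}).
Local Notation mu := (fair E q N_gt0 TN delta01).
Local Notation r := (rate R N).
Local Notation trajectory := (trajectory R E N).

Definition chosen c om : {set V} := [set w | om (in_coin T c w)].

(* No cycle of length at most 4 in [W] passes near [v]: then the threats to distinct
   neighbours of [v], apart from the edges through [v], are disjoint. *)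
Definition clean v (W : {set V}) :=
  [forall e in E, forall e' in E, forall f in E, forall f' in E,
   forall x in e :\ v, forall w in e' :\ v,
    [&& v \in e, v \in e', e \subset W, e' \subset W, f \subset W, f' \subset W,
      x \in f, w \in f', v \notin f, v \notin f' & x != w] ==> [disjoint f & f']].

Definition star v (W : {set V}) := [set e in E | (v \in e) && (e \subset W)].

Lemma cleanP v W : clean v W -> forall e e' f f' x w,
  e \in star v W -> e' \in star v W -> f \in E -> f' \in E ->
  x \in e :\ v -> w \in e' :\ v -> f \subset W -> f' \subset W ->
  x \in f -> w \in f' -> v \notin f -> v \notin f' -> x != w -> [disjoint f & f'].
Proof.
move=> cl e e' f f' x w; rewrite !inE => /and3P[eE ve eW] /and3P[e'E ve' e'W] fE f'E xe we fW f'W xf wf' vf vf' xw.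
move: cl => /forall_inP/(_ e eE)/forall_inP/(_ e' e'E)/forall_inP/(_ f fE)/forall_inP/(_ f' f'E).
move=> /forall_inP/(_ x); rewrite !inE xe => /(_ isT)/forall_inP/(_ w); rewrite !inE we => /(_ isT).
by move/implyP; apply; rewrite ve ve' eW e'W fW f'W xf wf' vf vf' xw.
Qed.

(** A threat at [x] other than [e] avoids [v] by linearity and lies in [W], its other vertices being
    in play or joined. Two such threats that meet contradict cleanliness; so does one passing
    through both [x] and [w], which is the case [f = f']. *)
Lemma clean_separated i v W st : clean v W ->
  (forall w, st w != Some false -> w \in W) -> separated R E N i v (star v W) st.
Proof.
move=> /cleanP cl stW.
have threatW e x f : e \in star v W -> x \in e :\ v -> f \in threats R E N i st x :\ e ->
  [/\ f \in E, f \subset W, x \in f & v \notin f].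
  rewrite inE => /and3P[eE ve eW] /setD1P[xv xe] /setD1P[fe /threatsP/and4P[fE xf /forall_inP nd _]].
  split=> //.
    apply/subsetP => y yf; have [->|yx] := eqVneq y x; first exact: (subsetP eW).
    by apply: stW; apply: nd; rewrite !inE yx yf.
  by apply: contraNN fe => vf; apply/eqP; apply: lin xv xf vf xe ve.
move=> e e' x w es e's xe we xw.
have no f : f \in threats R E N i st x :\ e -> w \notin f.
  move=> ft; have [fE fW xf vf] := threatW _ _ _ es xe ft.
  apply/negP => wf; have := cl _ _ _ _ _ _ es e's fE fE xe we fW fW xf wf vf vf xw.
  by move/disjointFr/(_ xf); rewrite xf.
have no' f : f \in threats R E N i st w :\ e' -> x \notin f.
  move=> ft; have [fE fW wf vf] := threatW _ _ _ e's we ft.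
  apply/negP => xf; have := cl _ _ _ _ _ _ es e's fE fE xe we fW fW xf wf vf vf xw.
  by move/disjointFr/(_ xf); rewrite xf.
rewrite -setI_eq0; apply: contraT => /set0Pn[y]; rewrite !inE.
case/andP=> /orP[/eqP->|/bigcupP[f ft yf]] /orP[/eqP yw|/bigcupP[f' f't yf']].
- by move: xw; rewrite yw eqxx.
- by move: (no' _ f't); rewrite yf'.
- by move: (no _ ft); rewrite -yw yf.
have [fE fW xf vf] := threatW _ _ _ es xe ft.
have [f'E f'W wf' vf'] := threatW _ _ _ e's we f't.
have := cl _ _ _ _ _ _ es e's fE f'E xe we fW f'W xf wf' vf vf' xw.
by move/disjointFr/(_ yf); rewrite yf'.
Qed.

Lemma run_dep c i om om' : (i <= T)%N ->
  (forall j : coin V T q, j.1.1 = c ->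
     (if j.2 is Some (i', _) then (i' < i)%N else true) -> om j = om' j) ->
  trajectory c i om = trajectory c i om'.
Proof.
elim: i => [_ h|i IH iT h]; first by apply/ffunP => w; rewrite !ffunE h.
have io : @inord T i = i :> nat by rewrite inordK // ltnS ltnW.
rewrite /= IH; first last.
- by move=> j jc ji; apply: h => //; case: (j.2) ji => // -[i' _] /leqW.
- exact: ltnW.
rewrite /cstep /step; apply/ffunP => w; rewrite !ffunE.
rewrite /survives !(h (kill_coin _ _ _ _ _ _)) ?(h (act_coin _ _ _ _)) //=; try by rewrite io.
case: (trajectory c i om' w) => // ; congr (if _ && _ then _ else _).
apply: eq_forallb => e; congr (_ ==> ~~ _); apply: eq_forallb => x; congr (_ ==> _).
by rewrite h //= io.
Qed.

Lemma run_merge c i om om' : (i < T)%N ->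
  trajectory c i (merge (round T c i setT) om om') = trajectory c i om'.
Proof.
move=> iT; apply: run_dep (ltnW iT) _ => -[[c' w] kd] /= -> h; rewrite ffunE !inE /= eqxx.
case: kd h => // -[i' s] i'i; case: eqP => // i'E; move: i'i.
by rewrite i'E inordK ?ltnn // ltnS ltnW.
Qed.

Lemma cstep_merge c i st om om' : (i < T)%N ->
  cstep R E N c i st (merge (round T c i setT) om om') = cstep R E N c i st om.
Proof.
move=> iT; apply/ffunP => w; rewrite /cstep /step !ffunE.
rewrite /survives !inE /= !eqxx.
case: (st w) => //; congr (if _ && _ then _ else _).
apply: eq_forallb => e; congr (_ ==> ~~ _); apply: eq_forallb => x; congr (_ ==> _).
by rewrite !ffunE !inE /= !eqxx.
Qed.

Lemma run_chosen c i om w : trajectory c i om w != Some false -> w \in chosen c om.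
Proof.
elim: i => [|i IH] /=; first by rewrite ffunE inE; case: (om _).
by rewrite /cstep /step ffunE; case sw: (trajectory c i om w) => [s|] => [h|_]; apply: IH; rewrite sw.
Qed.

Lemma chosen_merge c i om om' :
  chosen c (merge (round T c i setT) om om') = chosen c om'.
Proof. by apply/setP => w; rewrite !inE ffunE !inE /= !andbF. Qed.

(** The Markov property: the coins of round [i] enter neither the sample [chosen c] nor the earlier
    rounds, so they can be averaged with the state held fixed. *)
Lemma Ex_round c i (g : {set V} -> R) (h h' : {set V} -> state V -> R) : (i < T)%N ->
  (forall W, 0 <= g W) ->
  (forall W st, 0 < g W -> (forall w, st w != Some false -> w \in W) ->
    Ex mu (fun om => h W (cstep R E N c i st om)) <= h' W st) ->
  Ex mu (fun om => g (chosen c om) * h (chosen c om) (trajectory c i.+1 om)) <=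
  Ex mu (fun om => g (chosen c om) * h' (chosen c om) (trajectory c i om)).
Proof.
move=> iT g0 hh'; rewrite (Ex_tower mu (round T c i setT)); apply: Ex_le => om'.
rewrite [leLHS](_ : _ = g (chosen c om') *
   Ex mu (fun om => h (chosen c om') (cstep R E N c i (trajectory c i om') om))); last first.
  rewrite -ExZ; apply: eq_Ex => om /=.
  by rewrite chosen_merge run_merge // cstep_merge.
have := g0 (chosen c om'); rewrite le_eqVlt => /orP[/eqP<-|gp]; first by rewrite !mul0r.
by rewrite ler_pM2l //; apply: hh' => // w; exact: run_chosen.
Qed.
End Evolution.

Lemma expR_half_le (R : realType) (y : R) : 0 <= y <= 1 -> expR (y / 2) <= 1 + y.
Proof.
move=> /andP[y0 y1]; rewrite -[y / 2]opprK expRN.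
have h : 0 < 1 - y / 2 by lra.
apply: (@le_trans _ _ (1 - y / 2)^-1).
  by rewrite lef_pV2 ?posrE ?expR_gt0 // expR_ge1Dx.
by rewrite -div1r ler_pdivrMr //; nra.
Qed.

(** * The probabilities that a vertex is overloaded and that it joins *)

Section SingleColour.
Variables (R : realType) (V : finType) (E : {set {set V}}).
Variables (k N T q : nat) (delta : R).
Hypothesis N_gt0 : (0 < N)%N.
Hypothesis TN : (2 ^ T <= N)%N.
Hypothesis delta01 : 0 <= delta <= 1.
Hypothesis lin : forall (e f : {set V}) x w, e \in E -> f \in E -> x != w ->
  x \in e -> w \in e -> x \in f -> w \in f -> e = f.
Hypothesis k3 : (2 < k)%N.
Hypothesis unif : forall e, e \in E -> #|e| = k.

Implicit Types (st : state V) (v w x : V) (e f W : {set V}) (c : 'I_q) (i : nat).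
Implicit Types (om : {ffun coin V T q -> bool}) (F : {set {set V}}).
Local Notation mu := (fair E q N_gt0 TN delta01).
Local Notation r := (rate R N).
Local Notation trajectory := (trajectory R E N).

(** The size of the star is tuned to [potential_start]: each of its edges starts with weight at most
    [k.-1 * T ^ (k - 2) / N ^ k.-1], so that the total is at most 1/8. *)
Definition good v W := [&& v \in W, clean E v W &
  (#|star E v W| * (8 * k.-1 * T ^ (k - 2)) <= N ^ k.-1)%N].

(** A vertex overloaded in some round is removed: having ignored its threats, it may have completed
    an edge. *)
Definition joined c om : {set V} :=
  [set w | (trajectory c T om w == Some true) && [forall i : 'I_T, load R E N i (trajectory c i om) w <= 2^-1]].

Lemma card_rest e v : e \in E -> v \in e -> #|e :\ v| = k.-1.
Proof. by move=> eE ve; rewrite -(unif eE) (cardsD1 v e) ve. Qed.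

(** As [r j.+1 / 2 = r j], the backward recursion of [potential_step] is solved by [b = r j] and
    [a = (d + 1) * r j], with [d] the number of rounds left before [t]. *)
Lemma potential_run c v (l : R) t j d : (t <= T)%N -> (j + d = t)%N -> 0 <= l ->
  Ex mu (fun om => (good v (chosen c om))%:R *
     potential l (r t) (r t) v (star E v (chosen c om)) (trajectory c t om)) <=
  Ex mu (fun om => (good v (chosen c om))%:R *
     potential l (r j) (d.+1%:R * r j) v (star E v (chosen c om)) (trajectory c j om)).
Proof.
move=> tT + l0; elim: d j => [|d IH] j jd.
  by rewrite addn0 in jd; rewrite jd mul1r.
have jT : (j < T)%N by apply: leq_trans tT; rewrite -jd addnS ltnS leq_addr.
apply: le_trans (IH j.+1 _) _; first by rewrite addSn -addnS.
have r0 : 0 <= r j by exact/ltW/rate_gt0.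
apply: (Ex_round (g := fun W => (good v W)%:R)
  (h := fun W => potential l (r j.+1) (d.+1%:R * r j.+1) v (star E v W))
  (h' := fun W => potential l (r j) (d.+2%:R * r j) v (star E v W))) => // W st gW stW.
have cl : clean E v W by move: gW; rewrite /good; case: clean; rewrite ?andbF //= ltxx.
have r1 : 0 <= r j.+1 by exact/ltW/rate_gt0.
have sub : star E v W \subset [set e in E | v \in e].
  by apply/subsetP => e; rewrite !inE => /and3P[-> ->].
have := potential_step N_gt0 TN delta01 lin c jT l0 r1 (mulr_ge0 (ler0n R d.+1) r1) sub
   (clean_separated R N lin j cl stW).
have -> : r j.+1 / 2 = r j by rewrite rateS; lra.
by have -> : d.+1%:R * r j.+1 / 2 + r j = d.+2%:R * r j by rewrite rateS -[d.+2]addn1 natrD; lra.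
Qed.

Lemma edge_factor_start c v (l b a : R) om e : e \in star E v (chosen c om) -> 0 <= l -> 0 <= b -> 0 <= a ->
  edge_factor l b a v e (trajectory c 0 om) <= 1 + l * (k.-1%:R * (b * a ^+ (k - 2))).
Proof.
rewrite inE => /and3P[eE ve _] l0 b0 a0; rewrite lerD2l ler_wpM2l //.
rewrite -(card_rest eE ve) mulr_natl -sumr_const; apply: ler_sum => w0 w0e.
rewrite (bigD1 w0) //=; apply: ler_pM.
- exact: weight_ge0.
- by apply: prodr_ge0 => w _; exact: weight_ge0.
- by rewrite /weight eqxx ler_piMr //; case: (_ == _).
rewrite [leRHS](_ : _ = \prod_(w in e :\ v | w != w0) a).
  apply: ler_prod => w /andP[_ ww0]; rewrite weight_ge0 //= /weight (negbTE ww0) ffunE.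
  by case: (om _); rewrite /= ?mulr0 ?add0r ?mulr1.
rewrite (eq_bigl [pred w | w \in e :\ v :\ w0]) ?prodr_const; last by move=> w; rewrite /= !inE andbC.
congr (_ ^+ _).
by have := card_rest eE ve; rewrite (cardsD1 w0 (e :\ v)) w0e; lia.
Qed.

(** For each candidate edge a single choice of [w0], any vertex in play, already gives the factor
    [1 + l * x]. Since [l * x <= 1], this is at least [expR (l * x / 2)], and the exponents add up
    to [l / 2] times the load. *)
Lemma load_potential c v om t (l : R) : v \in chosen c om -> (t <= T)%N -> 0 <= l -> l * r t <= 1 ->
  2^-1 < load R E N t (trajectory c t om) v ->
  expR (l / 4) <= potential l (r t) (r t) v (star E v (chosen c om)) (trajectory c t om).
Proof.
move=> vW tT l0 lr ld; set st := trajectory c t om.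
have r0 := rate_gt0 R N_gt0 t.
pose x e := r t ^+ #|undecided st e v|.
apply: (@le_trans _ _ (\prod_(e in star E v (chosen c om)) 
   (if candidate E st v e then expR (l * x e / 2) else 1))); last first.
  apply: ler_prod => e; rewrite inE => /and3P[eE ve eW].
  apply/andP; split; first by case: ifP; rewrite ?expR_ge0.
  case: ifP => [cd|_]; last by apply: edge_factor_ge1 => //; exact: ltW.
  have /and4P[_ _ /forall_inP nd a0] := cd.
  have /andP[x0 xr] := rateX_le R N_gt0 TN tT a0.
  rewrite -/(x e) in x0 xr.
  apply: (@le_trans _ _ (1 + l * x e)).
    by apply: expR_half_le; rewrite mulr_ge0 //= (le_trans _ lr) // ler_wpM2l.
  rewrite lerD2l ler_wpM2l //.
  have /card_gt0P[w0] := a0; rewrite inE => /andP[w0e /eqP w0N].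
  rewrite (bigD1 w0) //= -[leLHS]addr0; apply: lerD; last first.
    by apply: sumr_ge0 => w1 _; apply: prodr_ge0 => w _; apply: weight_ge0; exact: ltW.
  rewrite /x -prodr_const (eq_bigl (fun w => (w \in e :\ v) && (st w == None))); last first.
    by move=> w; rewrite [in LHS]inE.
  rewrite big_mkcondr /=.
  apply: ler_prod => w we; apply/andP; split; first by case: ifP => // _; exact: ltW.
  rewrite /weight; have [->|_] := eqVneq w w0; first by rewrite w0N eqxx mulr1.
  have := nd w we; case: (st w) => [[]|] //= _; rewrite ?mulr0 ?addr0 ?add0r ?mulr1 //.
rewrite -big_mkcondr /= -expR_sum ler_expR.
rewrite -mulr_suml -mulr_sumr.
have -> : \sum_(e in star E v (chosen c om) | candidate E st v e) x e = load R E N t st v.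
  rewrite /load; apply: eq_bigl => e; rewrite inE.
  case: (boolP (candidate E st v e)) => [/and4P[eE ve /forall_inP nd _]|_]; rewrite ?andbF //.
  rewrite eE ve andbT /=; apply/subsetP => w we.
  have [->//|wv] := eqVneq w v.
  by apply: (@run_chosen R _ E N _ _ c t); apply: nd; rewrite !inE wv we.
nra.
Qed.

(** The inverse of [rate T], the largest [l] with [l * rate t <= 1] for all [t <= T]. *)
Definition lam : R := N%:R / 2 ^+ T.

Lemma lam_ge0 : 0 <= lam. Proof. by rewrite divr_ge0 // exprn_ge0. Qed.

Lemma lam_rate t : (t <= T)%N -> lam * r t <= 1.
Proof.
move=> tT; have N0 : N%:R != 0 :> R by rewrite pnatr_eq0 -lt0n.
rewrite /lam /rate mulrC mulrA divfK // ler_pdivrMr ?exprn_gt0 // mul1r.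
by apply: ler_weXn2l => //; rewrite ler1n.
Qed.

Lemma potential_start c v om d : good v (chosen c om) -> (d < T)%N ->
  potential lam (r 0) (d.+1%:R * r 0) v (star E v (chosen c om)) (trajectory c 0 om) <= expR (lam / 8).
Proof.
move=> /and3P[_ _ few] dT; have l0 := lam_ge0; have r0 := ltW (rate_gt0 R N_gt0 0).
have a0 : 0 <= d.+1%:R * r 0 by rewrite mulr_ge0.
set y := lam * (k.-1%:R * (r 0 * (d.+1%:R * r 0) ^+ (k - 2))).
apply: (@le_trans _ _ (\prod_(e in star E v (chosen c om)) expR y)).
  apply: ler_prod => e es; apply/andP; split.
    by apply: le_trans ler01 _; exact: edge_factor_ge1.
  by apply: le_trans (expR_ge1Dx _); exact: edge_factor_start.
rewrite prodr_const -expRM_natl ler_expR /y mulrCA ler_wpM2l //.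
have N0 : 0 < N%:R :> R by rewrite ltr0n.
apply: (@le_trans _ _ (#|star E v (chosen c om)|%:R * (k.-1%:R * (N%:R^-1 * (T%:R / N%:R) ^+ (k - 2))))).
  rewrite ler_wpM2l // ler_wpM2l // /rate expr0 mul1r ler_wpM2l ?invr_ge0 //.
  by rewrite lerXn2r ?nnegrE ?divr_ge0 // ler_pM2r ?invr_gt0 // ler_nat.
move: few; rewrite -(ler_nat R) !natrM !natrX.
have -> : k.-1 = (k - 2).+1 by lia.
rewrite expr_div_n exprS => few.
rewrite mulrA [X in _ * X](_ : _ = T%:R ^+ (k - 2) / (N%:R * N%:R ^+ (k - 2))); last first.
  by rewrite invfM mulrCA.
rewrite mulrA ler_pdivrMr ?mulr_gt0 ?exprn_gt0 //; lra.
Qed.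

(** The potential starts below [expR (lam / 8)], and an overload forces it up to [expR (lam / 4)];
    Markov's inequality gives the quotient. *)
Lemma overload_bound c v t : (t < T)%N ->
  Pr mu (fun om => good v (chosen c om) && (2^-1 < load R E N t (trajectory c t om) v)) <=
  expR (- (lam / 8)) * Pr mu (fun om => good v (chosen c om)).
Proof.
move=> tT; have l0 := lam_ge0; have r0 := ltW (rate_gt0 R N_gt0 t).
apply: le_trans (@markov_exp _ _ _ mu (fun om => (good v (chosen c om))%:R *
     potential lam (r t) (r t) v (star E v (chosen c om)) (trajectory c t om)) _ (expR (lam / 4)) _ _ _) _.
- exact: expR_gt0.
- move=> om; rewrite mulr_ge0 //; apply: prodr_ge0 => e _.
  by apply: le_trans ler01 _; exact: edge_factor_ge1.
- move=> om /andP[g ld]; rewrite g mul1r; apply: load_potential => //.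
  + by case/and3P: g.
  + exact: ltnW.
  + exact/lam_rate/ltnW.
rewrite ler_pdivrMr ?expR_gt0 //.
apply: le_trans (potential_run c v (ltnW tT) (add0n t) l0) _.
rewrite mulrAC -expRD -ExZ; apply: Ex_le => om.
case g: (good v (chosen c om)); rewrite ?mul0r ?mulr0 // mul1r mulr1.
apply: le_trans (potential_start g tT) _; rewrite ler_expR; lra.
Qed.

Lemma ExN (f : {ffun coin V T q -> bool} -> R) : Ex mu (fun om => - f om) = - Ex mu f.
Proof.
by rewrite -[RHS]mulN1r -ExZ; apply: eq_Ex => om; rewrite mulN1r.
Qed.

(* [d * r j / 4] is a lower bound for the probability that a vertex in play at
   round [j = T - d] joins later on. *)
Definition prospect d j (s : status) : R :=
  (s == Some true)%:R + d%:R * r j / 4 * (s == None)%:R.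

Lemma prospect_run c v j d : (j + d = T)%N ->
  Ex mu (fun om => (good v (chosen c om))%:R * prospect d j (trajectory c j om v)) <=
  Ex mu (fun om => (good v (chosen c om))%:R * prospect 0 T (trajectory c T om v)).
Proof.
elim: d j => [|d IH] j jd; first by rewrite addn0 in jd; rewrite jd.
have jT : (j < T)%N by rewrite -jd addnS ltnS leq_addr.
apply: le_trans (IH j.+1 _); last by rewrite addSn -addnS.
(* [Ex_round] bounds expectations from above; negation turns it into the lower bound needed here. *)
rewrite -lerN2 -!ExN.
under eq_Ex do rewrite -mulrN.
under [leRHS]eq_Ex do rewrite -mulrN.
apply: (Ex_round (g := fun W => (good v W)%:R)
  (h := fun W st => - prospect d j.+1 (st v))
  (h' := fun W st => - prospect d.+1 j (st v))) => // W st _ _.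
rewrite ExN lerN2.
under [leRHS]eq_Ex do rewrite lazy_step_threats ?/prospect /= ?mulr0 ?addr0 //.
case sv: (st v) => [s|]; first by rewrite Ex_lazy_step // sv /prospect /= !mulr0.
rewrite Ex_lazy_step_all // /prospect /= !mulr1 !mulr0 !addr0 !add0r rateS -natr1.
(* The recursion asks for [(r + (1 - r) * d * r / 2) / 2 >= (d + 1) * r / 4], which is equivalent to
   [d * r <= 1]. *)
have dr : d%:R * r j <= 1.
  rewrite /rate mulrA ler_pdivrMr ?ltr0n // mul1r -natrX -natrM ler_nat.
  apply: leq_trans TN; rewrite -jd -addSnnS expnD mulnC expnS.
  by rewrite leq_mul ?leq_pmull //; rewrite ltnW // ltn_expl.
have := rate_gt0 R N_gt0 j; have := ler0n R d; nra.
Qed.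

Lemma join_bound c v :
  T%:R / (4 * N%:R) * Pr mu (fun om => good v (chosen c om)) <=
  Pr mu (fun om => good v (chosen c om) && (trajectory c T om v == Some true)).
Proof.
have := prospect_run c v (add0n T).
rewrite [leRHS](_ : _ = Pr mu (fun om => good v (chosen c om) && (trajectory c T om v == Some true))); last first.
  by apply: eq_Ex => om; rewrite /prospect !mul0r addr0 -natrM mulnb.
apply: le_trans; rewrite -ExZ; apply: Ex_le => om.
case g: (good v (chosen c om)); rewrite ?mul0r ?mulr0 //.
have /and3P[] := g; rewrite inE => vW _ _.
rewrite /prospect /= ffunE vW /= mul1r !mulr1 add0r /rate expr0 invfM; lra.
Qed.

Lemma joined_bound c v :
  (T%:R / (4 * N%:R) - T%:R * expR (- (lam / 8))) * Pr mu (fun om => good v (chosen c om)) <=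
  Pr mu (fun om => v \in joined c om).
Proof.
rewrite mulrBl; set G := Pr mu _.
have jb := join_bound c v; rewrite -/G in jb.
have ob : Pr mu (fun om => [exists t : 'I_T, good v (chosen c om) && (2^-1 < load R E N t (trajectory c t om) v)])
   <= T%:R * expR (- (lam / 8)) * G.
  apply: le_trans (Pr_exists mu predT _) _.
  rewrite -mulrA -[X in X%:R * _]card_ord mulr_natl -sumr_const.
  by apply: ler_sum => t _; exact: overload_bound.
have := lerD jb ob.
suff : Pr mu (fun om => good v (chosen c om) && (trajectory c T om v == Some true)) <=
  Pr mu (fun om => v \in joined c om) +
  Pr mu (fun om => [exists t : 'I_T, good v (chosen c om) && (2^-1 < load R E N t (trajectory c t om) v)]).
  lra.
apply: le_trans (Pr_union _ _ _); apply: Pr_le => om /andP[g jn].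
rewrite inE jn /= orbC; apply/orP.
case: (boolP [forall t : 'I_T, load R E N t (trajectory c t om) v <= 2^-1]); first by right.
rewrite negb_forall => /existsP[t]; rewrite -ltNge => lt; left.
by apply/existsP; exists t; rewrite g lt.
Qed.

End SingleColour.

(** * Independence and locality of the sets [joined] *)

Section Joined.
Variables (R : realType) (V : finType) (E : {set {set V}}).
Variables (k N T q : nat).
Hypothesis lin : forall (e f : {set V}) x w, e \in E -> f \in E -> x != w ->
  x \in e -> w \in e -> x \in f -> w \in f -> e = f.
Hypothesis k3 : (2 < k)%N.
Hypothesis unif : forall e : {set V}, e \in E -> #|e| = k.

Implicit Types (st : state V) (v w x : V) (e f W S : {set V}) (c : 'I_q) (i : nat).
Implicit Types (om : {ffun coin V T q -> bool}) (F : {set {set V}}).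
Local Notation trajectory := (trajectory R E N).
Local Notation joined := (joined R E N).

Lemma run_stable c i j om w s : (i <= j)%N -> trajectory c i om w = Some s -> trajectory c j om w = Some s.
Proof.
move=> /subnK <-; elim: (j - i)%N => // n IH h.
by rewrite addSn /= /cstep /step ffunE IH.
Qed.

(** If all of [e] joined, take the last round that starts with at least two of its vertices in play.
    All of these except possibly one vertex [w] become active in that round, so [e] is a threat to
    [w] that fires. As [w] was never overloaded it heeds the threat and is discarded, a
    contradiction. *)
Lemma joined_independent c om e : e \in E -> ~~ (e \subset joined c om).
Proof.
move=> eE; apply/negP => /subsetP ej.
have eT w : w \in e -> trajectory c T om w = Some true.
  by move=> /ej; rewrite inE => /andP[/eqP].
have eL w i : w \in e -> (i < T)%N -> load R E N i (trajectory c i om) w <= 2^-1.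
  by move=> /ej; rewrite inE => /andP[_ /forallP h] iT; exact: (h (Ordinal iT)).
have alive i w : w \in e -> (i <= T)%N -> trajectory c i om w != Some false.
  by move=> we iT; apply/eqP => /(run_stable iT); rewrite eT.
pose A i := [set w in e | trajectory c i om w == None].
have AT : A T = set0.
  by apply/setP => w; rewrite !inE; case: (boolP (w \in e)) => //= /eT ->.
have Aex : exists i, (#|A i| <= 1)%N by exists T; rewrite AT cards0.
have [m m1 mmin] := ex_minnP Aex.
case: m m1 mmin => [A0 _|i A1 mmin].
  suff Ae : A 0%N = e by move: A0; rewrite Ae unif // leqNgt (ltnW k3).
  apply/setP => w; rewrite inE; case: (boolP (w \in e)) => //= we.
  by have := alive 0%N w we (leq0n _); rewrite ffunE; case: (om _).
have iT : (i < T)%N.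
  have : (#|A T| <= 1)%N by rewrite AT cards0.
  by move/mmin.
have Ai : (1 < #|A i|)%N.
  by rewrite ltnNge; apply/negP => /mmin; rewrite ltnn.
have [w wA wA'] : exists2 w, w \in A i & A i.+1 \subset [set w].
  have sub : A i.+1 \subset A i.
    apply/subsetP => w; rewrite !inE => /andP[-> /=].
    by case rw: (trajectory c i om w) => [s|] //; rewrite /cstep /step ffunE rw.
  have [A0|/set0Pn[w wA]] := eqVneq (A i.+1) set0.
    have /card_gt0P[w wA] := ltnW Ai; exists w => //; by rewrite A0 sub0set.
  exists w; first exact: (subsetP sub).
  by apply/subsetP => x xA; rewrite inE; apply/eqP; apply: (card_le1_eqP A1).
have next x : x \in A i -> survives R E N i (trajectory c i om) x (om (kill_coin E T c i x (trajectory c i om)))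
     (fun x => om (act_coin T c i x)).
  rewrite inE => /andP[xe /eqP xN]; have := alive i.+1 x xe iT.
  by rewrite /= /cstep /step ffunE xN; case: ifP.
have act x : x \in A i -> x != w -> om (act_coin T c i x).
  move=> xA xw; have := next _ xA; move: xA; rewrite inE => /andP[xe /eqP xN] sv.
  have : x \notin A i.+1 by apply: contraNN xw => /(subsetP wA'); rewrite inE.
  rewrite inE xe /= /cstep /step ffunE xN sv; by case: (om _).
have /existsP[x /andP[xA xw]] : [exists x, (x \in A i) && (x != w)].
  apply: contraTT Ai => /existsPn h; rewrite -leqNgt.
  apply/card_le1_eqP => x y xA yA.
  by have := h x; have := h y; rewrite xA yA /= !negbK => /eqP-> /eqP->.
have we : w \in e by move: wA; rewrite inE => /andP[].
have := next _ wA; rewrite /survives => /andP[_ /forall_inP /(_ e)].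
rewrite /threats eL // inE => h.
have : candidate E (trajectory c i om) w e.
  rewrite /candidate eE we /=; apply/andP; split.
    by apply/forall_inP => y /setD1P[_ ye]; apply: alive => //; exact: ltnW.
  apply/card_gt0P; exists x; move: xA; rewrite !inE xw => /andP[-> ->] //.
move=> /h /negP; apply; apply/forall_inP => y; rewrite !inE => /andP[/andP[yw ye] yN].
by apply: act; rewrite ?inE ?ye.
Qed.

Lemma joined_chosen c om w : w \in joined c om -> w \in chosen c om.
Proof.
by rewrite inE => /andP[/eqP h _]; apply: (@run_chosen R _ E N _ _ c T); rewrite h.
Qed.

Definition grow (S : {set V}) : {set V} := S :|: \bigcup_(e in E | ~~ [disjoint e & S]) e.

Lemma grow_edge S e x w : e \in E -> w \in S -> w \in e -> x \in e -> x \in grow S.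
Proof.
move=> eE wS we xe; rewrite inE; apply/orP; right; apply/bigcupP; exists e => //.
by rewrite eE /=; apply/pred0Pn; exists w; rewrite /= we wS.
Qed.

Lemma grow_sub S : S \subset grow S.
Proof. exact: subsetUl. Qed.

Lemma iter_grow_sub n S : S \subset iter n grow S.
Proof. elim: n => //= n IH; exact: subset_trans IH (grow_sub _). Qed.

Lemma iter_grow_mono n m S : (n <= m)%N -> iter n grow S \subset iter m grow S.
Proof. by move=> /subnK <-; rewrite iterD iter_grow_sub. Qed.

Lemma undecided_local st st' w e : {in e, st =1 st'} ->
  undecided st e w = undecided st' e w.
Proof.
move=> h; apply/setP => x; rewrite !inE; case: (boolP (x \in e)) => [xe|]; rewrite ?andbF //.
by rewrite h.
Qed.

Lemma candidate_local st st' w S e : w \in S -> {in grow S, st =1 st'} ->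
  candidate E st w e = candidate E st' w e.
Proof.
move=> wS h; rewrite /candidate; case: (boolP (e \in E)) => //= eE.
case: (boolP (w \in e)) => //= we.
have he : {in e, st =1 st'} by move=> x xe; apply: h; exact: grow_edge wS we xe.
rewrite (undecided_local w he); congr (_ && _); apply: eq_forallb => x.
by case: (boolP (x \in e :\ w)) => // /setD1P[_ xe]; rewrite he.
Qed.

Lemma undecided_grow st st' w S e : w \in S -> {in grow S, st =1 st'} ->
  e \in E -> w \in e -> undecided st e w = undecided st' e w.
Proof.
move=> wS h eE we; apply: undecided_local => x xe; apply: h; exact: grow_edge wS we xe.
Qed.

Lemma load_local i st st' w S : w \in S -> {in grow S, st =1 st'} ->
  load R E N i st w = load R E N i st' w.
Proof.
move=> wS h; rewrite /load (eq_bigl (candidate E st' w)); last first.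
  by move=> e; exact: candidate_local wS h.
by apply: eq_bigr => e /and4P[eE we _ _]; rewrite (undecided_grow wS h).
Qed.

Lemma visible_local st st' w S : w \in S -> {in grow S, st =1 st'} ->
  visible E st w = visible E st' w.
Proof.
move=> wS h; apply/ffunP => x; rewrite !ffunE; case: existsP => // -[e /andP[eE /andP[we xe]]].
by apply: h; exact: grow_edge wS we xe.
Qed.

(** Information travels one edge per round, through the view that selects the extra coin and through
    the threats. *)
Lemma run_local c i om om' S : 
  (forall j : coin V T q, j.1.1 = c -> j.1.2 \in iter i grow S -> om j = om' j) ->
  {in S, trajectory c i om =1 trajectory c i om'}.
Proof.
elim: i S => [|i IH] S h w wS; first by rewrite !ffunE h.
have IHS : {in grow S, trajectory c i om =1 trajectory c i om'}.
  by apply: IH => j jc jS; apply: h => //; rewrite iterSr.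
have sub : grow S \subset iter i.+1 grow S by rewrite iterSr; exact: iter_grow_sub.
have coins x s : x \in grow S -> om (c, x, s) = om' (c, x, s).
  by move=> /(subsetP sub) xs; apply: h.
have wG : w \in grow S by apply: (subsetP (grow_sub S)).
rewrite /= /cstep /step !ffunE (IHS _ wG).
case: (trajectory c i om' w) => //.
have -> : om (act_coin T c i w) = om' (act_coin T c i w) by exact: coins.
congr (if _ then _ else _); rewrite /survives; congr (~~ _ && _).
  by rewrite /kill_coin (visible_local wS IHS) coins.
have -> : threats R E N i (trajectory c i om) w = threats R E N i (trajectory c i om') w.
  rewrite /threats (load_local i wS IHS); case: ifP => // _; apply/setP => e.
  by rewrite !inE (candidate_local e wS IHS).
apply: eq_forallb => e; case: (boolP (e \in threats _ _ _ _ _ _)) => //= /threatsP/and4P[eE we _ _].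
congr (~~ _); rewrite (undecided_grow wS IHS) //; apply: eq_forallb => x.
case: (boolP (x \in undecided _ _ _)) => //=; rewrite !inE => /andP[/andP[_ xe] _].
by rewrite /act_coin coins //; exact: grow_edge wS we xe.
Qed.

Lemma joined_local c w : depends_on
  [set j : coin V T q | (j.1.1 == c) && (j.1.2 \in iter T.+1 grow [set w])]
  (fun om => w \in joined c om).
Proof.
move=> om om' h.
have loc i : (i <= T)%N -> {in grow [set w], trajectory c i om =1 trajectory c i om'}.
  move=> iT; apply: run_local => j jc ji; apply: h; rewrite inE jc eqxx andTb.
  by rewrite iterSr; apply: (subsetP (iter_grow_mono _ iT)).
have w1 : w \in [set w] by rewrite inE.
have -> : (w \in joined c om) = (trajectory c T om w == Some true) &&
    [forall i : 'I_T, load R E N i (trajectory c i om) w <= 2^-1] by rewrite inE.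
have -> : (w \in joined c om') = (trajectory c T om' w == Some true) &&
    [forall i : 'I_T, load R E N i (trajectory c i om') w <= 2^-1] by rewrite inE.
have -> : trajectory c T om w = trajectory c T om' w.
  by apply: (loc T (leqnn T)); apply: (subsetP (grow_sub _)).
congr (_ && _).
by apply: eq_forallb => i; rewrite (load_local _ w1 (loc i (ltnW (ltn_ord i)))).
Qed.

End Joined.

(** Applied once per quantifier, this counts the configurations of [lollipop], [triangle] and
    [square] while their quantifiers are peeled off. *)
Lemma Pr_exists_le (R : realType) (J X : finType) (p : coin_law R J X) (I : finType)
    (P : pred I) (A : I -> pred {ffun J -> X}) (n : nat) (t : R) :
  0 <= t -> (#|P| <= n)%N -> (forall i, P i -> Pr p (A i) <= t) ->
  Pr p (fun w => [exists i, P i && A i w]) <= n%:R * t.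
Proof.
move=> t0 Pn At; apply: le_trans (Pr_exists p P A) _.
apply: (@le_trans _ _ (\sum_(i | P i) t)); first exact: ler_sum.
by rewrite sumr_const -[leLHS]mulr_natl ler_wpM2r // ler_nat.
Qed.

Lemma square_size (k : nat) : (2 < k)%N -> (3 * k - 1 <= 1 + (k + (2 * k - 1) - 1))%N.
Proof. move=> k3; lia. Qed.

(** * Short cycles in the random sample *)

Section GoodSample.
Variables (R : realType) (V : finType) (E : {set {set V}}).
Variables (k N T q D : nat) (delta : R).
Hypothesis N_gt0 : (0 < N)%N.
Hypothesis TN : (2 ^ T <= N)%N.
Hypothesis delta01 : 0 <= delta <= 1.
Hypothesis lin : forall (e f : {set V}) x w, e \in E -> f \in E -> x != w ->
  x \in e -> w \in e -> x \in f -> w \in f -> e = f.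
Hypothesis k3 : (2 < k)%N.
Hypothesis unif : forall e : {set V}, e \in E -> #|e| = k.
Hypothesis deg : forall v : V, (#|[set e in E | v \in e]| <= D)%N.

Implicit Types (v w x y : V) (e f W S : {set V}) (c : 'I_q).
Implicit Types (om : {ffun coin V T q -> bool}).
Local Notation mu := (fair E q N_gt0 TN delta01).

Let d0 : 0 <= delta. Proof. by case/andP: delta01. Qed.
Let d1 : delta <= 1. Proof. by case/andP: delta01. Qed.

Lemma Pr_chosen c S : Pr mu (fun om => S \subset chosen c om) = delta ^+ #|S|.
Proof.
rewrite -prodr_const [LHS](_ : _ = Ex mu (fun om => \prod_(x in S) (om (in_coin T c x))%:R)).
  rewrite (@Ex_prod_indep _ _ _ mu _ S (fun x => [set in_coin T c x])).
  - by apply: eq_bigr => x _; rewrite (Ex_coin E N_gt0 TN delta01 _ (fun b => b%:R)) /bias /= mulr0 addr0 mulr1.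
  - by move=> x _ om om' h; rewrite h ?inE.
  - by move=> x y _ _ xy; rewrite disjoints1 inE; apply: contraNN xy => /eqP[->].
apply: eq_Ex => om; case: (boolP (S \subset _)) => [/subsetP h|].
  by rewrite big1 // => x /h; rewrite inE => ->.
move=> /subsetPn[x xS]; rewrite inE => /negbTE xo.
by rewrite (bigD1 x) //= xo mul0r.
Qed.

Lemma Pr_chosen_le c S n : (n <= #|S|)%N ->
  Pr mu (fun om => S \subset chosen c om) <= delta ^+ n.
Proof. by move=> nS; rewrite Pr_chosen ler_wiXn2l. Qed.

Lemma card_edges2 x w : x != w -> (#|[pred f | [&& f \in E, x \in f & w \in f]]| <= 1)%N.
Proof.
move=> xw; apply/card_le1_eqP => e f /and3P[eE xe we] /and3P[fE xf wf].
exact: (lin fE eE xw xf wf xe we).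
Qed.

Lemma deg_pred v : (#|[pred e | (e \in E) && (v \in e)]| <= D)%N.
Proof. by apply: leq_trans (deg v); rewrite cardsE. Qed.

Lemma card_edge e : e \in E -> (#|[pred x in e]| <= k)%N.
Proof. by move=> /unif eq_k; rewrite -[leqRHS]eq_k; apply: subset_leq_card; apply/subsetP. Qed.

Lemma edges_meet e f x : e \in E -> f \in E -> e != f -> x \in e -> x \in f ->
  forall y, y \in e -> y \in f -> y = x.
Proof.
move=> eE fE ef xe xf y ye yf; apply: contraNeq ef => yx.
by apply/eqP; apply: lin yx ye xe yf xf.
Qed.

Lemma third_vertex e x y : e \in E -> exists2 z, z \in e & (z != x) && (z != y).
Proof.
move=> eE; have : (0 < #|e :\ x :\ y|)%N.
  have := unif eE; rewrite (cardsD1 x e) (cardsD1 y (e :\ x)).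
  by have := leq_b1 (x \in e); have := leq_b1 (y \in e :\ x); lia.
by move=> /card_gt0P[z]; rewrite !inE => /and3P[zy zx ze]; exists z; rewrite ?zx ?zy.
Qed.

Lemma card_union e f x : e \in E -> f \in E -> e != f -> x \in e -> x \in f ->
  #|e :|: f| = (2 * k - 1)%N.
Proof.
move=> eE fE ef xe xf; rewrite cardsU (unif eE) (unif fE).
suff -> : e :&: f = [set x] by rewrite cards1 mul2n addnn.
apply/setP => y; rewrite !inE; apply/andP/eqP => [[ye yf]|->//].
exact: (edges_meet eE fE ef xe xf).
Qed.

(* The three ways in which a set can fail to be clean at [v]. *)
Definition lollipop v W :=
  [exists e, ((e \in E) && (v \in e)) && [exists x, (x \in e) && [exists f, ((f \in E) && (x \in f)) &&
   [exists y, (y \in f) && [exists w, (w \in e) && [exists f', [&& f' \in E, w \in f' & y \in f'] &&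
    [&& x != w, w != y, v \notin f, v \notin f' & (e :|: f :|: f') \subset W]]]]]]].

Definition triangle v W :=
  [exists e, ((e \in E) && (v \in e)) && [exists x, (x \in e) && [exists e', ((e' \in E) && (v \in e')) &&
   [exists w, (w \in e') && [exists f, [&& f \in E, x \in f & w \in f] &&
    [&& x != w, e != e', v \notin f & (e :|: e' :|: f) \subset W]]]]]].

Definition square v W :=
  [exists e, ((e \in E) && (v \in e)) && [exists x, (x \in e) && [exists f, ((f \in E) && (x \in f)) &&
   [exists y, (y \in f) && [exists e', ((e' \in E) && (v \in e')) && [exists w, (w \in e') &&
    [exists f', [&& f' \in E, w \in f' & y \in f'] &&
    [&& x != v, w != v, e != e', w != y, v \notin f, v \notin f', [disjoint f & e'], [disjoint f' & e]
     & (e :|: e' :|: f :|: f') \subset W]]]]]]]].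

Lemma exists_intro (I : finType) (P Q : pred I) i : P i -> Q i -> [exists i, P i && Q i].
Proof. by move=> Pi Qi; apply/existsP; exists i; rewrite Pi Qi. Qed.

(** A lollipop arises when [x] and [w] lie on the same edge at [v], a triangle when [f] meets [e']
    or [f'] meets [e], and a square otherwise. *)
Lemma unclean_cases v W : ~~ clean E v W -> [|| lollipop v W, triangle v W | square v W].
Proof.
rewrite /clean.
move=> /forall_inPn[e eE] /forall_inPn[e' e'E] /forall_inPn[f fE] /forall_inPn[f' f'E].
move=> /forall_inPn[x xe] /forall_inPn[w we']; rewrite negb_imply.
case/andP=> /and5P[ve ve' eW e'W /and5P[fW f'W xf wf' /and3P[vf vf' xw]]].
rewrite -setI_eq0 => /set0Pn[y]; rewrite inE => /andP[yf yf'].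
move: xe we'; rewrite !inE => /andP[xv xe] /andP[wv we'].
have tri a b g x' w' : a \in E -> b \in E -> g \in E -> v \in a -> v \in b -> x' \in a -> w' \in b ->
   x' \in g -> w' \in g -> x' != w' -> a != b -> v \notin g -> a \subset W -> b \subset W -> g \subset W ->
   triangle v W.
  move=> aE bE gE va vb x'a w'b x'g w'g xw' ab vg aW bW gW.
  apply: (exists_intro (i := a)); first by rewrite aE.
  apply: (exists_intro (i := x')) => //.
  apply: (exists_intro (i := b)); first by rewrite bE.
  apply: (exists_intro (i := w')) => //.
  apply: (exists_intro (i := g)); first by rewrite gE x'g.
  by rewrite xw' ab vg !subUset aW bW gW.
have [ee'|ee'] := eqVneq e e'.
  apply/orP; left; subst e'.
  apply: (exists_intro (i := e)); first by rewrite eE.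
  apply: (exists_intro (i := x)) => //.
  apply: (exists_intro (i := f)); first by rewrite fE.
  apply: (exists_intro (i := y)) => //.
  apply: (exists_intro (i := w)) => //.
  apply: (exists_intro (i := f')); first by rewrite f'E wf'.
  rewrite xw vf vf' !subUset eW fW f'W /= andbT.
  apply: contraNneq vf => wy; have -> // : f = e.
  by apply: lin xw xf _ xe we' => //; rewrite wy.
have [/existsP[z /andP[ze' zf]]|/existsPn ne'] := boolP [exists z, (z \in e') && (z \in f)].
  apply/orP; right; apply/orP; left.
  have xz : x != z.
    apply: contraNneq ee' => xz; apply/eqP; apply: lin xv xe ve _ ve' => //; by rewrite xz.
  exact: (tri e e' f x z).
have [/existsP[z /andP[ze zf']]|/existsPn ne] := boolP [exists z, (z \in e) && (z \in f')].
  apply/orP; right; apply/orP; left.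
  have zw : z != w.
    apply: contraNneq ee' => zw; apply/eqP; apply: lin wv _ ve we' ve' => //; by rewrite -zw.
  exact: (tri e e' f' z w).
apply/orP; right; apply/orP; right.
apply: (exists_intro (i := e)); first by rewrite eE.
apply: (exists_intro (i := x)) => //.
apply: (exists_intro (i := f)); first by rewrite fE.
apply: (exists_intro (i := y)) => //.
apply: (exists_intro (i := e')); first by rewrite e'E.
apply: (exists_intro (i := w)) => //.
apply: (exists_intro (i := f')); first by rewrite f'E wf'.
rewrite xv wv ee' vf vf' !subUset eW fW f'W e'W /= !andbT.
apply/and3P; split.
- by apply: contraTneq we' => wy; have := ne' w; rewrite negb_and wy yf orbF.
- by apply/pred0P => z /=; rewrite andbC; apply/negbTE/ne'.
- by apply/pred0P => z /=; rewrite andbC; apply/negbTE/ne.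
Qed.

(** The edge [f'] is determined by its vertices [w] and [y], hence the factor 1. For the exponent,
    [e] and [f] have [2 * k - 1] vertices together and, as [k >= 3], [f'] has a further vertex
    outside both. *)
Lemma Pr_lollipop c v : Pr mu (fun om => lollipop v (chosen c om)) <=
  D%:R * (k%:R * (D%:R * (k%:R * (k%:R * (1%:R * delta ^+ (2 * k)))))).
Proof.
have X0 n : 0 <= delta ^+ n by rewrite exprn_ge0.
apply: Pr_exists_le; [by rewrite ?mulr_ge0|exact: deg_pred|].
move=> e /andP[eE ve]; apply: Pr_exists_le; [by rewrite ?mulr_ge0| exact: card_edge|].
move=> x xe; apply: Pr_exists_le; [by rewrite ?mulr_ge0| exact: deg_pred|].
move=> f /andP[fE xf]; apply: Pr_exists_le; [by rewrite ?mulr_ge0| exact: card_edge|].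
move=> y yf; apply: Pr_exists_le; [by rewrite ?mulr_ge0| exact: card_edge|].
move=> w we.
have [->|wy] := eqVneq w y.
  rewrite (@eq_Pr _ _ _ mu _ (fun=> false)) ?/Pr ?Ex_cst ?mulr_ge0 // => om.
  by apply/existsP => -[f']; rewrite !andbF.
apply: Pr_exists_le; [by []|exact: card_edges2|].
move=> f' /and3P[f'E wf' yf'].
case: (boolP [&& x != w, v \notin f & v \notin f']); last first.
  move=> h; rewrite (@eq_Pr _ _ _ mu _ (fun=> false)) ?/Pr ?Ex_cst // => om.
  by apply/negP => /and5P[a _ b d _]; move: h; rewrite a b d.
move=> /and3P[xw vf vf'].
apply: (@le_trans _ _ (Pr mu (fun om => e :|: f :|: f' \subset chosen c om))).
  by apply: Pr_le => om /and5P[].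
apply: Pr_chosen_le.
have ef : e != f by apply: contraNneq vf => <-.
have ef' : e != f' by apply: contraNneq vf' => <-.
have ff' : f' != f.
  apply: contraNneq ef => ff; apply/eqP; apply: lin xw xe we xf _ => //; by rewrite -ff.
have [z zf' /andP[zw zy]] := third_vertex w y f'E.
have ze : z \notin e.
  by apply: contraNN zw => ze; apply/eqP; apply: (edges_meet eE f'E ef' we wf').
have zf : z \notin f.
  by apply: contraNN zy => zf; apply/eqP; apply: (edges_meet f'E fE ff' yf' yf).
have : z |: (e :|: f) \subset e :|: f :|: f'.
  by rewrite subUset subsetUl andbT sub1set !inE zf' orbT.
move=> /subset_leq_card; apply: leq_trans.
rewrite cardsU1 (card_union eE fE ef xe xf) !inE (negbTE ze) (negbTE zf) /=.
by rewrite add1n subn1 prednK // muln_gt0 (ltn_trans _ k3).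
Qed.

Lemma Pr_triangle c v : Pr mu (fun om => triangle v (chosen c om)) <=
  D%:R * (k%:R * (D%:R * (k%:R * (1%:R * delta ^+ (2 * k))))).
Proof.
have X0 n : 0 <= delta ^+ n by rewrite exprn_ge0.
apply: Pr_exists_le; [by rewrite ?mulr_ge0|exact: deg_pred|].
move=> e /andP[eE ve]; apply: Pr_exists_le; [by rewrite ?mulr_ge0| exact: card_edge|].
move=> x xe; apply: Pr_exists_le; [by rewrite ?mulr_ge0| exact: deg_pred|].
move=> e' /andP[e'E ve']; apply: Pr_exists_le; [by rewrite ?mulr_ge0| exact: card_edge|].
move=> w we'.
have [->|xw] := eqVneq x w.
  rewrite (@eq_Pr _ _ _ mu _ (fun=> false)) ?/Pr ?Ex_cst ?mulr_ge0 // => om.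
  by apply/existsP => -[f]; rewrite !andbF.
apply: Pr_exists_le; [by []|exact: card_edges2|].
move=> f /and3P[fE xf wf].
case: (boolP [&& e != e' & v \notin f]); last first.
  move=> h; rewrite (@eq_Pr _ _ _ mu _ (fun=> false)) ?/Pr ?Ex_cst // => om.
  by apply/negP => /and4P[_ a b _]; move: h; rewrite a b.
move=> /andP[ee' vf].
apply: (@le_trans _ _ (Pr mu (fun om => e :|: e' :|: f \subset chosen c om))).
  by apply: Pr_le => om /and4P[].
apply: Pr_chosen_le.
have ef : e != f by apply: contraNneq vf => <-.
have ef' : e' != f by apply: contraNneq vf => <-.
have [z zf /andP[zx zw]] := third_vertex x w fE.
have ze : z \notin e.
  by apply: contraNN zx => ze; apply/eqP; apply: (edges_meet eE fE ef xe xf).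
have ze' : z \notin e'.
  by apply: contraNN zw => ze'; apply/eqP; apply: (edges_meet e'E fE ef' we' wf).
have : z |: (e :|: e') \subset e :|: e' :|: f.
  by rewrite subUset subsetUl andbT sub1set !inE zf orbT.
move=> /subset_leq_card; apply: leq_trans.
rewrite cardsU1 (card_union eE e'E ee' ve ve') !inE (negbTE ze) (negbTE ze') /=.
by rewrite add1n subn1 prednK // muln_gt0 (ltn_trans _ k3).
Qed.

(** Here [e], [e'] and [f] have [3 * k - 2] vertices together, and [f'] adds one more. *)
Lemma Pr_square c v : Pr mu (fun om => square v (chosen c om)) <=
  D%:R * (k%:R * (D%:R * (k%:R * (D%:R * (k%:R * (1%:R * delta ^+ (3 * k - 1))))))).
Proof.
have X0 n : 0 <= delta ^+ n by rewrite exprn_ge0.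
apply: Pr_exists_le; [by rewrite ?mulr_ge0|exact: deg_pred|].
move=> e /andP[eE ve]; apply: Pr_exists_le; [by rewrite ?mulr_ge0| exact: card_edge|].
move=> x xe; apply: Pr_exists_le; [by rewrite ?mulr_ge0| exact: deg_pred|].
move=> f /andP[fE xf]; apply: Pr_exists_le; [by rewrite ?mulr_ge0| exact: card_edge|].
move=> y yf; apply: Pr_exists_le; [by rewrite ?mulr_ge0| exact: deg_pred|].
move=> e' /andP[e'E ve']; apply: Pr_exists_le; [by rewrite ?mulr_ge0| exact: card_edge|].
move=> w we'.
have [->|wy] := eqVneq w y.
  rewrite (@eq_Pr _ _ _ mu _ (fun=> false)) ?/Pr ?Ex_cst ?mulr_ge0 // => om.
  by apply/existsP => -[f']; rewrite !andbF.
apply: Pr_exists_le; [by []|exact: card_edges2|].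
move=> f' /and3P[f'E wf' yf'].
case: (boolP [&& e != e', v \notin f, v \notin f', [disjoint f & e'] & [disjoint f' & e]]); last first.
  move=> h; rewrite (@eq_Pr _ _ _ mu _ (fun=> false)) ?/Pr ?Ex_cst // => om.
  by apply/negP => /and5P[_ _ a _ /and5P[b d g i _]]; move: h; rewrite a b d g i.
move=> /and5P[ee' vf vf' dfe' df'e].
apply: (@le_trans _ _ (Pr mu (fun om => e :|: e' :|: f :|: f' \subset chosen c om))).
  by apply: Pr_le => om /and5P[_ _ _ _ /and5P[]].
apply: Pr_chosen_le.
have ef : e != f by apply: contraNneq vf => <-.
have e'f' : e' != f' by apply: contraNneq vf' => <-.
have ff' : f' != f by apply: contraTneq wf' => ->; rewrite (disjointFl dfe').
have [z zf' /andP[zw zy]] := third_vertex w y f'E.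
have ze : z \notin e by rewrite (disjointFr df'e).
have ze' : z \notin e'.
  by apply: contraNN zw => ze'; apply/eqP; apply: (edges_meet e'E f'E e'f' we' wf').
have zf : z \notin f.
  by apply: contraNN zy => zf; apply/eqP; apply: (edges_meet f'E fE ff' yf' yf).
have : z |: (f :|: (e :|: e')) \subset e :|: e' :|: f :|: f'.
  by rewrite subUset sub1set !inE zf' !orbT /= [f :|: _]setUC subsetUl.
move=> /subset_leq_card; apply: leq_trans.
rewrite cardsU1 !inE (negbTE ze) (negbTE zf) (negbTE ze') /=.
rewrite cardsU (card_union eE e'E ee' ve ve') (unif fE).
have -> : f :&: (e :|: e') = [set x].
  apply/setP => u; rewrite !inE; apply/andP/eqP => [[uf /orP[ue|ue']]|->]; last by rewrite xe xf.
    exact: (edges_meet eE fE ef xe xf).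
  by move: ue'; rewrite (disjointFr dfe').
rewrite cards1; apply: square_size k3.
Qed.

End GoodSample.

(** From ['C(d, m) * m! <= d ^ m] and [(z - m) ^ m <= 'C(z, m) * m!]. *)
Lemma bin_ratio (a b d z m : nat) : (m <= z)%N -> (b * d <= a * (z - m))%N ->
  (b ^ m * 'C(d, m) <= a ^ m * 'C(z, m))%N.
Proof.
move=> mz daz.
have ub n i : (n ^_ i <= n ^ i)%N.
  elim: i n => // i IH [|n]; first by rewrite ffact0n.
  rewrite ffactnS expnS leq_mul2l /=; apply: leq_trans (IH n) _.
  by case: i {IH} => // i; rewrite leq_exp2r.
have lb i n : (i <= n)%N -> ((n - i) ^ i <= n ^_ i)%N.
  elim: i n => // i IH [|n] // iN; rewrite ffactnS expnS subSS leq_mul ?IH //.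
  by rewrite (leq_trans (leq_subr _ _)).
rewrite -(leq_pmul2r (fact_gt0 m)) -!mulnA !bin_ffact.
apply: (@leq_trans (b ^ m * d ^ m)); first by rewrite leq_mul2l ub orbT.
rewrite -expnMn; apply: (@leq_trans ((a * (z - m)) ^ m)).
  by case: m mz daz => // m _; rewrite leq_exp2r.
by rewrite expnMn leq_mul2l lb ?orbT.
Qed.

Lemma half_budget (R : realFieldType) (t a b g d h : R) : 0 <= t ->
  a <= t / 16 -> b <= t / 16 -> g <= t / 16 -> d <= t / 4 ->
  t <= h + (a + (b + (g + d))) -> t / 2 <= h.
Proof. lra. Qed.

(** * Lower bounds for joining, and sets avoided by one colour *)

Section Phase.
Variables (R : realType) (V : finType) (E : {set {set V}}).
Variables (k N T q D : nat) (delta : R).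
Hypothesis N_gt0 : (0 < N)%N.
Hypothesis TN : (2 ^ T <= N)%N.
Hypothesis delta01 : 0 <= delta <= 1.
Hypothesis lin : forall (e f : {set V}) x w, e \in E -> f \in E -> x != w ->
  x \in e -> w \in e -> x \in f -> w \in f -> e = f.
Hypothesis k3 : (2 < k)%N.
Hypothesis unif : forall e : {set V}, e \in E -> #|e| = k.
Hypothesis deg : forall v : V, (#|[set e in E | v \in e]| <= D)%N.

Implicit Types (v w x y : V) (e f W S : {set V}) (c : 'I_q).
Implicit Types (om : {ffun coin V T q -> bool}).
Local Notation mu := (fair E q N_gt0 TN delta01).
Local Notation joined := (joined R E N).
Local Notation lam := (lam R N T).

Let d0 : 0 <= delta. Proof. by case/andP: delta01. Qed.

Hypothesis lollipop_small : 16 * k%:R ^+ 3 * D%:R ^+ 2 * delta ^+ (2 * k - 1) <= 1.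
Hypothesis square_small : 16 * k%:R ^+ 3 * D%:R ^+ 3 * delta ^+ (3 * k - 2) <= 1.
Hypothesis sparse : 4 * D%:R * (8 * k.-1 * T ^ (k - 2))%:R * delta ^+ k.-1 <= N%:R ^+ k.-1.

(** First moment: an edge at [v] lies in the sample with probability [delta ^+ k], of which one
    factor [delta] is due to [v] itself. So crowding costs at most a quarter of the probability that
    [v] is sampled. *)
Lemma Pr_crowded c v :
  Pr mu (fun om => ~~ (#|star E v (chosen c om)| * (8 * k.-1 * T ^ (k - 2)) <= N ^ k.-1)%N)
    <= delta / 4.
Proof.
set B := (8 * k.-1 * T ^ (k - 2))%N.
have N0 : 0 < N%:R ^+ k.-1 :> R by rewrite exprn_gt0 ?ltr0n.
apply: le_trans (@markov_exp _ _ _ mu (fun om => B%:R * #|star E v (chosen c om)|%:R) _ _ N0 _ _) _.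
- by move=> om; rewrite mulr_ge0.
- by move=> om; rewrite -ltnNge -natrM -natrX ler_nat mulnC; exact: ltnW.
rewrite ler_pdivrMr // ExZ.
have -> : Ex mu (fun om => #|star E v (chosen c om)|%:R) =
    \sum_(e in [set e in E | v \in e]) Pr mu (fun om => e \subset chosen c om).
  rewrite -Ex_sum; apply: eq_Ex => om; rewrite -sum1_card natr_sum big_mkcond [RHS]big_mkcond /=.
  by apply: eq_bigr => e _; rewrite !inE; case: (e \in E); case: (v \in e); case: (_ \subset _).
apply: (@le_trans _ _ (B%:R * (D%:R * delta ^+ k))).
  rewrite ler_wpM2l //; apply: (@le_trans _ _ (\sum_(e in [set e in E | v \in e]) delta ^+ k)).
    apply: ler_sum => e; rewrite inE => /andP[eE _].
    by rewrite (Pr_chosen E N_gt0 TN delta01) unif.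
  by rewrite sumr_const -[leLHS]mulr_natl ler_wpM2r ?exprn_ge0 // ler_nat.
have -> : k = k.-1.+1 by lia.
move: sparse; rewrite -/B exprS /=; have := d0.
move: (delta ^+ k.-1) (N%:R ^+ k.-1) => x y; nra.
Qed.

(** Each of the three short cycles costs at most [delta / 16] and crowding at most [delta / 4], out
    of the probability [delta] that [v] is sampled. *)
Lemma Pr_good c v : delta / 2 <= Pr mu (fun om => good E k N T v (chosen c om)).
Proof.
have dk : delta ^+ (2 * k) = delta ^+ (2 * k - 1) * delta by rewrite -exprSr; congr (_ ^+ _); lia.
have dk' : delta ^+ (3 * k - 1) = delta ^+ (3 * k - 2) * delta by rewrite -exprSr; congr (_ ^+ _); lia.
have lo := Pr_lollipop N_gt0 TN delta01 lin k3 unif deg c v.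
have tr := Pr_triangle N_gt0 TN delta01 lin k3 unif deg c v.
have sq := Pr_square N_gt0 TN delta01 lin k3 unif deg c v.
have cr := Pr_crowded c v.
have k1 : 1 <= k%:R :> R by rewrite ler1n; lia.
have vc : Pr mu (fun om => [set v] \subset chosen c om) = delta.
  by rewrite (Pr_chosen E N_gt0 TN delta01) cards1 expr1.
have lo' : Pr mu (fun om => lollipop E v (chosen c om)) <= delta / 16.
  apply: le_trans lo _; rewrite dk; move: lollipop_small d0.
  move: (delta ^+ (2 * k - 1)) => x; rewrite !exprS expr0; nra.
have sq' : Pr mu (fun om => square E v (chosen c om)) <= delta / 16.
  apply: le_trans sq _; rewrite dk'; move: square_small d0.
  move: (delta ^+ (3 * k - 2)) => x; rewrite !exprS expr0; nra.
have tr' : Pr mu (fun om => triangle E v (chosen c om)) <= delta / 16.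
  apply: le_trans tr _; rewrite dk.
  have x0 : 0 <= delta ^+ (2 * k - 1) by rewrite exprn_ge0.
  apply: (@le_trans _ _ (k%:R ^+ 3 * D%:R ^+ 2 * delta ^+ (2 * k - 1) * delta)).
    rewrite [leLHS](_ : _ = k%:R ^+ 2 * (D%:R ^+ 2 * delta ^+ (2 * k - 1) * delta)); last by ring.
    rewrite [leRHS](_ : _ = k%:R ^+ 3 * (D%:R ^+ 2 * delta ^+ (2 * k - 1) * delta)); last by ring.
    apply: ler_wpM2r; first by rewrite !mulr_ge0 ?exprn_ge0.
    exact: ler_weXn2l.
  rewrite [leLHS](_ : _ = 16 * k%:R ^+ 3 * D%:R ^+ 2 * delta ^+ (2 * k - 1) * (delta / 16)); last by field.
  by rewrite -[leRHS]mul1r ler_wpM2r // divr_ge0.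
suff : Pr mu (fun om => [set v] \subset chosen c om) <=
   Pr mu (fun om => good E k N T v (chosen c om)) +
   (Pr mu (fun om => lollipop E v (chosen c om)) + (Pr mu (fun om => triangle E v (chosen c om)) +
   (Pr mu (fun om => square E v (chosen c om)) +
   Pr mu (fun om => ~~ (#|star E v (chosen c om)| * (8 * k.-1 * T ^ (k - 2)) <= N ^ k.-1)%N)))).
  by rewrite vc; exact: (half_budget d0 lo' tr' sq' cr).
apply: (@le_trans _ _ (Pr mu (fun om => good E k N T v (chosen c om) ||
  (lollipop E v (chosen c om) || (triangle E v (chosen c om) || (square E v (chosen c om) ||
   ~~ (#|star E v (chosen c om)| * (8 * k.-1 * T ^ (k - 2)) <= N ^ k.-1)%N)))))); last first.
  by do 3 (apply: le_trans (Pr_union _ _ _) _; rewrite lerD2l); exact: Pr_union.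
apply: Pr_le => om; rewrite sub1set => vW.
rewrite /good vW /=; case: (boolP (_ <= N ^ k.-1)%N) => // _; rewrite ?orbT // andbT orbF.
case: (boolP (clean _ _ _)) => // nc /=.
exact: (@unclean_cases V E lin v _ nc).
Qed.

Variable p : R.
Hypothesis p_gt0 : 0 < p.
Hypothesis p_le : p <= (T%:R / (4 * N%:R) - T%:R * expR (- (lam / 8))) * (delta / 2).

Lemma Pr_joined c v : p <= Pr mu (fun om => v \in joined c om).
Proof.
apply: le_trans (joined_bound N_gt0 TN delta01 lin k3 unif c v).
apply: le_trans p_le _; apply: ler_wpM2l; last exact: Pr_good.
rewrite leNgt; apply/negP => lt0; have := lt_le_trans p_gt0 p_le.
by rewrite ltNge mulr_le0_ge0 ?divr_ge0 // ltW.
Qed.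

Lemma Pr_joined2 c x y : x != y ->
  Pr mu (fun om => (x \in joined c om) && (y \in joined c om)) <= delta ^+ 2.
Proof.
move=> xy; apply: (@le_trans _ _ (Pr mu (fun om => [set x; y] \subset chosen c om))).
  by apply: Pr_le => om /andP[/joined_chosen xc /joined_chosen yc]; rewrite subUset !sub1set xc.
by rewrite (Pr_chosen E N_gt0 TN delta01) cards2 xy.
Qed.

(** With [n] the number of vertices of [W] that join, the indicator of [n = 0] is at most
    [(n - 1) ^ 2 = 1 - n + n * (n - 1)]. Pairs are bounded crudely by the probability [delta ^+ 2]
    that both are sampled. *)
Lemma Pr_avoid c W (m : nat) : #|W| = m -> m%:R * delta ^+ 2 <= p / 2 ->
  Pr mu (fun om => [disjoint W & joined c om]) <= 1 - m%:R * p / 2.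
Proof.
move=> Wm md.
pose J om x : R := (x \in joined c om)%:R.
apply: (@le_trans _ _ (Ex mu (fun om => 1 - \sum_(x in W) J om x +
    \sum_(x in W) \sum_(y in W | y != x) (J om x * J om y)))).
  apply: Ex_le => om; set n : R := \sum_(x in W) J om x.
  have -> : \sum_(x in W) \sum_(y in W | y != x) J om x * J om y = n * n - n.
    rewrite {1}/n mulr_suml -sumrB; apply: eq_bigr => x xW.
    have -> : n = J om x + \sum_(y in W | y != x) J om y by rewrite /n (bigD1 x).
    by rewrite -mulr_sumr /J; case: (x \in _) => /=; lra.
  case: (boolP [disjoint W & joined c om]) => [dis|].
    have -> : n = 0 by apply: big1 => x xW; rewrite /J (disjointFr dis xW).
    by rewrite mulr0 subr0 subrr addr0.
  have : exists i : nat, n = i%:R.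
    exists (\sum_(x in W) (x \in joined c om : nat))%N; by rewrite natr_sum.
  move=> [[|i] ->] _; first by rewrite mulr0 subr0 subrr addr0 ler01.
  by rewrite -natr1 /=; have := ler0n R i; set y : R := i%:R; nra.
rewrite ExD ExB Ex_cst !Ex_sum.
have s1 : m%:R * p <= \sum_(x in W) Ex mu (fun om => J om x).
  rewrite -Wm mulr_natl -sumr_const; apply: ler_sum => x _; exact: Pr_joined.
have s2 : \sum_(x in W) Ex mu (fun om => \sum_(y in W | y != x) J om x * J om y) <= m%:R * (m%:R * delta ^+ 2).
  rewrite -Wm [leRHS]mulr_natl -sumr_const; apply: ler_sum => x _.
  rewrite Ex_sum; apply: (@le_trans _ _ (\sum_(y in W) delta ^+ 2)); last first.
    by rewrite sumr_const mulr_natl.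
  rewrite big_mkcondr /=; apply: ler_sum => y _; case: ifP => yx; last by rewrite exprn_ge0.
  rewrite eq_sym in yx; apply: le_trans (Pr_joined2 c yx).
  by rewrite le_eqVlt; apply/orP; left; apply/eqP/eq_Ex => om; rewrite /J -natrM mulnb.
have m0 := ler0n R m; nra.
Qed.

End Phase.

Lemma card_bigcup_le (I T : finType) (A : {set I}) (F : I -> {set T}) (n : nat) :
  (forall i, i \in A -> (#|F i| <= n)%N) -> (#|\bigcup_(i in A) F i| <= #|A| * n)%N.
Proof.
move=> Fn; rewrite -sum_nat_const; elim/big_rec2: _ => [|i m S iA IH]; first by rewrite cards0.
by apply: leq_trans (leq_card_setU _ _) _; exact: leq_add (Fn i iA) IH.
Qed.

Section Balls.
Variables (V : finType) (E : {set {set V}}) (k D : nat).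
Hypothesis unif : forall e : {set V}, e \in E -> #|e| = k.
Hypothesis deg : forall v : V, (#|[set e in E | v \in e]| <= D)%N.
Implicit Types (v w x y : V) (S : {set V}).
Local Notation grow := (grow E).

Definition adjacent x y := (x == y) || [exists e in E, (x \in e) && (y \in e)].

Lemma adjacent_sym x y : adjacent x y = adjacent y x.
Proof.
by rewrite /adjacent eq_sym; congr (_ || _); apply: eq_existsb => e; rewrite [(x \in e) && _]andbC.
Qed.

Lemma growP S y : reflect (exists2 x, x \in S & adjacent x y) (y \in grow S).
Proof.
apply: (iffP idP) => [|[x xS]].
  rewrite inE => /orP[yS|/bigcupP[e /andP[eE /pred0Pn[x /= /andP[xe xS]]] ye]].
    by exists y; rewrite /adjacent ?eqxx.
  exists x => //; apply/orP; right; apply/existsP; exists e; by rewrite eE xe.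
case/orP => [/eqP<-|/existsP[e /and3P[eE xe ye]]]; first exact: (subsetP (grow_sub _ _)).
exact: grow_edge xS xe ye.
Qed.

Lemma grow_mono S S' : S \subset S' -> grow S \subset grow S'.
Proof.
move=> /subsetP SS'; apply/subsetP => y /growP[x xS xy]; apply/growP; exists x => //.
exact: SS'.
Qed.

Lemma iter_grow_monoS n S S' : S \subset S' -> iter n grow S \subset iter n grow S'.
Proof. by move=> SS'; elim: n => //= n IH; exact: grow_mono. Qed.

Lemma ball_step n x y w : adjacent x y -> w \in iter n grow [set y] -> w \in iter n.+1 grow [set x].
Proof.
move=> xy; rewrite iterSr; apply: subsetP; apply: iter_grow_monoS.
by rewrite sub1set; apply/growP; exists x => //; rewrite inE.
Qed.

Lemma ball_sym n x y : y \in iter n grow [set x] -> x \in iter n grow [set y].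
Proof.
elim: n x y => [|n IH] x y /=; first by rewrite !inE eq_sym.
move=> /growP[z /IH xz zy]; apply: ball_step xz.
by rewrite adjacent_sym.
Qed.

Lemma card_ball n v : (#|iter n grow [set v]| <= (1 + k * D) ^ n)%N.
Proof.
elim: n => [|n IH] /=; first by rewrite cards1.
have cg S : (#|grow S| <= #|S| * (1 + k * D))%N.
  apply: leq_trans (_ : #|\bigcup_(x in S) (x |: \bigcup_(e in [set e in E | x \in e]) e)| <= _)%N.
    apply: subset_leq_card; apply/subsetP => y /growP[x xS xy]; apply/bigcupP; exists x => //.
    rewrite !inE; case/orP: xy => [/eqP->|/existsP[e /and3P[eE xe ye]]]; first by rewrite eqxx.
    by apply/orP; right; apply/bigcupP; exists e => //; rewrite inE eE.
  apply: card_bigcup_le => x _; rewrite cardsU1; apply: leq_add; first exact: leq_b1.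
  apply: leq_trans (_ : #|[set e in E | x \in e]| * k <= _)%N.
    by apply: card_bigcup_le => e; rewrite inE => /andP[/unif ->].
  by rewrite mulnC leq_mul2l deg orbT.
by apply: leq_trans (cg _) _; rewrite expnSr leq_mul2r IH orbT.
Qed.

Lemma card_ball_meet n v :
  (#|[set u | ~~ [disjoint iter n grow [set v] & iter n grow [set u]]]| <= (1 + k * D) ^ (2 * n))%N.
Proof.
apply: leq_trans (card_ball (2 * n) v); apply: subset_leq_card; apply/subsetP => u.
rewrite inE => /pred0Pn[x /andP[/= xv xu]].
rewrite mul2n -addnn iterD; have := ball_sym xu; apply: subsetP.
by apply: iter_grow_monoS; rewrite sub1set.
Qed.

End Balls.

(** An edge at [v] is missed entirely only if its witness is, and by linearity the edges at [v] have
    distinct witnesses; so degrees reduce to counting missed vertices. The default [v] does not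
    occur for an edge with at least two vertices. *)
Definition witness (V : finType) (v : V) (e : {set V}) : V := odflt v [pick w in e :\ v].

Lemma witnessP (V : finType) (v : V) (e : {set V}) :
  (1 < #|e|)%N -> v \in e -> witness v e \in e :\ v.
Proof.
move=> e1 ve; rewrite /witness; case: pickP => //= no.
have : #|e :\ v| = 0%N by apply/eqP; rewrite cards_eq0; apply/eqP/setP => x; rewrite (no x) inE.
by move=> c0; move: e1; rewrite (cardsD1 v e) ve c0.
Qed.

(** * All colours together, and the local lemma *)

Section OnePhase.
Variables (R : realType) (V : finType) (E : {set {set V}}).
Variables (k N T q D m z : nat) (delta p : R).
Hypothesis N_gt0 : (0 < N)%N.
Hypothesis TN : (2 ^ T <= N)%N.
Hypothesis delta01 : 0 <= delta <= 1.
Hypothesis lin : forall (e f : {set V}) x w, e \in E -> f \in E -> x != w ->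
  x \in e -> w \in e -> x \in f -> w \in f -> e = f.
Hypothesis k3 : (2 < k)%N.
Hypothesis unif : forall e : {set V}, e \in E -> #|e| = k.
Hypothesis deg : forall v : V, (#|[set e in E | v \in e]| <= D)%N.
Local Notation mu := (fair E q N_gt0 TN delta01).
Local Notation joined := (joined R E N).
Hypothesis avoid : forall (c : 'I_q) (W : {set V}), #|W| = m ->
  Pr mu (fun om => [disjoint W & joined c om]) <= 1 - m%:R * p / 2.
Hypothesis many_colours : 2 * k.+1%:R <= p * q%:R.
Hypothesis mz : (m <= z)%N.
Hypothesis Dz : (D <= 2 ^ k * (z - m))%N.
Hypothesis local : 4 * expR (- m%:R) * ((1 + k * D) ^ (2 * T.+2))%:R <= 1 :> R.

Implicit Types (v w x y : V) (e f W S : {set V}) (c : 'I_q).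
Implicit Types (om : {ffun coin V T q -> bool}).

Definition missed om : {set V} := ~: \bigcup_(c : 'I_q) joined c om.

Let edge_gt1 e : e \in E -> (1 < #|e|)%N.
Proof. by move=> /unif ->; exact: ltnW. Qed.

(** Distinct colours read disjoint sets of coins, so the probabilities of avoiding [W] multiply;
    [many_colours] makes the exponent [q * m * p / 2] at least [m * (k + 1)]. *)
Lemma Pr_missed W : #|W| = m -> Pr mu (fun om => W \subset missed om) <= expR (- (m%:R * k.+1%:R)).
Proof.
move=> Wm.
rewrite [leLHS](_ : _ = Ex mu (fun om => \prod_(c in [set: 'I_q]) ([disjoint W & joined c om])%:R)).
  rewrite (@Ex_prod_indep _ _ _ mu _ _ (fun c => [set j : coin V T q | j.1.1 == c])).
  - apply: (@le_trans _ _ (\prod_(c in [set: 'I_q]) expR (- (m%:R * p / 2)))).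
      apply: ler_prod => c _; apply/andP; split; first exact: Pr_ge0.
      by apply: le_trans (avoid c Wm) _; apply: expR_ge1Dx.
    rewrite prodr_const cardsT card_ord -expRM_natl ler_expR mulrN lerN2.
    have := ler0n R m; move: many_colours; set x := k.+1%:R; set y := m%:R; nra.
  - move=> c _ om om' h; congr (_%:R); congr nat_of_bool.
    have jl x : (x \in joined c om) = (x \in joined c om').
      by apply: joined_local => j; rewrite !inE => /andP[jc _]; apply: h; rewrite inE.
    by apply: eq_disjoint_r => x; rewrite jl.
  - move=> c c' _ _ cc'; rewrite -setI_eq0; apply/eqP/setP => j; rewrite !inE.
    by apply/negP => /andP[/eqP-> /eqP h]; move: cc'; rewrite h eqxx.
apply: eq_Ex => om; case: (boolP (W \subset missed om)) => [sub|].
  rewrite big1 // => c _.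
  suff -> : [disjoint W & joined c om] by [].
  rewrite disjoints_subset; apply: subset_trans sub _; rewrite setCS.
  exact: (bigcup_sup c).
move=> /subsetPn[x xW]; rewrite inE negbK => /bigcupP[c _ xc].
have nd : [disjoint W & joined c om] = false.
  by apply/negP => /disjointFr/(_ xW); rewrite xc.
by rewrite (bigD1 c) ?inE //= nd mul0r.
Qed.

Definition overfull v om :=
  (z <= #|[set e in [set e in E | v \in e] | witness v e \in missed om]|)%N.

(** [Pr_count] over [m]-sets of edges at [v]: the ratio of binomials is at most [2 ^ (k * m)], which
    leaves [expR (- m)] because [2 <= expR 1]. *)
Lemma Pr_overfull v : Pr mu (overfull v) <= expR (- m%:R).
Proof.
have count := @Pr_count _ _ _ mu _ [set e in E | v \in e] (fun e om => witness v e \in missed om) m z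
  (expR (- (m%:R * k.+1%:R))).
have Cz : 0 < 'C(z, m)%:R :> R by rewrite ltr0n bin_gt0.
rewrite -(ler_pM2r Cz); apply: le_trans (count _) _.
  move=> B /subsetP BE Bm.
  apply: (@le_trans _ _ (Pr mu (fun om => [set witness v e | e in B] \subset missed om))).
    apply: Pr_le => om /forall_inP h; apply/subsetP => x /imsetP[e eB ->]; exact: h.
  apply: Pr_missed; rewrite card_in_imset // => e f eB fB ef.
  have := BE _ eB; have := BE _ fB; rewrite !inE => /andP[fE vf] /andP[eE ve].
  have /setD1P[wv we] := witnessP (edge_gt1 eE) ve; have /setD1P[_ wf] := witnessP (edge_gt1 fE) vf.
  by apply: lin wv we ve _ vf => //; rewrite ef.
apply: (@le_trans _ _ (((2 ^ k) ^ m * 'C(z, m))%N%:R * expR (- (m%:R * k.+1%:R)))).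
  apply: ler_wpM2r; first exact: expR_ge0.
  rewrite ler_nat; have := @bin_ratio (2 ^ k) 1 D z m mz; rewrite exp1n !mul1n => /(_ Dz).
  apply: leq_trans; apply: leq_bin2l; exact: deg.
rewrite natrM mulrAC ler_wpM2r ?(ltW Cz) //.
have e2 : 2 <= expR 1 :> R by have := expR_ge1Dx (1 : R); lra.
apply: (@le_trans _ _ (expR (k * m)%N%:R * expR (- (m%:R * k.+1%:R)))).
  apply: ler_wpM2r; first exact: expR_ge0.
  rewrite -expnM natrX -[(k * m)%:R]mulr1 expRM_natl.
  by rewrite lerXn2r ?nnegrE ?expR_ge0.
by rewrite -expRD ler_expR natrM -natr1; lra.
Qed.

Lemma overfull_local v : depends_on
  [set j : coin V T q | j.1.2 \in iter T.+2 (grow E) [set v]] (overfull v).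
Proof.
move=> om om' h; rewrite /overfull; congr (_ <= #|pred_of_set _|)%N.
apply/setP => e; rewrite !inE; case: (boolP (e \in E)) => //= eE; case: (boolP (v \in e)) => //= ve.
have jl c : (witness v e \in joined c om) = (witness v e \in joined c om').
  apply: joined_local => j; rewrite inE => /andP[_ jw]; apply: h; rewrite inE iterSr.
  move: jw; apply: subsetP; apply: iter_grow_monoS; rewrite sub1set.
  have /setD1P[_ we] := witnessP (edge_gt1 eE) ve.
  by apply: grow_edge eE _ ve we; rewrite inE.
by congr (~~ _); apply/bigcupP/bigcupP => -[c _ wc]; exists c; rewrite // ?jl // -jl.
Qed.

Lemma one_phase : exists I : 'I_q -> {set V},
  (forall c e, e \in E -> ~~ (e \subset I c)) /\
  (forall v, #|[set e in E | (v \in e) && (e \subset ~: \bigcup_c I c)]| < z)%N.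
Proof.
have [||om omP] := @local_lemma _ _ _ _ mu overfull
  (fun v => [set j : coin V T q | j.1.2 \in iter T.+2 (grow E) [set v]]) (expR (- m%:R))
  ((1 + k * D) ^ (2 * T.+2))%N overfull_local Pr_overfull _ _ local.
- move=> v; apply: leq_trans (card_ball_meet unif deg T.+2 v); apply: subset_leq_card.
  apply/subsetP => u; rewrite in_set => h; rewrite in_set; apply: contraNN h => dis.
  rewrite -setI_eq0; apply/eqP/setP => j; rewrite in_setI in_set0; apply/negP => /andP[].
  by rewrite in_set => jv; rewrite in_set => ju; move: (disjointFr dis jv); rewrite ju.
- by rewrite expn_gt0.
exists (fun c => joined c om); split; first by move=> c e eE; apply: joined_independent k3 unif _ _ _ eE.
move=> v; have := omP v; rewrite -ltnNge; apply: leq_ltn_trans.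
apply: subset_leq_card; apply/subsetP => e; rewrite !inE => /and3P[eE ve sub].
rewrite eE ve /=; have /setD1P[_ we] := witnessP (edge_gt1 eE) ve.
by have := subsetP sub _ we; rewrite inE.
Qed.
End OnePhase.

(** With [t] the quotient of [n] by [d + 1], [(t + 1) ^ (d + 1) <= 2 ^ n]; one factor absorbs the
    constants, the other [d] dominate [n ^ d]. *)
Lemma poly_le_exp (c d : nat) : exists n0, forall n, (n0 <= n)%N -> (c * n ^ d <= 2 ^ n)%N.
Proof.
exists (d.+1 * (c * d.+1 ^ d))%N => n nn0.
pose t := (n %/ d.+1)%N.
have nt : (n <= d.+1 * t.+1)%N by rewrite mulnC ltnW // -ltn_divLR.
have ct : (c * d.+1 ^ d <= t.+1)%N by rewrite leqW // /t leq_divRL // mulnC.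
have tn : ((t.+1) ^ d.+1 <= 2 ^ n)%N.
  apply: (@leq_trans ((2 ^ t) ^ d.+1)); first by rewrite leq_exp2r // ltn_expl.
  by rewrite -expnM leq_exp2l // leq_trunc_div.
apply: leq_trans tn; rewrite expnSr.
apply: (@leq_trans (c * (d.+1 * t.+1) ^ d)).
  by rewrite leq_mul2l; case: (d) nt => [|d'] nt; rewrite ?expn0 ?leq_exp2r ?nt ?orbT.
by rewrite expnMn mulnA [X in (_ <= X)%N]mulnC leq_mul2r ct orbT.
Qed.

(** * Numerical choice of the parameters of a phase *)

Section Scale.
Variables (R : realType) (k T a : nat).
Hypothesis k3 : (2 < k)%N.
Hypothesis T1 : (0 < T)%N.
Hypothesis aT : (6 * k * T <= a)%N.
Hypothesis k_small : (16 * k ^ 3 <= 2 ^ (4 * T))%N.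
Hypothesis T_large : (40 * T <= 2 ^ T)%N.
Hypothesis a_large : ((192 * k) ^ 2 * a ^ 2 <= 2 ^ a)%N.
Hypothesis a_large' : (768 * k ^ 2 * a ^ k <= 2 ^ a)%N.

(* The vertex set is first thinned out to density [1 / M]; the process then runs for [T]
   rounds at rates [2 ^ i / N], so that a vertex joins with probability of order
   [T / (M * N)], where [M * N = 2 ^ a]. *)
Local Notation N := (2 ^ (2 * T))%N.
Local Notation M := (2 ^ (a - 2 * T))%N.
(** Rounds up the constant [4 * (8 * k.-1 * T ^ (k - 2))] of the condition [sparse]; a degree [D]
    fits the scale [a] when [crowding * D <= 2 ^ (a * k.-1)]. *)
Definition crowding : nat := (64 * k * T ^ (k - 2))%N.
Definition degree_cap : nat := (2 ^ (a * k.-1) %/ crowding)%N.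
(** Large enough for [expR (- batch)] to beat the number of dependent events in the local lemma, at
    most [2 ^ (a * k.-1 * (2 * T.+2))]. *)
Definition batch : nat := (a * k * (2 * T.+2))%N.
(** The number [2 * k.+1 / p] of colours demanded by [many_colours], made an integer. *)
Definition palette : nat := (32 * k.+1 * 2 ^ a %/ T).+1.
Definition threshold : nat := (2 ^ (a.-1 * k.-1) %/ crowding).+1.
Let delta : R := M%:R^-1.
Let p : R := T%:R / (16 * (2 ^ a)%:R).

Let kT : (k * T <= a)%N. Proof. apply: leq_trans aT; nia. Qed.
Let T18 : (18 * T <= a)%N. Proof. apply: leq_trans aT; nia. Qed.
Let a2T : (2 * T <= a)%N. Proof. lia. Qed.

Lemma crowding_gt0 : (0 < crowding)%N.
Proof. by rewrite /crowding !muln_gt0 expn_gt0 T1 (ltn_trans _ k3). Qed.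

Lemma scale_delta01 : 0 <= delta <= 1.
Proof.
rewrite invr_ge0 ler0n /= invf_le1 ?ltr0n ?expn_gt0 //.
by rewrite ler1n expn_gt0.
Qed.

Lemma scale_TN : (2 ^ T <= N)%N.
Proof. by rewrite leq_exp2l //; lia. Qed.

Lemma degree_cap_le : (degree_cap <= 2 ^ (a * k.-1))%N.
Proof. exact: leq_div. Qed.

Lemma expr_delta n : delta ^+ n = ((2 ^ ((a - 2 * T) * n))%N%:R)^-1.
Proof. by rewrite /delta exprVn -natrX -expnM. Qed.

Lemma scale_lollipop : 16 * k%:R ^+ 3 * degree_cap%:R ^+ 2 * delta ^+ (2 * k - 1) <= 1.
Proof.
rewrite expr_delta -!natrX -!natrM ler_pdivrMr ?ltr0n ?expn_gt0 // mul1r ler_nat.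
apply: (@leq_trans (2 ^ (4 * T) * 2 ^ (2 * (a * k.-1)))).
  apply: leq_mul => //; rewrite [(2 * _)%N]mulnC expnM leq_exp2r //; exact: degree_cap_le.
rewrite -expnD leq_exp2l // mulnBl.
have -> : (2 * k - 1 = 2 * k.-1 + 1)%N by lia.
nia.
Qed.

(** The exponents of 2 add up to [4 * T + 3 * a * (k - 1) - (a - 2 * T) * (3 * k - 2) = 6 * k * T -
    a]: the origin of the condition [6 * k * T <= a]. *)
Lemma scale_square : 16 * k%:R ^+ 3 * degree_cap%:R ^+ 3 * delta ^+ (3 * k - 2) <= 1.
Proof.
rewrite expr_delta -!natrX -!natrM ler_pdivrMr ?ltr0n ?expn_gt0 // mul1r ler_nat.
apply: (@leq_trans (2 ^ (4 * T) * 2 ^ (3 * (a * k.-1)))).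
  apply: leq_mul => //; rewrite [(3 * _)%N]mulnC expnM leq_exp2r //; exact: degree_cap_le.
rewrite -expnD leq_exp2l // mulnBl.
have -> : (3 * k - 2 = 3 * k.-1 + 1)%N by lia.
nia.
Qed.

Lemma scale_sparse : 4 * degree_cap%:R * (8 * k.-1 * T ^ (k - 2))%:R * delta ^+ k.-1 <= N%:R ^+ k.-1.
Proof.
rewrite expr_delta -!natrX -!natrM ler_pdivrMr ?ltr0n ?expn_gt0 // -natrM ler_nat.
rewrite -expnM -expnD -mulnDl subnKC //.
apply: leq_trans (leq_trunc_div (2 ^ (a * k.-1)) crowding).
rewrite -/degree_cap /crowding; set x := (T ^ (k - 2))%N; set y := degree_cap; nia.
Qed.

Lemma p_pos : 0 < p.
Proof. by rewrite divr_gt0 ?mulr_gt0 ?ltr0n ?expn_gt0. Qed.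

Lemma expR_ge_2X n : (2 ^ n)%:R <= expR n%:R :> R.
Proof.
rewrite -[n%:R]mulr1 expRM_natl natrX lerXn2r ?nnegrE ?expR_ge0 //.
by have := expR_ge1Dx (1 : R); lra.
Qed.

(** For [N = 2 ^ (2 * T)] one has [lam = 2 ^ T], so the overloads cost [T * expR (- 2 ^ T / 8)], at
    most half of the gain [T / (4 * N)]. *)
Lemma scale_p : p <= (T%:R / (4 * N%:R) - T%:R * expR (- (lam R N T / 8))) * (delta / 2).
Proof.
have T6 : (6 <= T)%N by move: T1 T_large; case: (T) => [|[|[|[|[|[|n]]]]]].
have N0 : 0 < N%:R :> R by rewrite ltr0n expn_gt0.
have e8 : expR (- (lam R N T / 8)) <= (8 * N%:R)^-1 :> R.
  rewrite expRN lef_pV2 ?posrE ?expR_gt0 ?mulr_gt0 //.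
  have -> : lam R N T / 8 = (2 ^ (T - 3))%N%:R.
    rewrite /lam mul2n -addnn expnD natrM natrX mulfK ?expf_neq0 ?pnatr_eq0 //.
    rewrite -{1}[T](@subnK 3) ?(leq_trans _ T6) // exprD natrX; lra.
  apply: le_trans _ (expR_ge_2X _); rewrite -(natrM _ 8) ler_nat -[8%N]/(2 ^ 3)%N -expnD leq_exp2l //.
  have : (2 ^ 3 * 2 ^ (T - 3) = 2 ^ T)%N by rewrite -expnD subnKC // (leq_trans _ T6).
  move: T_large; rewrite -[(2 ^ 3)%N]/8%N; lia.
have -> : p = T%:R / (8 * N%:R) * (delta / 2).
  rewrite /p /delta -[in LHS](subnKC a2T) expnD natrM; field.
  by rewrite !pnatr_eq0 -!lt0n !expn_gt0.
apply: ler_wpM2r; first by rewrite divr_ge0 // invr_ge0.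
have -> : T%:R / (8 * N%:R) = T%:R / (4 * N%:R) - T%:R * (8 * N%:R)^-1 :> R.
  by field; rewrite lt0r_neq0.
by rewrite lerD2l lerN2 ler_wpM2l.
Qed.

Lemma batch_le : (32 * batch <= T * 2 ^ (a - 4 * T))%N.
Proof.
have h : (192 * a * k <= 2 ^ (a - 4 * T))%N.
  rewrite -leq_sqr -expnM; apply: (@leq_trans (2 ^ a)); last by rewrite leq_exp2l //; lia.
  by apply: leq_trans a_large; rewrite -expnMn leq_sqr; lia.
apply: (@leq_trans (T * (192 * a * k))); last by rewrite leq_mul2l h orbT.
rewrite /batch; set x := (a * k)%N; nia.
Qed.

Lemma scale_batch : batch%:R * delta ^+ 2 <= p / 2.
Proof.
rewrite expr_delta ler_pdivrMr ?ltr0n ?expn_gt0 // /p.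
have A0 : 0 < (2 ^ a)%N%:R :> R by rewrite ltr0n expn_gt0.
rewrite [leRHS](_ : _ = T%:R * (2 ^ ((a - 2 * T) * 2))%N%:R / (32 * (2 ^ a)%N%:R)); last first.
  by field; rewrite lt0r_neq0.
rewrite ler_pdivlMr ?mulr_gt0 // -(natrM _ 32) -!natrM ler_nat.
have -> : ((a - 2 * T) * 2 = a + (a - 4 * T))%N by lia.
rewrite expnD; have := batch_le; set x := (2 ^ a)%N; set y := (2 ^ (a - 4 * T))%N; nia.
Qed.

Lemma scale_many : 2 * k.+1%:R <= p * palette%:R.
Proof.
rewrite /p mulrAC ler_pdivlMr ?mulr_gt0 ?ltr0n ?expn_gt0 //.
rewrite -(natrM _ 2) -(natrM _ 16) -!natrM ler_nat.
have := ltn_ceil (32 * k.+1 * 2 ^ a) T1; rewrite -/palette.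
set x := (2 ^ a)%N; nia.
Qed.

Lemma scale_threshold : (2 * batch <= threshold)%N.
Proof.
apply: leqW; rewrite leq_divRL ?crowding_gt0 //.
apply: (@leq_trans (768 * k ^ 2 * a ^ k)); last first.
  apply: leq_trans a_large' _; rewrite leq_exp2l //; nia.
rewrite /batch /crowding.
have Ta : (T ^ (k - 2) <= a ^ (k - 2))%N.
  by case: (k - 2)%N => // n; rewrite leq_exp2r //; lia.
have -> : (a ^ k = a ^ 2 * a ^ (k - 2))%N by rewrite -expnD subnKC // ltnW.
move: Ta; set x := (T ^ _)%N; set y := (a ^ (k - 2))%N => Ta.
apply: (@leq_trans (768 * k ^ 2 * (a * a * y))); last by rewrite -mulnn.
apply: (@leq_trans (768 * k ^ 2 * (a * a * x))); last by rewrite !leq_mul.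
have -> : (2 * (a * k * (2 * T.+2)) * (64 * k * x) = 64 * k ^ 2 * (a * (2 * T.+2)) * x * 2)%N by rewrite -mulnn; ring.
have h : (4 * T.+2 <= 12 * a)%N by lia.
have -> : (64 * k ^ 2 * (a * (2 * T.+2)) * x * 2 = 64 * k ^ 2 * a * x * (4 * T.+2))%N by ring.
have -> : (768 * k ^ 2 * (a * a * x) = 64 * k ^ 2 * a * x * (12 * a))%N by ring.
by rewrite leq_mul2l h orbT.
Qed.

(** Passing from [a] to [a - 1] divides the degree bound by [2 ^ k.-1]; a further factor 2 pays for
    subtracting [batch], which is at most half of [threshold]. *)
Lemma scale_Dz : (degree_cap <= 2 ^ k * (threshold - batch))%N.
Proof.
have h := scale_threshold.
apply: (@leq_trans (2 ^ k.-1 * threshold)); last first.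
  have -> : (2 ^ k = 2 ^ k.-1 * 2)%N by rewrite -expnSr prednK //; lia.
  rewrite -mulnA leq_mul2l; lia.
rewrite -ltnS ltn_divLR ?crowding_gt0 //.
have := ltn_ceil (2 ^ (a.-1 * k.-1)) crowding_gt0; rewrite -/threshold.
have -> : (2 ^ (a * k.-1) = 2 ^ k.-1 * 2 ^ (a.-1 * k.-1))%N.
  by rewrite -expnD -mulSn prednK //; lia.
set x := (2 ^ (a.-1 * _))%N; set y := (2 ^ k.-1)%N => lt.
apply: (@leq_trans (y * (threshold * crowding))).
  by rewrite ltn_pmul2l // expn_gt0.
by rewrite mulnA leq_mul2r leqnSn orbT.
Qed.

Lemma scale_local : 4 * expR (- batch%:R) * ((1 + k * degree_cap) ^ (2 * T.+2))%:R <= 1 :> R.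
Proof.
have b0 := expR_gt0 (batch%:R : R).
rewrite expRN mulrAC ler_pdivrMr // mul1r; apply: le_trans _ (expR_ge_2X batch).
rewrite -(natrM _ 4) ler_nat.
have h : (1 + k * degree_cap <= 2 ^ (a * k.-1))%N.
  have := leq_trunc_div (2 ^ (a * k.-1)) crowding; rewrite -/degree_cap /crowding.
  have : (0 < T ^ (k - 2))%N by rewrite expn_gt0 T1.
  have : (1 < 2 ^ (a * k.-1))%N by rewrite -{1}(expn0 2) ltn_exp2l // muln_gt0; lia.
  set x := (T ^ (k - 2))%N; set y := degree_cap; set u := (2 ^ _)%N; nia.
apply: (@leq_trans (4 * (2 ^ (a * k.-1)) ^ (2 * T.+2))).
  by rewrite leq_mul2l leq_exp2r.
rewrite -expnM -[4%N]/(2 ^ 2)%N -expnD leq_exp2l // /batch.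
have -> : (a * k * (2 * T.+2) = a * k.-1 * (2 * T.+2) + a * (2 * T.+2))%N.
  by rewrite -{1}(@prednK k) ?mulnS //; [ring|lia].
rewrite addnC leq_add2l; nia.
Qed.

(** Only [a] drops by one, while [T], and with it [crowding], stays the same: conclusion and
    hypothesis have the same shape, ready for iteration. *)
Lemma scaled_phase (V : finType) (E : {set {set V}}) :
  (forall (e f : {set V}) x w, e \in E -> f \in E -> x != w ->
     x \in e -> w \in e -> x \in f -> w \in f -> e = f) ->
  (forall e : {set V}, e \in E -> #|e| = k) ->
  (forall v : V, crowding * #|[set e in E | v \in e]| <= 2 ^ (a * k.-1))%N ->
  exists I : 'I_palette -> {set V},
  (forall c e, e \in E -> ~~ (e \subset I c)) /\
  (forall v, crowding * #|[set e in E | (v \in e) && (e \subset ~: \bigcup_c I c)]|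
     <= 2 ^ (a.-1 * k.-1))%N.
Proof.
move=> lin unif deg.
have N0 : (0 < N)%N by rewrite expn_gt0.
have deg' v : (#|[set e in E | v \in e]| <= degree_cap)%N.
  by rewrite leq_divRL ?crowding_gt0 // mulnC.
have avoid := @Pr_avoid R V E k N T palette degree_cap delta N0 scale_TN scale_delta01
  lin k3 unif deg' scale_lollipop scale_square scale_sparse p p_pos scale_p.
have mz : (batch <= threshold)%N by have := scale_threshold; lia.
have [I [ind few]] := one_phase lin k3 unif deg' (fun c W Wm => avoid c W batch Wm scale_batch)
  scale_many mz scale_Dz scale_local.
exists I; split=> // v; have := few v.
by rewrite ltnS leq_divRL ?crowding_gt0 // mulnC.
Qed.

End Scale.

(** * Colouring linear hypergraphs *)

Definition colourable (V : finType) (E : {set {set V}}) (Q : nat) :=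
  exists2 c : V -> nat, (forall v, c v < Q)%N & forall e, e \in E -> ~~ monochromatic c e.

Section Colouring.
Variables (V : finType) (k : nat).
Hypothesis k3 : (2 < k)%N.
Implicit Types (E : {set {set V}}) (e f S : {set V}) (v w x : V).

Lemma monoP (c : V -> nat) e : reflect {in e &, forall u v, c u = c v} (monochromatic c e).
Proof.
apply: (iffP forall_inP) => [h u v ue ve|h u ue].
  by apply/eqP; move: (h u ue) => /forall_inP; apply.
by apply/forall_inP => v ve; apply/eqP/h.
Qed.

(** Vertices are coloured one at a time; an edge at [v] forbids at most the colour of its
    witness. *)
Lemma greedy_colouring E (d : nat) : (forall e, e \in E -> #|e| = k) ->
  (forall v, #|[set e in E | v \in e]| <= d)%N -> colourable E d.+1.
Proof.
move=> unif deg.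
suff H S : exists2 c : V -> nat, (forall v, c v < d.+1)%N &
    forall e, e \in E -> e \subset S -> ~~ monochromatic c e.
  have [c cd ce] := H setT; exists c => // e eE; exact: ce eE (subsetT e).
have [n] := ubnP #|S|; elim: n S => // n IH S; rewrite ltnS => Sn.
have [->|/set0Pn[v vS]] := eqVneq S set0.
  exists (fun=> 0%N) => // e eE; rewrite subset0 => /eqP e0.
  by have := unif e eE; rewrite e0 cards0; lia.
have [|c cd ce] := IH (S :\ v).
  by apply: leq_trans Sn; rewrite [X in (_ < X)%N](cardsD1 v) vS.
pose F := [set (inord (c (witness v e)) : 'I_d.+1) | e in [set e in E | v \in e]].
have [t tF] : exists t, t \notin F.
  apply/existsP; apply: contraT => /existsPn allF.
  have : (#|F| < d.+1)%N by rewrite ltnS; apply: leq_trans (leq_imset_card _ _) (deg v).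
  rewrite (_ : F = setT) ?cardsT ?card_ord ?ltnn //.
  by apply/setP => t; rewrite inE; have := allF t; rewrite negbK.
exists (fun x => if x == v then t : nat else c x) => [x|e eE eS].
  by case: ifP.
have [ve|ve] := boolP (v \in e); last first.
  apply: contraNN (ce e eE _); last by rewrite subsetD1 eS ve.
  have nv x : x \in e -> (x == v) = false by move=> xe; apply: contraNF ve => /eqP <-.
  by move=> /monoP m; apply/monoP => x y xe ye; have := m x y xe ye; rewrite /= !nv.
apply/negP => /monoP m; have e1 : (1 < #|e|)%N by rewrite unif // ltnW.
have /setD1P[wv we] := witnessP e1 ve.
have := m v (witness v e) ve we; rewrite eqxx (negbTE wv) => tc.
move: tF => /imsetP; apply; exists e; first by rewrite inE eE.
by rewrite -tc inord_val.
Qed.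

(** The phase uses fresh colours from [Q] on. An edge touching some [I i] could be monochromatic
    only inside a single independent set; every other edge belongs to [E']. *)
Lemma colour_phase E E' (q Q : nat) (I : 'I_q -> {set V}) :
  (forall e, e \in E -> #|e| = k) ->
  (forall c e, e \in E -> ~~ (e \subset I c)) ->
  E' = [set e in E | e \subset ~: \bigcup_c I c] ->
  colourable E' Q -> colourable E (Q + q).
Proof.
move=> unif ind E'E [c' cQ c'e].
pose c v := if [pick i | v \in I i] is Some i then (Q + i)%N else c' v.
exists c => [v|e eE].
  by rewrite /c; case: pickP => [i _|_]; rewrite ?ltn_add2l ?ltn_addr.
apply/negP => /monoP m.
have [/existsP[w /andP[we /existsP[i wi]]]|/existsPn no] := boolP [exists w, (w \in e) && [exists i, w \in I i]].
  have [j cj] : exists j : 'I_q, c w = (Q + j)%N.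
    by rewrite /c; case: pickP => [j _|/(_ i)]; [exists j|rewrite wi].
  have /subsetPn[x xe /negP] := ind j e eE; apply.
  have := m x w xe we; rewrite cj /c; case: pickP => [i' xi' /addnI/ord_inj <- //|_].
  by move=> h; have := cQ x; rewrite h ltnNge leq_addr.
have : e \in E'.
  rewrite E'E inE eE /=; apply/subsetP => w we; rewrite inE; apply/negP => /bigcupP[i _ wi].
  by have := no w; rewrite we /= => /existsPn/(_ i); rewrite wi.
move=> /c'e/negP; apply; apply/monoP => x y xe ye.
have cx z : z \in e -> c z = c' z.
  move=> ze; rewrite /c; case: pickP => // i zi.
  by have := no z; rewrite ze /= => /existsPn/(_ i); rewrite zi.
by rewrite -!cx //; exact: m.
Qed.

Lemma leq_colourable E Q Q' : (Q <= Q')%N -> colourable E Q -> colourable E Q'.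
Proof. by move=> QQ' [c cQ ce]; exists c => // v; exact: leq_trans (cQ v) QQ'. Qed.

(** The phases run down to the scale [a0], as far as their numerical conditions are guaranteed; what
    is left is coloured greedily with [2 ^ (a0 * k.-1) + 1] colours. *)
Lemma colour_scaled (R : realType) (T a0 : nat) :
  (0 < T)%N -> (6 * k * T <= a0)%N -> (16 * k ^ 3 <= 2 ^ (4 * T))%N ->
  (40 * T <= 2 ^ T)%N ->
  (forall a, (a0 <= a)%N -> ((192 * k) ^ 2 * a ^ 2 <= 2 ^ a)%N) ->
  (forall a, (a0 <= a)%N -> (768 * k ^ 2 * a ^ k <= 2 ^ a)%N) ->
  forall j E,
  (forall e f x w, e \in E -> f \in E -> x != w ->
     x \in e -> w \in e -> x \in f -> w \in f -> e = f) ->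
  (forall e, e \in E -> #|e| = k) ->
  (forall v, crowding k T * #|[set e in E | v \in e]| <= 2 ^ ((a0 + j) * k.-1))%N ->
  colourable E ((2 ^ (a0 * k.-1)).+1 + \sum_(i < j) palette k T (a0 + i.+1)).
Proof.
move=> T1 aT ks Tl al al'; elim=> [|j IH] E lin unif deg.
  rewrite big_ord0 addn0; apply: greedy_colouring => // v.
  apply: leq_trans (_ : crowding k T * _ <= _)%N; last by rewrite -[a0]addn0; exact: deg.
  by rewrite leq_pmull // crowding_gt0.
have a0j : (a0 <= a0 + j.+1)%N by rewrite leq_addr.
have [I [ind few]] := scaled_phase R k3 T1 (leq_trans aT a0j) ks Tl (al _ a0j) (al' _ a0j) lin unif deg.
rewrite big_ord_recr /= addnA; apply: (colour_phase unif ind (erefl _)).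
apply: IH => [e f x w|e|v].
- by rewrite !inE => /andP[eE _] /andP[fE _]; exact: lin eE fE.
- by rewrite inE => /andP[/unif].
have -> : (a0 + j = (a0 + j.+1).-1)%N by rewrite addnS.
apply: leq_trans (few v); rewrite leq_mul2l; apply/orP; right.
apply: subset_leq_card; apply/subsetP => e; rewrite !inE.
by case/andP=> /andP[-> ->] ->.
Qed.

End Colouring.

Lemma sum_palette (k T a j : nat) : (0 < T)%N ->
  (T * \sum_(i < j) palette k T (a + i.+1) <= 64 * k.+1 * 2 ^ (a + j) + j * T)%N.
Proof.
move=> T1; elim: j => [|j IH]; first by rewrite big_ord0 muln0.
rewrite big_ord_recr /= mulnDr.
have h : (T * palette k T (a + j.+1) <= 32 * k.+1 * 2 ^ (a + j.+1) + T)%N.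
  by rewrite /palette mulnS addnC leq_add2r mulnC leq_trunc_div.
apply: leq_trans (leq_add IH h) _; rewrite addnS expnS; set x := (2 ^ _)%N; nia.
Qed.

(** Keeps the greedy remainder [2 ^ (6 * k * T * k.-1)], even multiplied by [T <= 2 ^ T], below
    [2 ^ a] once [8 * k ^ 2 * T <= a]. *)
Lemma exponent_budget (k T : nat) : (2 < k)%N -> (T + 6 * k * T * k.-1 <= 8 * k ^ 2 * T)%N.
Proof.
move=> k3; have : (k.-1 <= k)%N by exact: leq_pred.
have : (T <= k * T)%N by rewrite leq_pmull // (ltn_trans _ k3).
by rewrite -mulnn; set y := k.-1; nia.
Qed.

Lemma colour_budget (K x s y w T : nat) : (s <= K * x + w)%N -> (y <= x)%N ->
  (T <= x)%N -> (w <= x)%N -> (T + y + s <= (K + 3) * x)%N.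
Proof. lia. Qed.

(* Frieze and Mubayi's theorem. In the proof [2 ^ a] is, up to a constant, the (k-1)-st root
   of [T ^ (k - 2) * D] with [T] of order [log D]. The field [R] only carries the
   probabilities. *)
Lemma linear_hypergraph_colouring (R : realType) (k : nat) : (2 < k)%N ->
  exists C D0 : nat, forall D, (D0 <= D)%N ->
  forall (V : finType) (E : {set {set V}}),
  (forall e f x w, e \in E -> f \in E -> x != w ->
     x \in e -> w \in e -> x \in f -> w \in f -> e = f) ->
  (forall e, e \in E -> #|e| = k) ->
  (forall v, #|[set e in E | v \in e]| <= D)%N ->
  exists2 Q, colourable E Q & (trunc_log 2 D * Q ^ k.-1 <= C * D)%N.
Proof.
move=> k3.
have [n1 h1] := poly_le_exp ((192 * k) ^ 2) 2.
have [n2 h2] := poly_le_exp (768 * k ^ 2) k.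
have [n3 h3] := poly_le_exp 40 1.
have [n4 h4] := poly_le_exp (16 * k ^ 3) 0.
pose T0 := (n1 + n2 + n3 + n4).+1; pose C1 := (64 * k.+1 + 3)%N.
exists (16 * k ^ 3 * ((2 * C1) ^ k.-1 * (64 * k)))%N, (2 ^ (8 * k ^ 3 * T0))%N => D D0 V E lin unif deg.
have Dpos : (0 < D)%N by apply: leq_trans D0; rewrite expn_gt0.
(* The divisor [8 * k ^ 3] is what yields [8 * k ^ 2 * T <= a] below, through
   [2 ^ l <= D <= 2 ^ (a * k.-1)]. *)
pose l := trunc_log 2 D; pose T := (l %/ (8 * k ^ 3))%N.
have k3p : (0 < 8 * k ^ 3)%N by rewrite muln_gt0 expn_gt0 (ltn_trans _ k3).
have T0T : (T0 <= T)%N by rewrite leq_divRL // mulnC; exact: trunc_log_max.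
have T1 : (0 < T)%N by apply: leq_trans T0T.
have lT : (l <= 16 * k ^ 3 * T)%N.
  have := ltn_ceil l k3p; rewrite -/T; move: T1; set x := (k ^ 3)%N; nia.
have Kpos := crowding_gt0 k3 T1.
have aex : exists a, (crowding k T * D <= 2 ^ (a * k.-1))%N.
  exists (crowding k T * D)%N; apply: leq_trans (ltnW (ltn_expl _ (isT : (1 < 2)%N))) _.
  by rewrite leq_exp2l // leq_pmulr //; lia.
(* The least scale that accommodates [D]; minimality bounds [2 ^ (a * k.-1)] from above up to a
   factor [2 ^ k.-1]. *)
have [a Ka amin] := ex_minnP aex.
have a8 : (8 * k ^ 2 * T <= a)%N.
  have : (8 * k ^ 3 * T <= a * k.-1)%N.
    rewrite -(leq_exp2l _ _ (isT : (1 < 2)%N)); apply: leq_trans Ka.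
    apply: (@leq_trans D); last by rewrite leq_pmull.
    apply: leq_trans _ (trunc_logP (isT : (1 < 2)%N) Dpos); rewrite leq_exp2l // mulnC; exact: leq_trunc_div.
  rewrite expnS -(leq_pmul2r (_ : 0 < k)%N) ?(ltn_trans _ k3) //.
  set x := (k ^ 2)%N; nia.
have a0a : (6 * k * T <= a)%N.
  by apply: leq_trans a8; rewrite leq_mul2r -mulnn; apply/orP; right; nia.
have Ta : (T <= a)%N by apply: leq_trans a8; rewrite leq_pmull // muln_gt0 expn_gt0 (ltn_trans _ k3).
have nT : (n1 + n2 + n3 + n4 <= T)%N by exact: ltnW T0T.
have aj : (6 * k * T + (a - 6 * k * T) = a)%N by rewrite subnKC.
have T6 : (T <= 6 * k * T)%N by rewrite leq_pmull // muln_gt0 (ltn_trans _ k3).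
have col := @colour_scaled V k k3 R T (6 * k * T) T1 (leqnn _) _ _ _ _ (a - 6 * k * T) E lin unif _.
exists ((2 ^ (6 * k * T * k.-1)).+1 + \sum_(i < a - 6 * k * T) palette k T (6 * k * T + i.+1))%N.
  apply: col.
  - by rewrite -[X in (X <= _)%N]muln1 -(expn0 (4 * T)); apply: h4; lia.
  - by rewrite -[X in (40 * X <= _)%N]expn1; apply: h3; lia.
  - by move=> b ab; apply: h1; lia.
  - by move=> b ab; apply: h2; lia.
  - by move=> v; rewrite aj; apply: leq_trans Ka; rewrite leq_mul2l deg orbT.
set Q := (_ + _)%N.
have TQ : (T * Q <= C1 * 2 ^ a)%N.
  rewrite /Q mulnDr mulnS.
  have := sum_palette k (6 * k * T) (a - 6 * k * T) T1; rewrite aj.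
  set s := (T * \sum_(_ < _) _)%N => sl.
  have t1 : (T * 2 ^ (6 * k * T * k.-1) <= 2 ^ a)%N.
    apply: (@leq_trans (2 ^ T * 2 ^ (6 * k * T * k.-1))).
      by rewrite leq_mul2r ltnW ?orbT // ltn_expl.
    rewrite -expnD leq_exp2l //; exact: leq_trans (exponent_budget T k3) a8.
  have t2 : (T <= 2 ^ a)%N by apply: leq_trans Ta _; exact/ltnW/ltn_expl.
  have t3 : ((a - 6 * k * T) * T <= 2 ^ a)%N.
    apply: (@leq_trans (a ^ 2)); first by rewrite -mulnn leq_mul // leq_subr.
    apply: leq_trans (h1 a _); last lia.
    by rewrite leq_pmull // expn_gt0 muln_gt0 (ltn_trans _ k3).
  exact: colour_budget sl t1 t2 t3.
have min : (2 ^ (a * k.-1) <= 2 ^ k.-1 * (crowding k T * D))%N.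
  have a1 : (0 < a)%N by exact: leq_trans T1 Ta.
  rewrite -{1}(prednK a1) mulSn expnD leq_mul2l; apply/orP; right; apply: ltnW.
  rewrite ltnNge; apply/negP => /amin; by rewrite leqNgt prednK ?leqnn.
have kk : k.-1 = (k - 2).+1 by lia.
(* The power [k - 1] of [T * Q <= C1 * 2 ^ a] has [T ^ (k - 2)] on both sides, on the right inside
   [crowding]; cancelling it leaves a single [T] on the left. *)
have main : (T * Q ^ k.-1 <= (2 * C1) ^ k.-1 * (64 * k) * D)%N.
  have Tk : (0 < T ^ (k - 2))%N by rewrite expn_gt0 T1.
  rewrite -(leq_pmul2l Tk) mulnA -expnSr -kk -expnMn.
  apply: (@leq_trans ((C1 * 2 ^ a) ^ k.-1)); first by rewrite leq_exp2r // kk.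
  rewrite expnMn -expnM; apply: leq_trans (leq_mul (leqnn _) min) _.
  rewrite /crowding [((2 * C1) ^ _)%N]expnMn.
  by apply: eq_leq; ring.
apply: (@leq_trans (16 * k ^ 3 * T * Q ^ k.-1)); first by rewrite leq_mul2r lT orbT.
by rewrite -[X in (X <= _)%N]mulnA -[X in (_ <= X)%N]mulnA leq_mul2l main orbT.
Qed.

Definition linear_uniform (V : finType) (k : nat) (E : {set {set V}}) :=
  k_uniform k E && linear_hypergraph E.

Lemma edge_uniformP (V : finType) (k : nat) (E : {set {set V}}) : linear_uniform k E ->
  forall e, e \in E -> #|e| = k.
Proof. by case/andP=> /forall_inP h _ e /h/eqP. Qed.

Lemma edge_linearP (V : finType) (k : nat) (E : {set {set V}}) : linear_uniform k E ->
  forall e f x w, e \in E -> f \in E -> x != w ->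
     x \in e -> w \in e -> x \in f -> w \in f -> e = f.
Proof.
case/andP=> _ /forall_inP lin e f x w eE fE xw xe we xf wf; apply/eqP.
apply: contraT => ef; have /forall_inP/(_ f fE) := lin e eE.
rewrite ef leqNgt /= => /negP[]; apply: (@leq_trans #|[set x; w]|).
  by rewrite cards2 xw.
by apply: subset_leq_card; rewrite subUset !sub1set !inE xe we xf wf.
Qed.

Lemma linear_uniformS (V : finType) (k : nat) (E E' : {set {set V}}) : E' \subset E ->
  linear_uniform k E -> linear_uniform k E'.
Proof.
move=> /subsetP sub /andP[/forall_inP u /forall_inP l]; apply/andP; split.
  by apply/forall_inP => e /sub/u.
apply/forall_inP => e /sub eE; apply/forall_inP => f /sub fE.
exact: (forall_inP (l e eE)).
Qed.

(** The streaming algorithm fixes its palette before seeing the hypergraph, so [Q] may depend on [D]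
    only: the largest value meeting the bound is taken. Replacing the binary logarithm by [ln] costs
    a factor 2. *)
Lemma linear_colouring (R : realType) (k : nat) : (2 < k)%N ->
  exists C D0 : nat, [/\ (0 < C)%N, (2 < D0)%N & forall D, (D0 <= D)%N ->
  exists Q : nat, Q%:R ^+ k.-1 * ln D%:R <= C%:R * D%:R :> R /\
  forall (V : finType) (E : {set {set V}}), linear_uniform k E ->
    (forall v, degree E v <= D)%N -> colourable E Q].
Proof.
move=> k3; have [C [D0 FM]] := linear_hypergraph_colouring R k3.
exists (2 * C).+1, (maxn D0 3); split=> //; first by rewrite leq_max orbT.
move=> D; rewrite geq_max => /andP[D0D D3].
have Dpos : (0 < D)%N by apply: leq_trans D3.
have l1 : (0 < trunc_log 2 D)%N by apply: trunc_log_max => //; exact: ltnW.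
have k1 : (0 < k.-1)%N by rewrite -subn1 subn_gt0 ltnW.
pose P Q := (trunc_log 2 D * Q ^ k.-1 <= C * D)%N.
have Pb Q : P Q -> (Q <= C * D)%N.
  apply: leq_trans; apply: (@leq_trans (Q ^ k.-1)); last by rewrite leq_pmull.
  by case: Q => // Q; rewrite -{1}[Q.+1]expn1 leq_pexp2l.
have P0 : exists Q, P Q by exists 0%N; rewrite /P exp0n // muln0.
have [Q PQ Qmax] := ex_maxnP P0 Pb.
exists Q; split; last first.
  move=> V E lu deg; have [Q' col PQ'] := FM D D0D V E (edge_linearP lu) (edge_uniformP lu) deg.
  exact: leq_colourable (Qmax _ PQ') col.
have lnD : ln D%:R <= 2 * (trunc_log 2 D)%:R :> R.
  apply: (@le_trans _ _ (trunc_log 2 D).+1%:R); last first.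
    by rewrite -(natrM _ 2) ler_nat mul2n -addnn -addn1 leq_add2l.
  rewrite -[leRHS]expRK ler_ln ?posrE ?expR_gt0 ?ltr0n //.
  apply: le_trans _ (expR_ge_2X _ _); rewrite ler_nat.
  exact/ltnW/trunc_log_ltn.
rewrite -natrX; apply: (@le_trans _ _ ((Q ^ k.-1)%:R * (2 * (trunc_log 2 D)%:R))).
  by rewrite ler_wpM2l.
rewrite mulrCA -!natrM ler_nat.
apply: (@leq_trans (2 * (C * D))); first by rewrite leq_mul2l mulnC.
by rewrite mulnA leq_mul2r leqnSn orbT.
Qed.

(** * From abstract states to memory words *)

Section Simulation.
Variables (R : realType) (V S : finType) (coins : finType) (W : nat).
Variables (init : coins -> S) (upd : {set V} -> S -> S) (out : S -> V -> nat).
Hypothesis coins_gt0 : (0 < #|coins|)%N.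
Hypothesis S_small : (#|S| <= 2 ^ (word_bits #|V| * W))%N.

Let memory : finType := W.-tuple (word #|V|).

Let card_memory : #|{: memory}| = (2 ^ (word_bits #|V| * W))%N.
Proof. by rewrite card_tuple card_tuple card_bool expnM. Qed.

Let S_le : (#|S| <= #|{: memory}|)%N. Proof. by rewrite card_memory. Qed.

Let encode (x : S) : memory := enum_val (widen_ord S_le (enum_rank x)).

Let s0 : S := init (enum_val (Ordinal coins_gt0)).

Let decode (m : memory) : S := odflt s0 [pick x | encode x == m].

Let encodeK : cancel encode decode.
Proof.
move=> x; rewrite /decode; case: pickP => [y /eqP|/(_ x)]; last by rewrite eqxx.
by move=> /enum_val_inj/(congr1 val)/= /ord_inj/enum_rank_inj.
Qed.

(** Only the initial draw influences the run, so the other draws cancel in the uniform probability.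
    The default [s0] of [decode] concerns memory contents that encode no state, which a run never
    produces. *)
Lemma simulation : exists A : streaming_algorithm V, num_words A = W /\
  forall (s : seq {set V}) (good : pred (V -> nat)),
  uniform_prob R (fun w : randomness A s => good (run w)) =
  uniform_prob R (fun f => good (out (foldl (fun x e => upd e x) (init f) s))).
Proof.
exists (@StreamingAlgorithm V W coins coins_gt0 (fun f => encode (init f))
  (fun _ e m => encode (upd e (decode m))) (fun _ m => out (decode m))).
split=> // s good.
set good' := fun f => good (out (foldl (fun x e => upd e x) (init f) s)).
rewrite /uniform_prob.
set A := StreamingAlgorithm _ _ _ _.
have runE (w : randomness A s) : good (run w) = good' w.1.1.
  case: w => -[f ws] f' /=; rewrite /good'.
  have -> : forall (us : seq coins) (x : S), size us = size s ->
    foldl (fun m (y : coins * {set V}) => encode (upd y.2 (decode m))) (encode x) (zip us s)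
      = encode (foldl (fun x e => upd e x) x s).
  - elim: (s) => [|e s' IH] [|u us] x //= [sz].
    by rewrite encodeK IH.
  - by rewrite encodeK.
  - by rewrite size_tuple.
have -> : [set w : randomness A s | good (run w)] =
   setX (setX [set f | good' f] [set: (size s).-tuple coins]) [set: coins].
  by apply/setP => w; rewrite !inE runE !andbT.
rewrite !cardsX !cardsT [#|randomness A s|]card_prod card_prod !natrM.
have c0 : #|coins|%:R != 0 :> R by rewrite pnatr_eq0 -lt0n.
have t0 : #|{: (size s).-tuple coins}|%:R != 0 :> R.
  by rewrite card_tuple natrX expf_neq0.
rewrite /= -!mulrA -[in RHS](mulr1 #|coins|%:R); field.
by rewrite c0 t0.
Qed.

End Simulation.

(** * The streaming algorithm *)

Section Algorithm.
Variables (R : realType) (V : finType) (k P d Q : nat).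
Hypothesis P_gt0 : (0 < P)%N.
Hypothesis P_word : (P <= #|V|.+1)%N.
Hypothesis k_gt0 : (0 < k)%N.
Hypothesis col : forall E : {set {set V}}, linear_uniform k E ->
  (forall v, degree E v <= d)%N -> colourable E Q.

Local Notation n := #|V|.
Local Notation B := (n * d)%N.
Local Notation parts := {ffun V -> 'I_P}.
Implicit Types (f : parts) (e : {set V}) (X E : {set {set V}}).

Definition inside f e : bool := [forall u in e, forall v in e, f u == f v].
Definition kept_edges f E : {set {set V}} := [set e in E | inside f e].
Definition storable X : bool := (#|X| <= B)%N && [forall e in X, #|e| == k].

Definition store : finType := {X : {set {set V}} | storable X}.

Lemma storable0 : storable set0.
Proof. by rewrite /storable cards0 /=; apply/forall_inP => e; rewrite inE. Qed.

(** [insubd] keeps the old store when the enlarged one would not be storable, which bounds the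
    memory on every stream. *)
Definition add_edge e (x : parts * store) : parts * store :=
  (x.1, if inside x.1 e then insubd x.2 (e |: val x.2) else x.2).

Definition good_colouring X : option {ffun V -> 'I_Q} :=
  [pick c : {ffun V -> 'I_Q} | [forall e in X, ~~ monochromatic (fun v => c v : nat) e]].

Definition final_colour (x : parts * store) (v : V) : nat :=
  if good_colouring (val x.2) is Some c then (x.1 v * Q + c v)%N else 0%N.

Lemma card_k_sets : (#|[set e : {set V} | #|e| == k]| <= n ^ k)%N.
Proof.
have -> : (n ^ k)%N = #|{: k.-tuple V}| by rewrite card_tuple.
rewrite -cardsT; apply: leq_trans (leq_imset_card (fun t : k.-tuple V => [set x in t]) _).
apply: subset_leq_card; apply/subsetP => e; rewrite inE => ek; apply/imsetP.
have es : size (enum e) == k by rewrite -cardE.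
by exists (Tuple es); rewrite ?inE //; apply/setP => x; rewrite inE mem_enum.
Qed.

(** A storable set is the image of a partial map from [B] slots to the [k]-subsets of [V], of which
    there are at most [n ^ k]. *)
Lemma card_store : (#|store| <= (n ^ k).+1 ^ B)%N.
Proof.
pose F := [set e : {set V} | #|e| == k].
pose G : finType := option {e : {set V} | e \in F}.
have cG : (#|{: G}| <= (n ^ k).+1)%N.
  by rewrite card_option ltnS card_sig; apply: leq_trans card_k_sets; rewrite leq_eqVlt cardsE eqxx.
pose im (t : {ffun 'I_B -> G}) : {set {set V}} :=
  [set e | [exists i, if t i is Some y then val y == e else false]].
rewrite card_sig; apply: (@leq_trans #|[set im t | t : {ffun 'I_B -> G}]|); last first.
  apply: leq_trans (leq_imset_card _ _) _; rewrite card_ffun card_ord.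
  by case: (B) => // b; rewrite leq_exp2r.
apply: subset_leq_card; apply/subsetP => X; rewrite unfold_in => /andP[XB /forall_inP Xk].
apply/imsetP.
have XF (i : 'I_#|X|) : enum_val i \in F by rewrite inE Xk // enum_valP.
pose g (i : 'I_B) : G := omap (fun j : 'I_#|X| => exist _ (enum_val j) (XF j)) (insub (i : nat)).
exists [ffun i => g i] => //.
apply/setP => e; rewrite inE; apply/idP/existsP => [eX|[i]].
  exists (widen_ord XB (enum_rank_in eX e)); rewrite ffunE /g /=.
  case: insubP => [j _ jE|]; last by rewrite ltn_ord.
  by rewrite (_ : j = enum_rank_in eX e) /= ?enum_rankK_in //; apply: val_inj.
by rewrite ffunE /g; case: insubP => //= j _ _ /eqP <-; exact: enum_valP.
Qed.

(** One word per vertex for its class, and [k + 1] words per slot of the store, as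
    [n ^ k + 1 <= w ^ (k + 1)] for the number [w > n] of values of a word. *)
Lemma card_algorithm_state :
  (#|{: parts * store}| <= 2 ^ (word_bits n * (n + k.+1 * B)))%N.
Proof.
have nb : (n < 2 ^ word_bits n)%N by exact: trunc_log_ltn.
have b2 : (2 <= 2 ^ word_bits n)%N by rewrite -{1}(expn1 2) leq_exp2l.
set w := (2 ^ word_bits n)%N in nb b2.
rewrite card_prod mulnDr expnD (expnM 2 _ n) (expnM 2 _ (k.+1 * B)) -/w (expnM w k.+1 B).
apply: leq_mul.
  rewrite card_ffun card_ord; case: (n) P_word nb => // m Pm mw.
  by rewrite leq_exp2r //; apply: leq_trans Pm _.
apply: leq_trans card_store _.
case: (B) => // b; rewrite leq_exp2r // expnSr.
apply: (@leq_trans (w ^ k + w ^ k)).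
  apply: (@leq_trans ((n ^ k) + w ^ k)); first by rewrite -addn1 leq_add2l expn_gt0 (leq_trans _ b2).
  by rewrite leq_add2r leq_exp2r // ltnW.
by rewrite addnn -muln2 leq_mul2l b2 orbT.
Qed.

(** If all of [kept_edges f E] fits, so does each part of it, and no insertion is refused. *)
Lemma fold_stored f E (s : seq {set V}) (X0 : store) :
  storable (kept_edges f E) -> val X0 \subset kept_edges f E -> {subset s <= E} ->
  (foldl (fun x e => add_edge e x) (f, X0) s).1 = f /\
  val (foldl (fun x e => add_edge e x) (f, X0) s).2 = val X0 :|: [set e in s | inside f e].
Proof.
move=> st; elim: s X0 => [|e s IH] X0 X0E sE /=.
  by split=> //; apply/setP => e; rewrite !inE orbF.
have eE : e \in E by apply: sE; rewrite mem_head.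
have sE' : {subset s <= E} by move=> e' e's; apply: sE; rewrite inE e's orbT.
rewrite /add_edge /=; case: ifP => ie; last first.
  have [-> ->] := IH X0 X0E sE'; split=> //; apply/setP => e'; rewrite !inE.
  by case: eqVneq => // ->; rewrite ie andbF.
have sub : e |: val X0 \subset kept_edges f E by rewrite subUset sub1set inE eE ie.
have stX : storable (e |: val X0).
  case/andP: st => cE /forall_inP kE; rewrite /storable (leq_trans (subset_leq_card sub) cE) /=.
  by apply/forall_inP => e' /(subsetP sub)/kE.
have vX : val (insubd X0 (e |: val X0)) = e |: val X0 by rewrite val_insubd stX.
have [|-> ->] := IH (insubd X0 (e |: val X0)) _ sE'; first by rewrite vX.
split=> //; rewrite vX; apply/setP => e'; rewrite !inE.
by case: eqVneq => [->|] //=; rewrite ie orbT.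
Qed.

Lemma handshake E : (forall e, e \in E -> #|e| = k) -> (forall v, degree E v <= d)%N ->
  (#|E| <= B)%N.
Proof.
move=> unif deg; apply: (@leq_trans (\sum_(e in E) #|e|)).
  by rewrite -sum1_card; apply: leq_sum => e /unif ->.
have -> : (\sum_(e in E) #|e| = \sum_v degree E v)%N.
  under eq_bigr do rewrite -sum1_card.
  rewrite (exchange_big_dep predT) //=; apply: eq_bigr => v _.
  by rewrite sum1_card /degree cardsE.
by rewrite -sum_nat_const; apply: leq_sum => v _.
Qed.

(** Quotient and remainder by [Q] recover the class and the inner colour. A monochromatic edge would
    lie inside a class, hence be stored, and be monochromatic for the inner colouring. *)
Lemma final_colour_proper f E (s : seq {set V}) (q : R) :
  linear_uniform k E -> perm_eq s (enum E) -> (P * Q)%N%:R <= q ->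
  [forall v, (degree (kept_edges f E) v <= d)%N] ->
  proper_coloring q E (final_colour (foldl (fun x e => add_edge e x)
     (f, exist _ set0 storable0 : store) s)).
Proof.
move=> lu ps PQq /forallP deg.
have sub : kept_edges f E \subset E by apply/subsetP => e; rewrite inE => /andP[].
have lu' := linear_uniformS sub lu.
have st : storable (kept_edges f E).
  rewrite /storable handshake //=; last exact: edge_uniformP lu'.
  by apply/forall_inP => e /(edge_uniformP lu') ->.
have sE : {subset s <= E} by move=> e; rewrite (perm_mem ps) mem_enum.
have [|f1 v1] := fold_stored (X0 := exist _ set0 storable0 : store) st _ sE; first by rewrite sub0set.
rewrite /final_colour f1 v1.
have -> : val (exist _ set0 storable0 : store) :|: [set e in s | inside f e] = kept_edges f E.
  by apply/setP => e; rewrite !inE (perm_mem ps) mem_enum.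
have [c cP] : exists c, good_colouring (kept_edges f E) = Some c.
  rewrite /good_colouring; case: pickP => [c _|no]; first by exists c.
  have [c cQ ce] := col lu' deg.
  have /negP[] := no [ffun v => Ordinal (cQ v)].
  apply/forall_inP => e /ce; apply: contraNN => /monoP m; apply/monoP => u v ue ve.
  by have := m u v ue ve; rewrite !ffunE.
rewrite cP; move: cP; rewrite /good_colouring; case: pickP => // c' /forall_inP cE [c'E]; subst c'.
apply/andP; split.
  apply: le_trans PQq; rewrite ler_nat /num_colors.
  have -> : (P * Q = size (iota 0 (P * Q)))%N by rewrite size_iota.
  apply: uniq_leq_size; first exact: undup_uniq.
  move=> x; rewrite mem_undup => /codomP[v ->]; rewrite mem_iota add0n /=.
  apply: (@leq_trans ((f v).+1 * Q)); last by rewrite leq_mul2r ltn_ord orbT.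
  by rewrite mulSn addnC ltn_add2r.
apply/forall_inP => e eE; apply/negP => /monoP m.
have Q0 (v : V) : (0 < Q)%N := leq_ltn_trans (leq0n _) (ltn_ord (c v)).
have fc u v : u \in e -> v \in e -> f u = f v /\ c u = c v.
  move=> ue ve; have h := m u v ue ve; split; apply: val_inj => /=.
    have := congr1 (divn^~ Q) h; rewrite /= !divnMDl ?(Q0 u) // !divn_small ?ltn_ord // !addn0.
    by [].
  by have := congr1 (modn^~ Q) h; rewrite /= !modnMDl !modn_small ?ltn_ord.
have ek : e \in kept_edges f E.
  rewrite inE eE; apply/forall_inP => u ue; apply/forall_inP => v ve.
  by have [-> _] := fc u v ue ve.
have /negP[] := cE e ek; apply/monoP => u v ue ve.
by have [_ ->] := fc u v ue ve.
Qed.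

Lemma algorithm_exists : exists A : streaming_algorithm V,
  num_words A = (n + k.+1 * B)%N /\
  forall E : {set {set V}}, linear_uniform k E ->
  forall (s : seq {set V}) (q : R), perm_eq s (enum E) -> (P * Q)%N%:R <= q ->
  uniform_prob R (fun f : parts => [forall v, (degree (kept_edges f E) v <= d)%N]) <=
  uniform_prob R (fun w : randomness A s => proper_coloring q E (run w)).
Proof.
have parts_gt0 : (0 < #|{: parts}|)%N by rewrite card_ffun card_ord expn_gt0 P_gt0.
have [A [AW Arun]] := @simulation R V (parts * store)%type parts (n + k.+1 * B)
  (fun f => (f, exist _ set0 storable0 : store)) add_edge final_colour parts_gt0 card_algorithm_state.
exists A; split=> // E lu s q ps PQq; rewrite Arun /uniform_prob.
rewrite ler_pM2r ?invr_gt0 ?ltr0n // ler_nat; apply: subset_leq_card; apply/subsetP => f.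
rewrite !inE; exact: final_colour_proper.
Qed.

End Algorithm.

(** * Degrees inside the classes of a random partition *)

Section RandomPartition.
Variables (R : realType) (V : finType) (k P D m z : nat) (E : {set {set V}}).
Hypothesis P_gt0 : (0 < P)%N.
Hypothesis lu : linear_uniform k E.
Hypothesis deg : forall v, (degree E v <= D)%N.
Hypothesis mz : (m <= z)%N.
Hypothesis Dz : (2 * D <= P ^ k.-1 * (z - m))%N.
Hypothesis m_large : (#|V| ^ 2 <= 2 ^ m)%N.

Implicit Types (v u : V) (e : {set V}) (f : {ffun V -> 'I_P}).

Let pmf (v : V) (i : 'I_P) : R := P%:R^-1.
Let pmf_ge0 v i : 0 <= pmf v i. Proof. by rewrite invr_ge0. Qed.
Let pmf_sum1 v : \sum_i pmf v i = 1.
Proof.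
by rewrite sumr_const card_ord -[LHS]mulr_natr mulVf // pnatr_eq0 -lt0n.
Qed.

Let mu := CoinLaw pmf_ge0 pmf_sum1.

Lemma Pr_uniform (A : pred {ffun V -> 'I_P}) : Pr mu A = uniform_prob R A.
Proof.
have massE f : mass mu f = P%:R^-1 ^+ #|V| by rewrite /mass /= /pmf prodr_const.
rewrite /Pr /Ex /uniform_prob card_ffun card_ord natrX -exprVn mulrC.
under eq_bigr do rewrite massE.
rewrite -mulr_sumr; congr (_ * _).
by rewrite -natr_sum -sum1_card; congr (_%:R); rewrite [RHS]big_mkcond; apply: eq_bigr => f _; rewrite inE; case: (A f).
Qed.

Let monoc (c : 'I_P) e v f : R := \prod_(u in e :\ v) (f u == c)%:R.

Let Ex_monoc c e v : e \in E -> v \in e -> Ex mu (monoc c e v) = P%:R^-1 ^+ k.-1.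
Proof.
move=> eE ve; rewrite (Ex_coord_prod mu (e :\ v) (fun _ i => (i == c)%:R)) /=.
have ck : #|e :\ v| = k.-1 by rewrite -(edge_uniformP lu eE) (cardsD1 v e) ve.
rewrite -ck -prodr_const; apply: eq_bigr => u _.
rewrite (bigD1 c) //= eqxx mulr1 big1 ?addr0 // => i /negbTE ->; by rewrite mulr0.
Qed.

(** Given the class of [v], the edges of [S] are disjoint outside [v] by linearity, so each falls
    into that class independently, with probability [P ^- k.-1]. *)
Lemma Pr_all_inside v (S : {set {set V}}) : S \subset [set e in E | v \in e] -> #|S| = m ->
  Pr mu (fun f => [forall e in S, inside f e]) <= ((P ^ k.-1) ^ m)%N%:R^-1.
Proof.
move=> /subsetP SE Sm; have lin := edge_linearP lu.
have SEP e : e \in S -> e \in E /\ v \in e by move=> /SE; rewrite inE => /andP[].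
apply: (@le_trans _ _ (Ex mu (fun f => \sum_(c : 'I_P) ((f v == c)%:R * \prod_(e in S) monoc c e v f)))).
  apply: Ex_le => f; case: (boolP [forall e in S, _]) => [/forall_inP ins|_]; last first.
    by apply: sumr_ge0 => c _; rewrite mulr_ge0 // prodr_ge0 // => e _; rewrite prodr_ge0.
  rewrite (bigD1 (f v)) //= eqxx mul1r big1; last first.
    move=> e eS; have [_ ve] := SEP e eS; rewrite /monoc big1 // => u /setD1P[_ ue].
    by have /forall_inP/(_ u ue)/forall_inP/(_ v ve) -> := ins e eS.
  by rewrite lerDl sumr_ge0 // => c _; rewrite mulr_ge0 // prodr_ge0 // => e _; rewrite prodr_ge0.
rewrite Ex_sum.
have each c : Ex mu (fun f => (f v == c)%:R * \prod_(e in S) monoc c e v f) =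
    P%:R^-1 * (P%:R^-1 ^+ k.-1) ^+ m.
  rewrite (@Ex_indep _ _ _ mu [set v] (~: [set v])).
  - rewrite (Ex_coord mu v (fun i => (i == c)%:R)) (bigD1 c) //= eqxx mulr1 big1 ?addr0; last first.
      by move=> i /negbTE ->; rewrite mulr0.
    congr (_ * _); rewrite (@Ex_prod_indep _ _ _ mu _ S (fun e => e :\ v)).
    + rewrite -Sm -prodr_const; apply: eq_bigr => e /SEP[eE ve]; exact: Ex_monoc.
    + by move=> e _ f f' h; apply: eq_bigr => u ue; rewrite h.
    + move=> e e' /SEP[eE ve] /SEP[e'E ve'] ee'; rewrite -setI_eq0; apply: contraNT ee' => /set0Pn[u].
      rewrite inE => /andP[/setD1P[uv ue] /setD1P[_ ue']].
      by apply/eqP; apply: lin uv ue ve ue' ve'.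
  - by move=> f f' h; rewrite h ?inE.
  - move=> f f' h; apply: eq_bigr => e _; apply: eq_bigr => u /setD1P[uv _].
    by rewrite h ?inE.
  - by rewrite -subsets_disjoint.
under eq_bigr do rewrite each.
rewrite sumr_const card_ord -[leLHS]mulr_natl mulrA mulfV ?mul1r; last by rewrite pnatr_eq0 -lt0n.
by rewrite !exprVn -!natrX.
Qed.

(** For one vertex the failure probability is at most ['C(D, m) / ((P ^ k.-1) ^ m * 'C(z, m)) <= 2
    ^- m <= n ^- 2]; the union bound over the [n] vertices loses one factor [n]. *)
Lemma good_partition_prob :
  1 - #|V|%:R^-1 <= uniform_prob R (fun f : {ffun V -> 'I_P} =>
    [forall v, (degree (kept_edges f E) v <= z)%N]).
Proof.
rewrite -Pr_uniform.
(* For an empty vertex set the inverse of 0 is 0, so probability 1 is claimed; it holds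
   vacuously. *)
have [n0|n0] := posnP #|V|.
  rewrite n0 invr0 subr0 (@eq_Pr _ _ _ mu _ (fun=> true)) /Pr ?Ex_cst // => f.
  by apply/forallP => v; have := fintype0 v n0.
have over v : Pr mu (fun f => ~~ (degree (kept_edges f E) v <= z)%N) <= (2 ^ m)%N%:R^-1.
  have Cz : 0 < 'C(z, m)%:R :> R by rewrite ltr0n bin_gt0.
  rewrite -(ler_pM2r Cz).
  have count := @Pr_count _ _ _ mu _ [set e in E | v \in e] (fun e f => inside f e) m z _
    (fun S SE Sm => Pr_all_inside SE Sm).
  apply: (@le_trans _ _ (Pr mu (fun f => (z <= #|[set e in [set e in E | v \in e] | inside f e]|)%N) * 'C(z, m)%:R)).
    apply: ler_wpM2r; first exact: ltW.
    apply: Pr_le => f; rewrite -ltnNge => /ltnW/leq_trans; apply.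
    by apply: subset_leq_card; apply/subsetP => e; rewrite !inE => /andP[/andP[-> ->] ->].
  apply: le_trans count _.
  have Pk : (0 < (P ^ k.-1) ^ m)%N by rewrite !expn_gt0 P_gt0.
  rewrite ler_pdivrMr ?ltr0n // -mulrA ler_pdivlMl ?ltr0n ?expn_gt0 //.
  rewrite -!natrM ler_nat [X in (_ <= X)%N]mulnC.
  apply: leq_trans (bin_ratio mz Dz); rewrite leq_mul2l leq_bin2l ?orbT //; exact: deg.
have bad : Pr mu (fun f => [exists v, ~~ (degree (kept_edges f E) v <= z)%N]) <= #|V|%:R^-1.
  apply: le_trans (Pr_exists mu predT _) _.
  apply: (@le_trans _ _ (\sum_(v : V) (2 ^ m)%N%:R^-1)); first by apply: ler_sum => v _; exact: over.
  rewrite sumr_const -[leLHS]mulr_natl ler_pdivrMr ?ltr0n ?expn_gt0 //.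
  rewrite ler_pdivlMl ?ltr0n // -natrM ler_nat mulnn; exact: m_large.
rewrite lerBlDr; apply: le_trans (lerD (lexx _) bad).
apply: le_trans (Pr_union _ _ _); rewrite (@eq_Pr _ _ _ mu _ (fun=> true)) /Pr ?Ex_cst // => f.
by rewrite -negb_forall orbN.
Qed.

End RandomPartition.

Lemma degree_le_card (V : finType) (k : nat) (E : {set {set V}}) (v : V) : (2 < k)%N ->
  linear_uniform k E -> (degree E v <= #|V|)%N.
Proof.
move=> k3 lu; have lin := edge_linearP lu.
have e1 e : e \in E -> (1 < #|e|)%N by move=> /(edge_uniformP lu) ->; exact: ltnW.
rewrite /degree -(card_in_imset (f := witness v)); first exact: max_card.
move=> e f; rewrite !inE => /andP[eE ve] /andP[fE vf] ef.
have /setD1P[wv we] := witnessP (e1 _ eE) ve; have /setD1P[_ wf] := witnessP (e1 _ fE) vf.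
by apply: lin wv we ve _ vf => //; rewrite ef.
Qed.

(** Compares [k.-1]-th powers. The [gamma] in the hypothesis is the loss from colouring at degree
    about [n ^ gamma]; since [gamma < 1], its inverse is at most the [k.-1]-th power of
    [gamma ^- (4 * k)]. *)
Lemma palette_size_ge (R : realType) (k C x Delta : nat) (gamma : R) : (2 < k)%N -> (0 < C)%N ->
  0 < gamma -> gamma < 1 -> (2 < Delta)%N ->
  x%:R ^+ k.-1 * (gamma * ln Delta%:R) <= (10 * C)%:R ^+ k.-1 * Delta%:R ->
  x%:R <= palette_size k (10 * C)%:R gamma Delta.
Proof.
move=> k3 C0 g0 g1 D3 xle.
have lnD : 0 < ln Delta%:R :> R by rewrite ln_gt0 // ltr1n ltnW.
have k1 : (0 < k.-1)%N by rewrite -subn1 subn_gt0 ltnW.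
have q0 : 0 <= Delta%:R / ln Delta%:R :> R by rewrite divr_ge0 // ltW.
rewrite /palette_size; set w := _ `^ _.
have w0 : 0 <= w by exact: powR_ge0.
have wk : w ^+ k.-1 = Delta%:R / ln Delta%:R.
  rewrite -powR_mulrn // /w -powRrM mulVf ?powRr1 //.
  by rewrite pnatr_eq0 -lt0n.
have g4 : 0 < gamma ^+ (4 * k) by rewrite exprn_gt0.
rewrite -(ler_pXn2r k1) ?nnegrE ?mulr_ge0 ?invr_ge0 ?(ltW g4) //.
rewrite !exprMn wk exprVn -exprM.
have xle' : x%:R ^+ k.-1 <= (10 * C)%:R ^+ k.-1 / gamma * (Delta%:R / ln Delta%:R).
  rewrite mulf_div ler_pdivlMr ?mulr_gt0 //.
apply: le_trans xle' _; apply: ler_wpM2r => //; apply: ler_wpM2l; first by rewrite exprn_ge0.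
rewrite lef_pV2 ?posrE ?exprn_gt0 // -[leRHS]expr1.
by apply: ler_wiXn2l; rewrite ?(ltW g0) ?(ltW g1) // muln_gt0 k1 muln_gt0 (ltn_trans _ k3).
Qed.

(** Monotonicity of [t / ln t] in disguise: if [Delta > n], then [ln (Delta / n) <= Delta / n - 1],
    and [1 <= ln n]. *)
Lemma min_over_ln (R : realType) (Delta n : nat) : (0 < Delta)%N -> (0 < n)%N ->
  1 <= ln n%:R :> R ->
  (minn Delta n)%:R * ln Delta%:R <= Delta%:R * ln n%:R :> R.
Proof.
move=> Dpos npos l1.
have D0 : 0 < Delta%:R :> R by rewrite ltr0n.
have n0 : 0 < n%:R :> R by rewrite ltr0n.
case: (leqP Delta n) => [Dn|/ltnW nD].
  by rewrite ler_wpM2l // ler_ln ?posrE // ler_nat.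
have -> : ln Delta%:R = ln n%:R + ln (Delta%:R / n%:R) :> R.
  by rewrite ln_div ?posrE // addrC subrK.
have h : ln (Delta%:R / n%:R) <= Delta%:R / n%:R - 1 :> R.
  have := @le_ln1Dx R (Delta%:R / n%:R - 1); rewrite [1 + _]addrC subrK; apply.
  by rewrite ltrBrDl subrr divr_gt0.
have -> : Delta%:R * ln n%:R = n%:R * (ln n%:R + (Delta%:R / n%:R - 1) * ln n%:R) :> R.
  by field; rewrite lt0r_neq0.
rewrite ler_pM2l // lerD2l; apply: le_trans h _; rewrite ler_peMr // subr_ge0.
by rewrite ler_pdivlMr // mul1r ler_nat.
Qed.

(* [expR y] is [n], so [2 * (trunc_log 2 n).+1] is at most [6 * y], far below [expR (gamma * y)]. *)
Lemma log_le_power (R : realType) (gamma : R) (c : nat) : 0 < gamma ->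
  exists2 n0 : nat, (2 < n0)%N & forall n, (n0 <= n)%N ->
   [/\ (2 * (trunc_log 2 n).+1)%:R <= n%:R `^ gamma, c%:R <= n%:R `^ gamma & 1 <= ln n%:R :> R].
Proof.
move=> g0; pose Y : R := 12 / gamma ^+ 2 + c%:R / gamma + 1.
have Y1 : 1 <= Y by rewrite /Y lerDr addr_ge0 ?divr_ge0 ?exprn_ge0 // ltW.
exists (maxn (Num.bound (expR Y)) 3); first by rewrite leq_max orbT.
move=> n; rewrite geq_max => /andP[nY n3].
have n0 : 0 < n%:R :> R by rewrite ltr0n (ltn_trans _ n3).
have yY : Y <= ln n%:R.
  rewrite -[leLHS]expRK ler_ln ?posrE ?expR_gt0 //.
  apply: le_trans (ltW (archi_boundP (expR_ge0 Y))) _; by rewrite ler_nat.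
set y := ln n%:R in yY.
have -> : n%:R `^ gamma = expR (gamma * y) by rewrite /powR gt_eqF.
have gy0 : 0 <= gamma * y by rewrite mulr_ge0 ?(ltW g0) // (le_trans _ yY) // (le_trans _ Y1).
have y1 : 1 <= y by exact: le_trans yY.
have A0 : 0 <= 12 / gamma ^+ 2 by rewrite divr_ge0 // exprn_ge0 // ltW.
have B0 : 0 <= c%:R / gamma by rewrite divr_ge0 // ltW.
split=> //; last first.
  apply: le_trans _ (expR_ge1Dx _); have : c%:R <= gamma * y.
    rewrite -ler_pdivrMl // mulrC; apply: le_trans _ yY; rewrite /Y; lra.
  by lra.
have ly : (trunc_log 2 n)%:R <= 2 * y.
  have : expR ((trunc_log 2 n)%:R / 2) <= n%:R :> R.
    apply: (@le_trans _ _ (2 ^ trunc_log 2 n)%N%:R); last first.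
      by rewrite ler_nat trunc_logP // (ltn_trans _ n3).
    rewrite expRM_natl natrX lerXn2r ?nnegrE ?expR_ge0 //.
    by have := @expR_half_le R 1; rewrite ler01 lexx div1r => /(_ isT).
  rewrite -ler_ln ?posrE ?expR_gt0 // expRK -/y; lra.
apply: le_trans _ (expR_ge1Dxn 1 gy0).
have yy : 12 <= gamma ^+ 2 * y.
  rewrite -ler_pdivrMl ?exprn_gt0 // mulrC; apply: le_trans _ yY; rewrite /Y; lra.
have -> : (1.+1)`!%:R = 2 :> R by [].
rewrite natrM -[(trunc_log 2 n).+1%:R]natr1 exprMn [y ^+ 2]expr2.
have : 12 * y <= gamma ^+ 2 * (y * y) by rewrite mulrA ler_wpM2r // (le_trans ler01).
lra.
Qed.

Lemma degree_kept (V : finType) (P : nat) (f : {ffun V -> 'I_P}) (E : {set {set V}}) v :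
  (degree (kept_edges f E) v <= degree E v)%N.
Proof.
by apply: subset_leq_card; apply/subsetP => e; rewrite !inE => /andP[/andP[-> _] ->].
Qed.

Lemma uniform_prob_true (R : realType) (T : finType) (A : pred T) : (0 < #|T|)%N ->
  (forall x, A x) -> uniform_prob R A = 1.
Proof.
move=> T0 AT; rewrite /uniform_prob (_ : [set w | A w] = setT) ?cardsT.
  by rewrite divff // pnatr_eq0 -lt0n.
by apply/setP => w; rewrite !inE AT.
Qed.

Lemma bounded_by_max_degree (V : finType) (E : {set {set V}}) (D : nat) :
  (max_degree E <= D)%N -> forall v, (degree E v <= D)%N.
Proof. by move=> ED v; apply: leq_trans ED; exact: leq_bigmax. Qed.

(** The partition into a single class. By linearity degrees are at most [#|V|], so the store needs
    only [minn Delta #|V|] edges per vertex. *)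
Lemma store_everything (R : realType) (k Delta Q : nat) (q : R) (V : finType) : (2 < k)%N ->
  (forall E : {set {set V}}, linear_uniform k E -> (forall v, degree E v <= Delta)%N -> colourable E Q) ->
  Q%:R <= q ->
  exists A : streaming_algorithm V, num_words A = (#|V| + k.+1 * (#|V| * minn Delta #|V|))%N /\
  forall E : {set {set V}}, linear_uniform k E -> (max_degree E <= Delta)%N ->
  forall s : seq {set V}, perm_eq s (enum E) ->
  1 - #|V|%:R^-1 <= uniform_prob R (fun w : randomness A s => proper_coloring q E (run w)).
Proof.
move=> k3 col Qq.
have col' (E : {set {set V}}) : linear_uniform k E ->
    (forall v, degree E v <= minn Delta #|V|)%N -> colourable E Q.
  by move=> lu deg; apply: col lu _ => v; apply: leq_trans (deg v) (geq_minl _ _).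
have [A [AW Arun]] := algorithm_exists R (isT : (0 < 1)%N) (isT : (1 <= #|V|.+1)%N) (ltn_trans (isT : (0 < 2)%N) k3) col'.
exists A; split=> // E lu ED s ps.
apply: le_trans (Arun E lu s q ps _); last by rewrite mul1n.
rewrite uniform_prob_true ?gerBl ?invr_ge0 // ?card_ffun ?card_ord ?exp1n // => f.
apply/forallP => v; apply: leq_trans (degree_kept _ _ _) _.
by rewrite leq_min (bounded_by_max_degree ED) (degree_le_card v k3 lu).
Qed.

Theorem theorem1p11 (R : realType) (k : nat) (hk : (3 <= k)%N) :
  exists2 C : R, 0 < C &
  forall gamma : R, 0 < gamma -> gamma < 1 ->
  exists (Delta0 : nat) (K : R),
  forall Delta : nat, (Delta0 <= Delta)%N ->
  forall (n : nat) (V : finType), #|V| = n ->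
  exists A : streaming_algorithm V,
    (num_words A)%:R <= K * n%:R `^ (1 + gamma) /\
    forall E : {set {set V}},
      k_uniform k E -> linear_hypergraph E -> (max_degree E <= Delta)%N ->
    forall s : seq {set V}, perm_eq s (enum E) ->
      1 - n%:R^-1 <=
        uniform_prob R (fun w : randomness A s =>
          proper_coloring (palette_size k C gamma Delta) E (run w)).
Proof.
have [C [D0 [C0 D03 col]]] := linear_colouring R hk.
(* The factor is [5 * 2]: the stored degree is at most [5 * n ^ gamma], and the minimal number of
   classes loses [2 ^ k.-1] at the power [k - 1]. *)
exists (10 * C)%:R; first by rewrite ltr0n muln_gt0.
move=> gamma g0 g1.
have [n0 n03 large] := log_le_power D0 g0.
(* [n0] covers small [n], where degrees are below [n0]; 5 covers the degree bound [z] of the general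
   case. *)
exists D0, (1 + k.+1%:R * (n0 + 5)%:R) => Delta DD n V Vn.
have D3 : (2 < Delta)%N by exact: leq_trans D03 DD.
have Dpos : (0 < Delta)%N by exact: ltn_trans D3.
have lnD0 : 0 <= ln Delta%:R :> R by rewrite ln_ge0 // ler1n.
have C1 : 1 <= C%:R :> R by rewrite ler1n.
have k1 : (0 < k.-1)%N by rewrite -subn1 subn_gt0 ltnW.
have Ck : C%:R <= (10 * C)%:R ^+ k.-1 :> R.
  rewrite -natrX ler_nat; apply: (@leq_trans (10 * C)); first by rewrite leq_pmull.
  by rewrite -{1}[(10 * C)%N]expn1 leq_pexp2l // muln_gt0 C0.
have space (d : nat) : d%:R <= (n0 + 5)%:R * n%:R `^ gamma ->
    (n + k.+1 * (n * d))%N%:R <= (1 + k.+1%:R * (n0 + 5)%:R) * n%:R `^ (1 + gamma).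
  move=> dle; case: (posnP n) => [->|npos].
    by rewrite !mul0n muln0 mulr_ge0 ?powR_ge0 // addr_ge0 // mulr_ge0.
  have nR : 0 < n%:R :> R by rewrite ltr0n.
  have n1 : 1 <= n%:R :> R by rewrite ler1n.
  rewrite powRD; last by apply/implyP => _; rewrite gt_eqF.
  rewrite powRr1 ?(ltW nR) //.
  have x1 : 1 <= n%:R `^ gamma by rewrite -[leLHS](powRr0 n%:R) ler_powR // ltW.
  rewrite natrD !natrM mulrDl mul1r; apply: lerD; first by rewrite ler_peMr // ltW.
  rewrite -mulrA ler_wpM2l // mulrCA ler_wpM2l //; exact: ltW.
(* For small [n] or small [Delta] the whole hypergraph fits into memory. *)
have [sparse|dense] := boolP ((n < n0)%N || (Delta%:R <= n%:R `^ gamma)).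
  have [Q [Qle Qcol]] := col Delta DD.
  have Qq : Q%:R <= palette_size k (10 * C)%:R gamma Delta.
    apply: palette_size_ge => //.
    apply: (@le_trans _ _ (Q%:R ^+ k.-1 * ln Delta%:R)).
      by apply: ler_wpM2l; rewrite ?exprn_ge0 // ler_piMl // ltW.
    by apply: le_trans Qle _; rewrite ler_wpM2r.
  have [A [AW Arun]] := store_everything hk (Qcol V) Qq.
  rewrite Vn in AW Arun; exists A; split; last first.
    by move=> E u l; apply: Arun; rewrite /linear_uniform u l.
  rewrite AW; apply: space; case: (posnP n) => [->|npos].
    by rewrite minn0 mulr_ge0 ?powR_ge0.
  have x1 : 1 <= n%:R `^ gamma by rewrite -[leLHS](powRr0 n%:R) ler_powR ?ler1n // ltW.
  case/orP: sparse => [nn0|Dx].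
    apply: (@le_trans _ _ (n0 + 5)%:R); last by rewrite ler_peMr.
    by rewrite ler_nat (leq_trans (geq_minr _ _)) // (leq_trans (ltnW nn0)) // leq_addr.
  apply: (@le_trans _ _ (n%:R `^ gamma)).
    by apply: le_trans Dx; rewrite ler_nat geq_minl.
  by rewrite ler_peMl ?powR_ge0 // ler1n addnS.
move: dense; rewrite negb_or -leqNgt -ltNge => /andP[nn0 xD].
have [mx D0x ln1] := large n nn0.
set x := n%:R `^ gamma in mx D0x xD.
pose m := (2 * (trunc_log 2 n).+1)%N.
have n3 : (2 < n)%N by exact: leq_trans n03 nn0.
have npos : (0 < n)%N by exact: ltn_trans n3.
have x0 : 0 <= x by exact: powR_ge0.
have [g [g_gt0 xg gx]] : exists g : nat, [/\ (0 < g)%N, x <= g%:R & g%:R <= x + 1].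
  exists (Num.truncn x).+1; split; [by []|exact/ltW/truncnS_gt|].
  by rewrite -natr1 lerD2r truncn_le.
have x1 : 1 <= x by rewrite -[leLHS](powRr0 n%:R) ler_powR ?ler1n // ltW.
have xn : x <= n%:R by rewrite -[leRHS]powRr1 // ler_powR ?ler1n // ltW.
pose D := minn Delta n.
have xDn : x <= D%:R by rewrite /D; case: leqP => _ //; exact: ltW.
have Dnpos : (0 < D)%N by rewrite leq_min Dpos npos.
have Pex : exists P, (D <= P ^ k.-1 * g)%N.
  exists n; apply: (@leq_trans (n ^ k.-1)); last by rewrite leq_pmulr.
  apply: leq_trans (geq_minr _ _) _; by rewrite -{1}[n]expn1 leq_pexp2l.
(* The least number of classes for which [D / P ^ k.-1], about the expected degree inside a class,
   is at most [g]. *)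
have [P DP Pmin] := ex_minnP Pex.
have Pn : (P <= n)%N.
  apply: Pmin; apply: (@leq_trans (n ^ k.-1)); last by rewrite leq_pmulr.
  apply: leq_trans (geq_minr _ _) _; by rewrite -{1}[n]expn1 leq_pexp2l.
have P0 : (0 < P)%N by case: (P) DP => //; rewrite exp0n // mul0n leqNgt Dnpos.
have gP : (g * P ^ k.-1 <= 2 ^ k.-1 * D)%N.
  case: (ltnP 1 P) => [P1|P1].
    have lt : (P.-1 ^ k.-1 * g < D)%N.
      rewrite ltnNge; apply/negP => /Pmin; by rewrite leqNgt prednK ?leqnn.
    apply: (@leq_trans (g * (2 * P.-1) ^ k.-1)).
      rewrite leq_mul2l leq_exp2r // mul2n -addnn -{1}(prednK P0) -addn1 leq_add2l.
      by rewrite -ltnS prednK // P1 orbT.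
    by rewrite expnMn mulnCA leq_mul2l [(g * _)%N]mulnC (ltnW lt) orbT.
  have -> : P = 1%N by apply/eqP; rewrite eqn_leq P1 P0.
  rewrite exp1n muln1; apply: (@leq_trans (2 * D)); last first.
    by rewrite leq_mul2r -{1}[2%N]expn1 leq_pexp2l ?orbT.
  rewrite -(ler_nat R) natrM; lra.
(* [m] serves the union bound, as [n ^ 2 <= 2 ^ m]; [2 * g] leaves a factor 2 above the expected
   degree. *)
pose z := (m + 2 * g)%N.
have z5 : z%:R <= 5 * x by rewrite /z natrD natrM -/m in mx *; lra.
have zD0 : (D0 <= z)%N.
  apply: (@leq_trans g); last by rewrite /z mul2n -addnn addnA leq_addl.
  by rewrite -(ler_nat R); exact: le_trans D0x xg.
have [Q [Qle Qcol]] := col z zD0.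
have PQ : (P * Q)%N%:R <= palette_size k (10 * C)%:R gamma Delta.
  apply: palette_size_ge => //.
  have L0 : 0 < ln n%:R :> R by exact: lt_le_trans ltr01 ln1.
  rewrite -(ler_pM2r L0).
  have min := min_over_ln Dpos npos ln1.
  (* Since [z] is at least [n ^ gamma], its logarithm is smaller than [ln n] by a factor [gamma] at
     worst. *)
  have xz : gamma * ln n%:R <= ln z%:R.
    rewrite -ln_powR -/x ler_ln ?posrE ?(lt_le_trans ltr01 x1) //.
    by apply: le_trans xg _; rewrite ler_nat /z mul2n -addnn addnA leq_addl.
  have Qg : Q%:R ^+ k.-1 * (gamma * ln n%:R) <= (5 * C)%:R * g%:R.
    apply: (@le_trans _ _ (Q%:R ^+ k.-1 * ln z%:R)); first by rewrite ler_wpM2l ?exprn_ge0.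
    apply: (@le_trans _ _ (C%:R * z%:R)); first exact: Qle.
    rewrite natrM [5 * _]mulrC -mulrA ler_wpM2l //.
    by apply: le_trans z5 _; rewrite ler_wpM2l.
  have step1 : (P * Q)%N%:R ^+ k.-1 * (gamma * ln n%:R) <= (10 * C)%:R ^+ k.-1 * D%:R.
    rewrite natrM exprMn -mulrA.
    apply: (@le_trans _ _ (P%:R ^+ k.-1 * ((5 * C)%:R * g%:R))).
      by apply: ler_wpM2l Qg; rewrite exprn_ge0.
    rewrite mulrCA [P%:R ^+ _ * _]mulrC -!natrX -!natrM ler_nat.
    apply: (@leq_trans (5 * C * (2 ^ k.-1 * D))); first by rewrite leq_mul2l gP orbT.
    rewrite mulnA leq_mul2r; apply/orP; right.
    have -> : (10 * C = 5 * C * 2)%N by rewrite mulnAC.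
    rewrite expnMn leq_mul2r; apply/orP; right.
    by rewrite -{1}[(5 * C)%N]expn1 leq_pexp2l // muln_gt0 C0.
  rewrite [leLHS](_ : _ = (P * Q)%N%:R ^+ k.-1 * (gamma * ln n%:R) * ln Delta%:R); last by ring.
  apply: le_trans (ler_wpM2r lnD0 step1) _.
  by rewrite -!mulrA ler_wpM2l ?exprn_ge0.
have Pw : (P <= #|V|.+1)%N by rewrite Vn leqW.
have [A [AW Arun]] := algorithm_exists R P0 Pw (ltn_trans (isT : (0 < 2)%N) hk) (Qcol V).
rewrite Vn in AW; exists A; split.
  rewrite AW; apply: space; apply: le_trans z5 _.
  by rewrite ler_wpM2r // ler_nat leq_addl.
move=> E u l ED s ps; have lu : linear_uniform k E by rewrite /linear_uniform u l.
apply: le_trans (Arun E lu s _ ps PQ).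
rewrite -Vn; apply: (@good_partition_prob R V k P D m z E) => //.
- by move=> v; rewrite leq_min (bounded_by_max_degree ED) -Vn (degree_le_card v hk lu).
- by rewrite /z leq_addr.
- by rewrite /z addKn mulnCA leq_mul2l DP.
- by rewrite Vn /m mulnC expnM leq_exp2r // ltnW // trunc_log_ltn.
Qed.
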